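(* Let $m\in\{2,3,4\}$ and let $n\ge 1$. Then for each integer $k$ with $1\le k\le\binom{n+m-2}{m-1}$ there exists a scaling matrix $w\in(\mathbb{R}^* )^{m\times n}$ such that the scaled Segre embedding $X_w$ of $\mathbb{P}^{m-1}\times\mathbb{P}^{n-1}$ satisfies $\operatorname{mldeg}(X_w)=k$.
   Context: For $w\in(\mathbb{C}^* )^{m\times n}$, $X_w\subseteq\mathbb{P}^{mn-1}$ is the Zariski closure of the image of $\mathbb{P}^{m-1}\times\mathbb{P}^{n-1}\to\mathbb{P}^{mn-1}$, $(s,t)\mapsto(w_{ij}s_it_j)_{i\in[m],j\in[n]}$. ML degree: $\operatorname{mldeg}(X_w)$ is the number of complex critical points of the log-likelihood function $\sum_{i,j}u_{ij}\log p_{ij}$ (with the normalization $\sum p_{ij}=1$, i.e. of $\sum u_{ij}\log p_{ij}-(\sum u_{ij})\log(\sum p_{ij})$ on the projective variety) on the regular locus of $X_w$ minus the hypersurface $\{(\prod p_{ij})(\sum p_{ij})=0\}$, for generic data $u\in\mathbb{N}^{m\times n}$. Equivalently, it is the number, for generic $u$, of complex matrices $p=(p_{ij})$ in the affine cone over $X_w$ (i.e. $p_{ij}=w_{ij}s_it_j$ for some $s\in\mathbb{C}^m$, $t\in\mathbb{C}^n$) having the same row sums and the same column sums as $u$. *)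

(* Defs.v *)
From HB Require Import structures.
From mathcomp Require Import all_boot all_order all_algebra.
From mathcomp Require Import mpoly complex reals.

Set Implicit Arguments.
Unset Strict Implicit.
Unset Printing Implicit Defensive.

Import Order.TTheory GRing.Theory Num.Theory.
Local Open Scope ring_scope.

(* The coordinate ring of the space of m x n
   matrices over F is {mpoly F[m * n]}, the variable of entry (i, j) being
   number mxvec_index i j.  A projective variety in P^(mn-1) is represented by
   its affine cone, a predicate on m x n matrices. *)

Section MaximumLikelihoodDegree.

Variables (F : fieldType) (m n : nat).
Implicit Types (f h : {mpoly F[m * n]}) (p q v w : 'M[F]_(m, n)).
Implicit Types (X : 'M[F]_(m, n) -> Prop) (u : 'M[nat]_(m, n)).

Definition mxeval f p : F := f.@[fun l => mxvec p 0 l].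

Definition vanishes_on X f : Prop := forall q, X q -> mxeval f q = 0.

Definition zariski_closure X p : Prop :=
  forall f, vanishes_on X f -> mxeval f p = 0.

Definition segre_map w (s : 'rV[F]_m) (t : 'rV[F]_n) : 'M[F]_(m, n) :=
  \matrix_(i, j) (w i j * s 0 i * t 0 j).

(* The affine cone over X_w.  Since the set of all segre_map w s t is stable
   under scaling, its vanishing ideal is homogeneous and its affine Zariski
   closure is the cone over the closure taken in projective space. *)
Definition scaled_segre w : 'M[F]_(m, n) -> Prop :=
  zariski_closure (fun p => exists s t, p = segre_map w s t).

(* v lies in the Zariski tangent space at p of the affine cone X. *)
Definition tangent X p v : Prop :=
  forall f, vanishes_on X f ->
    \sum_(l < m * n) mxeval (f^`M(l)) p * mxvec v 0 l = 0.

Definition is_tangent_space X p (T : {vspace 'M[F]_(m, n)}) : Prop :=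
  forall v, v \in T <-> tangent X p v.

(* Regular points of an irreducible projective variety: the dimension of the
   variety is the least dimension of its Zariski tangent spaces, and the
   regular points are those where it is attained.  The vertex 0 of the cone is
   not a point of the projective variety. *)
Definition regular_point X p : Prop :=
  [/\ X p, p != 0 &
    exists2 T, is_tangent_space X p T &
      forall q T', X q -> q != 0 -> is_tangent_space X q T' ->
        (\dim T <= \dim T')%N].

Definition total p : F := \sum_i \sum_j p i j.

(* The value on v of the differential at p of
   \sum_(i, j) u i j * log (p i j) - (\sum_(i, j) u i j) * log (total p),
   which does not depend on the branches of the logarithm. *)
Definition dloglik u p v : F :=
  \sum_i \sum_j ((u i j)%:R / p i j) * v i j
  - (\sum_i \sum_j u i j)%N%:R / total p * total v.

(* A point of projective space off the hyperplane total p = 0 is represented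
   by its unique representative with total p = 1. *)
Definition critical_point X u p : Prop :=
  [/\ regular_point X p, (forall i j, p i j != 0), total p = 1 &
    forall v, tangent X p v -> dloglik u p v = 0].

(* mldeg X = k: off some proper Zariski closed set of data u there are exactly
   k critical points.  As N^(m x n) is Zariski dense when F has characteristic
   0, at most one k satisfies this. *)
Definition has_mldeg X (k : nat) : Prop :=
  exists2 h, h != 0 &
    forall u, mxeval h (map_mx (fun a : nat => a%:R) u) != 0 ->
      exists r : seq 'M[F]_(m, n),
        [/\ uniq r, size r = k & forall p, p \in r <-> critical_point X u p].

End MaximumLikelihoodDegree.

(* Main.v *)
(* On p = (w_ij s_i t_j) the critical equations say that the row and column sums of p
   are proportional to those of u.  Eliminating t leaves, on the chart s_0 = 1, the
   critical points of a product of powers of the linear forms s_i (i <> 0) and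
   l_j(s) = sum_i w_ij s_i, with exponents minus the row sums and plus the column sums
   of u.  "Exactly k solutions" is a first-order condition on u, so by quantifier
   elimination its truth value is constant off a hypersurface and can be tested on any
   Zariski dense set of data, negative entries being allowed.  Test it on the integer
   data for which all the exponents are positive: then, as Varchenko observed, all the
   critical points are real and there is exactly one in each bounded region of the real
   arrangement of the hyperplanes s_i = 0 and l_j = 0, with s_0 = 0 at infinity.

   It remains to find arrangements with k bounded regions.  By deletion-restriction a
   new hyperplane adds the number of bounded regions of its own section.  Hyperplanes
   are added one by one, generic or through one fresh vertex, which loses one bounded
   region; for m = 4 one starts from a cone over a planar arrangement, whose apex absorbs
   many regions at once.  Repeated columns do not change the number of regions. *)

Require Import Defs.
From HB Require Import structures.
From mathcomp Require Import all_boot all_order all_algebra all_field.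
From mathcomp Require Import mpoly boolp classical_sets reals topology.
From mathcomp Require Import normedtype derive realfun complex polyrcf.
From mathcomp Require Import ring lra zify.

Set Implicit Arguments.
Unset Strict Implicit.
Unset Printing Implicit Defensive.

Import Order.TTheory GRing.Theory Num.Theory.
Local Open Scope ring_scope.

(** For m = 4 and N generic columns the count is ['C(N + 2, 3)], and repeated columns leave only the
    values above the one for N - 1 columns to be reached. The same reduction for m = 3 asks for
    fewer than N losses, and every line but the first can lose one region: this just suffices. For m
    = 4 any number below ['C(N + 1, 2)] has to be lost, far more than one for each plane. Hence the
    cone. If b of the column planes form a cone, ['C(b + 1, 3)] regions disappear at once; each of D
    < b regions lost in its planar base is lost again in every later plane section, which costs N -
    b + 1 regions; and each of the N - b planes outside the cone can lose one more. [bin_greedy]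
    shows that these three kinds of losses reach every total needed. The apex (0 : 0 : 1 : 1) lies
    on e and s_1 but off s_2 and s_3, so each of the latter cuts the cone in a copy of its base. The
    third coordinate of the base stands for s_2 - s_3, which is no member of the spatial
    arrangement; this is why the planar construction keeps its line s_2 apart. *)

(** * Linear forms, flats and points that avoid them *)

Section Dot.
Variables (F : fieldType) (m : nat).
Implicit Types (h x y : 'rV[F]_m) (S : seq 'rV[F]_m).

Definition dot h x : F := \sum_i h 0 i * x 0 i.

Lemma dotDl h g x : dot (h + g) x = dot h x + dot g x.
Proof. by rewrite -big_split; apply: eq_bigr => i _; rewrite mxE mulrDl. Qed.

Lemma dotZl c h x : dot (c *: h) x = c * dot h x.
Proof. by rewrite mulr_sumr; apply: eq_bigr => i _; rewrite mxE mulrA. Qed.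

Lemma dotC h x : dot h x = dot x h.
Proof. by apply: eq_bigr => i _; rewrite mulrC. Qed.

Lemma dotDr h x y : dot h (x + y) = dot h x + dot h y.
Proof. by rewrite dotC dotDl !(dotC h). Qed.

Lemma dotZr c h x : dot h (c *: x) = c * dot h x.
Proof. by rewrite dotC dotZl dotC. Qed.

Lemma dotNr h x : dot h (- x) = - dot h x.
Proof. by rewrite -scaleN1r dotZr mulN1r. Qed.

Lemma dotBr h x y : dot h (x - y) = dot h x - dot h y.
Proof. by rewrite dotDr dotNr. Qed.

Lemma dotr0 h : dot h 0 = 0.
Proof. by rewrite -(scale0r 0) dotZr mul0r. Qed.

Lemma dot0r x : dot 0 x = 0.
Proof. by rewrite dotC dotr0. Qed.

Lemma dot_delta i x : dot (delta_mx 0 i) x = x 0 i.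
Proof.
rewrite /dot (bigD1 i) //= mxE !eqxx mul1r big1 ?addr0 // => j ij.
by rewrite mxE (negbTE ij) andbF mul0r.
Qed.

Definition kills S x := all (fun h => dot h x == 0) S.

Lemma killsP S x : reflect {in S, forall h, dot h x = 0} (kills S x).
Proof. by apply: (iffP allP) => H h hS; apply/eqP/H. Qed.

Lemma killsD S x y : kills S x -> kills S y -> kills S (x + y).
Proof.
by move=> /killsP Sx /killsP Sy; apply/killsP => h hS; rewrite dotDr Sx ?Sy ?addr0.
Qed.

Lemma killsZ S c x : kills S x -> kills S (c *: x).
Proof. by move=> /killsP Sx; apply/killsP => h hS; rewrite dotZr Sx ?mulr0. Qed.

Lemma kills0 S : kills S 0.
Proof. by apply/killsP => h _; rewrite dotr0. Qed.

Lemma kills_span S x h : kills S x -> h \in <<S>>%VS -> dot h x = 0.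
Proof.
move=> /killsP Sx /(@coord_span _ _ _ (in_tuple S)) -> /=.
elim/big_rec: _ => [|i y _ IH]; first by rewrite dot0r.
by rewrite dotDl dotZl IH Sx ?mulr0 ?addr0 // mem_nth.
Qed.

(** The columns of the cokernel of the matrix of [S] are killed by [S]; not all of them are killed
    by [h], which is outside the row space. *)
Lemma notin_span_kills S h :
  h \notin <<S>>%VS -> exists2 x, kills S x & dot h x != 0.
Proof.
move=> hS; pose M := \matrix_(i < size S) S`_i.
have: ~~ (h <= M)%MS.
  apply: contra hS => /submxP[D ->]; rewrite mulmx_sum_row memv_suml // => i _.
  by rewrite memvZ // rowK memv_span // mem_nth.
rewrite submxE => /eqP nz.
have [j nzj] : exists j, (h *m cokermx M) 0 j != 0.
  apply/existsP; rewrite -negb_forall; apply/negP => /forallP z; apply: nz.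
  by apply/rowP => j; rewrite [RHS]mxE; apply/eqP/z.
exists (col j (cokermx M))^T; last first.
  by move: nzj; rewrite mxE; congr (_ != _); apply: eq_bigr => i _; rewrite !mxE.
apply/killsP => g /(nthP 0)[i iS <-].
have := mulmx_coker M => /matrixP/(_ (Ordinal iS) j); rewrite !mxE => <-.
by apply: eq_bigr => l _; rewrite !mxE.
Qed.

Lemma free_kills h S : free (h :: S) -> exists2 x, kills S x & dot h x != 0.
Proof. by rewrite free_cons => /andP[/notin_span_kills]. Qed.

Lemma kills_free h S x : free S -> kills S x -> dot h x != 0 -> free (h :: S).
Proof.
move=> fS Sx hx; rewrite free_cons fS andbT; apply: contra hx => hS.
by rewrite (kills_span Sx hS).
Qed.

Lemma free_full S x : free S -> size S = m -> kills S x -> x = 0.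
Proof.
move=> fS sS Sx; apply/rowP => i; rewrite mxE -dot_delta.
apply: (kills_span Sx); suff -> : <<S>>%VS = fullv by rewrite memvf.
by apply/eqP; rewrite eqEdim subvf /= dimvf (eqP fS) sS /dim /= mul1n.
Qed.

Lemma free_notin S : (size S < m)%N -> exists h, h \notin <<S>>%VS.
Proof.
move=> sS; apply: contrapT => /forallNP H.
suff E : <<S>>%VS = fullv.
  by have := dim_span S; rewrite E dimvf /dim /= mul1n leqNgt sS.
by apply/vspaceP => h; rewrite memvf; apply: contrapT => hS; apply: (H h); apply/negP.
Qed.

Lemma nontrivial_kills S : (size S < m)%N -> exists2 x, kills S x & x != 0.
Proof.
move=> /free_notin[h /notin_span_kills[x Sx hx]]; exists x => //.
by apply: contraNneq hx => ->; rewrite dotr0.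
Qed.

End Dot.

Section RealDot.
Variables (R : realFieldType) (m : nat).
Implicit Types (h v x y : 'rV[R]_m) (S X : seq 'rV[R]_m).

Lemma dot_gt0 x : x != 0 -> 0 < dot x x.
Proof.
move=> x0; rewrite lt_def sumr_ge0 ?andbT => [|i _]; last by rewrite -expr2 sqr_ge0.
apply: contra x0; rewrite psumr_eq0 => [|i _]; last by rewrite -expr2 sqr_ge0.
by move=> /allP H; apply/eqP/rowP => i; have := H i (mem_index_enum _);
   rewrite mxE mulf_eq0 orbb => /eqP.
Qed.

(** If [S] does not kill [v], every nonzero point of the flat is off the line of [v]; in the other
    case the flat is large enough to contain a nonzero point orthogonal to [v]. *)
Lemma kills_off_line S v : free S -> (size S < m)%N ->
  ~~ kills S v || (size S < m.-1)%N ->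
  exists2 x, kills S x & forall c, x != c *: v.
Proof.
move=> fS sS /orP[Sv|sS'].
  have [x Sx x0] := nontrivial_kills sS; exists x => // c.
  apply: contra Sv => /eqP E; have c0 : c != 0.
    by apply: contraNneq x0 => c0; rewrite E c0 scale0r.
  by rewrite -[v](scalerK c0) -E killsZ.
have [x] : exists2 x, kills (v :: S) x & x != 0.
  by apply: nontrivial_kills; rewrite /= -ltn_predRL.
rewrite /= => /andP[vx Sx] x0; exists x => // c.
apply: contra x0 => /eqP E; move: vx; rewrite E dotZr mulf_eq0.
case/orP=> [/eqP->|vv]; first by rewrite scale0r.
suff /eqP-> : v == 0 by rewrite scaler0.
by apply: contraLR vv => /dot_gt0 /gt_eqF ->.
Qed.

Lemma avoid_finite (bad : seq R) : exists t, t \notin bad.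
Proof.
exists (1 + \sum_(b <- bad) `|b|); apply/negP => tb.
have s0 : 0 <= \sum_(b <- bad) `|b| by rewrite sumr_ge0.
have : `|1 + \sum_(b <- bad) `|b| | <= \sum_(b <- bad) `|b|.
  by rewrite [leRHS](big_rem _ tb) /= lerDl sumr_ge0.
by rewrite ger0_norm ?addr_ge0 // gerDr ler10.
Qed.

(** The component of [x] orthogonal to [v] does it. *)
Lemma form_off_line x v : (forall c, x != c *: v) ->
  exists2 h, dot h v = 0 & dot h x != 0.
Proof.
move=> xv; have [->|v0] := eqVneq v 0.
  exists x; rewrite ?dotr0 // gt_eqF ?dot_gt0 //.
  by have := xv 0; rewrite scale0r.
pose h := x - (dot v x / dot v v) *: v.
have vv : dot v v != 0 by rewrite gt_eqF ?dot_gt0.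
have hv : dot h v = 0.
  by rewrite dotC dotBr dotZr divfK // subrr.
exists h => //; have -> : dot h x = dot h h.
  by rewrite {2}/h dotBr dotZr hv mulr0 subr0.
by rewrite gt_eqF ?dot_gt0 // subr_eq0.
Qed.

(** On the pencil [h + t *: g] each point excludes at most one value of [t]. Where [g] vanishes the
    listed quotient is the default 0, harmless to avoid, and [h] alone decides. *)
Lemma generic_form v X : (forall x, x \in X -> forall c, x != c *: v) ->
  exists2 h, dot h v = 0 & forall x, x \in X -> dot h x != 0.
Proof.
elim: X => [|x X IH] H; first by exists 0; rewrite ?dot0r.
have [|h hv hX] := IH; first by move=> y yX; apply: H; rewrite inE yX orbT.
have [|g gv gx] := @form_off_line x v; first by apply: H; rewrite mem_head.
have [t tbad] := avoid_finite [seq - dot h y / dot g y | y <- x :: X].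
exists (h + t *: g) => [|y yX]; first by rewrite dotDl dotZl hv gv mulr0 addr0.
rewrite dotDl dotZl; have [gy|gy] := eqVneq (dot g y) 0.
  rewrite gy mulr0 addr0 hX //; move: yX; rewrite inE => /predU1P[E|//].
  by rewrite -E gy eqxx in gx.
apply: contra tbad => /eqP E; apply/mapP; exists y => //.
by apply: (canRL (mulfK gy)); apply/eqP; rewrite -addr_eq0 addrC E.
Qed.

End RealDot.

(** * Bounded regions of an arrangement and deletion-restriction *)

Section Regions.
Variables (R : realFieldType) (m : nat) (e : 'rV[R]_m).
Implicit Types (H K v x : 'rV[R]_m) (A E : seq 'rV[R]_m) (s : seq bool) (b : bool).

(* An arrangement is a list A of forms; e is the hyperplane at infinity, E a list
   of forms cutting out the flat to which A is restricted, and a list of signs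
   stands for the region of that flat on which the members of A have these signs. *)
Definition signed b (r : R) := if b then r else - r.

Definition pos A s x := all2 (fun K b => 0 < signed b (dot K x)) A s.
Definition nneg A s v := all2 (fun K b => 0 <= signed b (dot K v)) A s.

Definition feasible E A s := exists x, [/\ kills E x, dot e x = 1 & pos A s x].

(** Excluding the directions killed by [A] makes boundedness relative: a direction along which all
    of [A] is constant does not count. *)
Definition recedes E A s :=
  exists v, [/\ kills (e :: E) v, nneg A s v & ~~ kills A v].

Definition bounded_region E A s := feasible E A s /\ ~ recedes E A s.

Definition nregions E A k := exists l : seq (seq bool),
  [/\ uniq l, size l = k & forall s, s \in l <-> bounded_region E A s].

Lemma signedD b r r' : signed b (r + r') = signed b r + signed b r'.
Proof. by case: b => //=; rewrite opprD. Qed.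

Lemma signedM b c r : signed b (c * r) = c * signed b r.
Proof. by case: b => //=; rewrite mulrN. Qed.

Lemma signed_eq0 b r : (signed b r == 0) = (r == 0).
Proof. by case: b => //=; rewrite oppr_eq0. Qed.

Lemma posD A s x y : pos A s x -> nneg A s y -> pos A s (x + y).
Proof.
elim: A s => [|K A IH] [|b s] //= /andP[Kx Ax] /andP[Ky Ay].
by rewrite dotDr signedD ltr_wpDr //= IH.
Qed.

Lemma nnegZ A s c y : 0 <= c -> nneg A s y -> nneg A s (c *: y).
Proof.
move=> c0; elim: A s => [|K A IH] [|b s] //= /andP[Ky Ay].
by rewrite dotZr signedM mulr_ge0 //= IH.
Qed.

Lemma nnegD A s x y : nneg A s x -> nneg A s y -> nneg A s (x + y).
Proof.
elim: A s => [|K A IH] [|b s] //= /andP[Kx Ax] /andP[Ky Ay].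
by rewrite dotDr signedD addr_ge0 //= IH.
Qed.

Lemma posZ A s c y : 0 < c -> pos A s y -> pos A s (c *: y).
Proof.
move=> c0; elim: A s => [|K A IH] [|b s] //= /andP[Ky Ay].
by rewrite dotZr signedM mulr_gt0 //= IH.
Qed.

Lemma pos_nneg A s x : pos A s x -> nneg A s x.
Proof.
by elim: A s => [|K A IH] [|b s] //= /andP[/ltW -> /IH].
Qed.

Lemma pos_perturb A s x v : pos A s x ->
  exists2 d : R, 0 < d & forall t : R, `|t| <= d -> pos A s (x + t *: v).
Proof.
elim: A s => [|K A IH] [|b s] //= => [_|/andP[Kx /IH[d d0 dA]]].
  by exists 1.
pose d' := signed b (dot K x) / (1 + `|signed b (dot K v)|).
have q0 : 0 < 1 + `|signed b (dot K v)| by rewrite ltr_pwDl.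
have d'0 : 0 < d' by rewrite divr_gt0.
exists (Num.min d d'); first by rewrite lt_min d0.
move=> t; rewrite le_min => /andP[/dA-> td']; rewrite andbT.
rewrite dotDr dotZr signedD signedM -ltrBlDl sub0r.
rewrite ltrNl (le_lt_trans (ler_norm _)) // normrN normrM.
rewrite (le_lt_trans (ler_wpM2r _ td')) // /d' mulrAC ltr_pdivrMr //.
by rewrite mulrDr mulr1 ltrDr.
Qed.

Lemma nneg_kills A s v : nneg A s v -> nneg A s (- v) -> kills A v.
Proof.
elim: A s => [|K A IH] [|b s] //= /andP[Kv Av] /andP[].
rewrite -{1}scaleN1r dotZr signedM mulN1r oppr_ge0 => K'v /(IH _ Av) ->.
by rewrite andbT -(signed_eq0 b) eq_le Kv K'v.
Qed.

Lemma kills_nneg A s v : size A = size s -> kills A v -> nneg A s v.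
Proof.
elim: A s => [|K A IH] [|b s] //= [/IH H] /andP[/eqP-> /H ->].
by case: b; rewrite /= ?oppr0 lexx.
Qed.

Lemma size_pos A s x : pos A s x -> size A = size s.
Proof. by elim: A s => [|K A IH] [|b s] //= /andP[_ /IH->]. Qed.

Lemma size_nneg A s x : nneg A s x -> size A = size s.
Proof. by elim: A s => [|K A IH] [|b s] //= /andP[_ /IH->]. Qed.

Section DeletionRestriction.
Variables (E A : seq 'rV[R]_m) (H : 'rV[R]_m).
(** Without [spanH] a direction neglected for [A] could count for [H :: A]; [nconstH] makes [H] cut
    the affine flat properly. *)
Hypothesis spanH : forall v, kills (e :: E) v -> kills A v -> dot H v = 0.
Hypothesis nconstH : exists2 v, kills (e :: E) v & dot H v != 0.

Lemma feasible_cons b s : feasible E (H :: A) (b :: s) -> feasible E A s.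
Proof. by case=> x [Ex ex /= /andP[_ Ax]]; exists x. Qed.

Lemma feasible_restr s : feasible (H :: E) A s -> feasible E A s.
Proof. by case=> x [/= /andP[_ Ex] ex Ax]; exists x. Qed.

Lemma feasible_restr_cons b s :
  feasible (H :: E) A s -> feasible E (H :: A) (b :: s).
Proof.
case=> x [/= /andP[/eqP Hx Ex] ex Ax].
case: nconstH => v /= /andP[/eqP ev Ev] Hv.
have [d d0 /(_ _)dA] := pos_perturb v Ax.
pose t := if 0 < signed b (dot H v) then d else - d.
exists (x + t *: v); split.
- by rewrite killsD ?killsZ.
- by rewrite dotDr dotZr ev mulr0 addr0.
rewrite /= dA ?andbT; last by rewrite /t; case: ifP; rewrite ?normrN gtr0_norm.
rewrite dotDr Hx add0r dotZr signedM /t; case: (ltrP 0 (signed b _)) => Hv'; first exact: mulr_gt0.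
by rewrite mulNr -mulrN mulr_gt0 // oppr_gt0 lt_neqAle signed_eq0 Hv.
Qed.

Lemma feasible_split s : feasible E A s ->
  exists b, feasible E (H :: A) (b :: s).
Proof.
case=> x [Ex ex Ax]; have [Hx|Hx] := eqVneq (dot H x) 0.
  exists true; apply: feasible_restr_cons; exists x.
  by rewrite /= Hx eqxx.
exists (0 < dot H x); exists x; split=> //=; rewrite Ax andbT.
by case: (ltrP 0 (dot H x)) => //= Hx'; rewrite oppr_gt0 lt_neqAle Hx.
Qed.

(** The segment between the two points meets [H]; the weights are their distances from [H]. *)
Lemma feasible_cross s : feasible E (H :: A) (true :: s) ->
  feasible E (H :: A) (false :: s) -> feasible (H :: E) A s.
Proof.
case=> x [Ex ex /= /andP[Hx Ax]] [y [Ey ey /= /andP[Hy Ay]]].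
pose p := dot H x; pose q := - dot H y.
have pq : 0 < p + q by rewrite addr_gt0.
exists ((p + q)^-1 *: (q *: x + p *: y)); split.
- rewrite /= killsZ ?killsD ?killsZ // andbT dotZr dotDr !dotZr.
  by rewrite [X in _ * X](_ : _ = 0) ?mulr0 // /q /p; ring.
- by rewrite dotZr dotDr !dotZr ex ey !mulr1 addrC mulVf // addrC gt_eqF.
by rewrite posZ ?invr_gt0 // posD ?pos_nneg // posZ.
Qed.

Lemma recedes_cons b s v : kills (e :: E) v -> nneg A s v -> ~~ kills A v ->
  0 <= signed b (dot H v) -> recedes E (H :: A) (b :: s).
Proof.
move=> Ev Av Av0 Hv; exists v; split => //=; first by rewrite Hv.
by rewrite (negbTE Av0) andbF.
Qed.

Lemma recedes_restr b s : recedes (H :: E) A s -> recedes E (H :: A) (b :: s).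
Proof.
case=> v [/= /and3P[ev Hv Ev] Av Av0]; apply: (recedes_cons _ Av Av0).
  by rewrite /= ev.
by rewrite (eqP Hv); case: b => //=; rewrite oppr0.
Qed.

Lemma bounded_cons b s : ~ recedes E A s -> ~ recedes E (H :: A) (b :: s).
Proof.
move=> nr [v [Ev /= /andP[_ Av] nv]]; apply: nr; exists v; split => //.
by apply: contra nv => /= Av0; rewrite Av0 (spanH Ev Av0) eqxx.
Qed.

(** Together with [bounded_and] this shows, for each [s], that the two pieces contain as many
    bounded regions as the uncut region and its section by [H]; summing over [s] gives
    [nregions_cons]. *)
Lemma bounded_or s : bounded_region E A s \/ bounded_region (H :: E) A s <->
  bounded_region E (H :: A) (true :: s) \/ bounded_region E (H :: A) (false :: s).
Proof.
have [P1|nP1] := pselect (bounded_region E A s).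
  split=> _; last by left.
  by case: P1 => /feasible_split[[] F] /bounded_cons B; [left|right].
split.
  case=> // -[F2 B2]; have F1 := feasible_restr F2.
  have [v [Ev Av Av0]] : recedes E A s by apply: contrapT => B1; apply: nP1.
  have Hv : dot H v != 0.
    apply: contra_notN B2 => Hv; exists v; split => //.
    by move: Ev => /= /andP[-> ->]; rewrite Hv.
  suff [b B] : exists b, ~ recedes E (H :: A) (b :: s).
    by case: b B => B; [left|right]; split => //; apply: feasible_restr_cons.
  (* The bounded piece is the one from which [v] leads to [H]: a recession direction [w] of it
     combines with [v] to a direction [z] inside [H], which is trivial because the section is
     bounded, and then [- w] recedes as well. *)
  exists (dot H v < 0) => -[w [Ew /= /andP[Hw Aw] /negP]]; apply.
  pose a := `|dot H v|; pose c := signed (dot H v < 0) (dot H w).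
  have a0 : 0 < a by rewrite normr_gt0.
  pose z := a *: w + c *: v.
  have Az : nneg A s z by rewrite nnegD ?nnegZ // ltW.
  have Hz : dot H z = 0.
    rewrite dotDr !dotZr /a /c; case: (ltrP (dot H v) 0) => v0 /=.
      by rewrite ltr0_norm //; ring.
    by rewrite ger0_norm //; ring.
  have Ez : kills (e :: E) z by rewrite killsD ?killsZ.
  have Az0 : kills A z.
    apply: contra_notT B2 => Az0; exists z; split => //.
    by move: Ez => /= /andP[-> ->]; rewrite Hz eqxx.
  have Aw0 : kills A w.
    apply: (nneg_kills Aw).
    have -> : - w = a^-1 *: (c *: v - z).
      by rewrite opprD addrCA subrr addr0 scalerN scalerK // gt_eqF.
    rewrite nnegZ ?invr_ge0 ?(ltW a0) // nnegD ?nnegZ //.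
    by rewrite -scaleN1r kills_nneg ?killsZ ?(size_nneg Az).
  by rewrite Aw0 (spanH Ew Aw0) eqxx.
(* As the piece is bounded, [v] must point from it towards [H]; the ray from [x] along [v] reaches
   [H] at time [t] without leaving the region of [A]. *)
have one b : bounded_region E (H :: A) (b :: s) ->
    bounded_region (H :: E) A s.
  case=> F B; have F1 := feasible_cons F.
  have [v [Ev Av Av0]] : recedes E A s by apply: contrapT => B1; apply: nP1.
  split; last by apply: contra_not B; apply: recedes_restr.
  have Hv : signed b (dot H v) < 0.
    rewrite ltNge; apply/negP => Hv; apply: B; exact: (recedes_cons Ev Av Av0).
  case: F => x [Ex ex /= /andP[Hx Ax]].
  pose t := signed b (dot H x) / - signed b (dot H v).
  have t0 : 0 <= t by rewrite divr_ge0 ?ltW // oppr_gt0.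
  move: Ev => /= /andP[/eqP ev Ev].
  exists (x + t *: v); split.
  - rewrite /= killsD ?killsZ // andbT -(signed_eq0 b) dotDr signedD dotZr signedM.
    by rewrite /t invrN mulrN mulNr divfK ?subrr // lt_eqF.
  - by rewrite dotDr dotZr ev mulr0 addr0.
  by rewrite posD ?nnegZ.
by case=> /one; right.
Qed.

Lemma bounded_and s : bounded_region E A s /\ bounded_region (H :: E) A s <->
  bounded_region E (H :: A) (true :: s) /\ bounded_region E (H :: A) (false :: s).
Proof.
split=> [[[F1 B1] [F2 B2]]|[[Ft Bt] [Ff Bf]]].
  by split; split; do ?[exact: feasible_restr_cons|exact: bounded_cons].
split; split; last first.
- by apply: contra_not Bt; apply: recedes_restr.
- exact: feasible_cross.
- case=> v [Ev Av Av0]; case: (lerP 0 (dot H v)) => Hv.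
    by apply: Bt; apply: (recedes_cons Ev Av Av0).
  by apply: Bf; apply: (recedes_cons Ev Av Av0); rewrite /= oppr_ge0 ltW.
exact: feasible_cons Ft.
Qed.

Lemma nregions_cons k1 k2 :
  nregions E A k1 -> nregions (H :: E) A k2 -> nregions E (H :: A) (k1 + k2).
Proof.
case=> l1 [u1 <- P1] [l2 [u2 <- P2]].
pose P b s := `[< bounded_region E (H :: A) (b :: s) >].
pose l := undup (l1 ++ l2).
have PE b s : P b s <-> bounded_region E (H :: A) (b :: s) by split=> /asboolP.
have PO s : (s \in l1) || (s \in l2) = P true s || P false s.
  apply/orP/orP; rewrite !PE P1 P2 => /bounded_or //.
have PP s : (s \in l1) && (s \in l2) = P true s && P false s.
  by apply/andP/andP; rewrite !PE P1 P2 => /bounded_and.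
have sz l' : uniq l' -> {subset l' <= l} -> size l' = count (mem l') l.
  move=> u' s'; rewrite -size_filter; apply/perm_size/uniq_perm => // [|s].
    by rewrite filter_uniq ?undup_uniq.
  by rewrite mem_filter; case: (boolP (s \in l')) => [/[dup] sl /s' ->|sl];
     rewrite inE ?sl // (negbTE sl).
exists ([seq true :: s | s <- l & P true s] ++
        [seq false :: s | s <- l & P false s]); split.
- rewrite cat_uniq !map_inj_uniq ?filter_uniq ?undup_uniq //= => [|? ? []|? ? []] //.
  by rewrite andbT; apply/hasPn => _ /mapP[s _ ->]; apply/mapP => -[].
- rewrite size_cat !size_map !size_filter [size l1]sz 1?[size l2]sz //; last first.
  + by move=> s; rewrite mem_undup mem_cat => ->.
  + by move=> s; rewrite mem_undup mem_cat => ->; rewrite orbT.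
  elim: (l) => //= s l' IH; rewrite addnACA IH [RHS]addnACA; congr addn.
  move: (PO s) (PP s) => /=.
  by case: (s \in l1); case: (s \in l2); case: (P true s); case: (P false s).
move=> [|b s].
  split=> [|[[x []]]//]; rewrite mem_cat => /orP[] /mapP[] //.
rewrite mem_cat; split.
  by case/orP=> /mapP[s' + [-> ->]]; rewrite mem_filter => /andP[/PE].
move=> /[dup] B /PE Pbs; have sl : s \in l.
  by rewrite mem_undup mem_cat PO; case: b Pbs {B} => ->; rewrite ?orbT.
by apply/orP; case: b Pbs {B} => Pbs; [left|right]; apply: map_f; rewrite mem_filter Pbs.
Qed.

End DeletionRestriction.

Section Counting.
Variable E : seq 'rV[R]_m.

(** Every region recedes along [v] or [- v], which move only [H]. *)
Lemma nregions_parallel A H v : kills (e :: E) v -> kills A v -> dot H v != 0 ->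
  nregions E (H :: A) 0.
Proof.
move=> Ev Av Hv; exists [::]; split=> // -[|b s].
  by split=> // -[[x []]].
split=> // -[[x [_ _ /= /andP[_ /size_pos sA]]]]; case.
pose w := (if 0 < signed b (dot H v) then 1 else -1) *: v.
exists w; split=> /=; first exact: (killsZ _ Ev).
  rewrite dotZr signedM kills_nneg ?killsZ // andbT.
  case: (ltrP 0 (signed b (dot H v))) => Hv'; first by rewrite mul1r ltW.
  by rewrite mulN1r oppr_ge0.
rewrite dotZr mulf_eq0 (negbTE Hv) orbF.
by case: ifP; rewrite ?oppr_eq0 oner_eq0.
Qed.

Lemma nregions_vanish A K : K \in A ->
  (forall x, kills E x -> dot K x = 0) -> nregions E A 0.
Proof.
move=> KA K0; exists [::]; split=> // s; split=> // -[[x [Ex _ Ax]] _].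
elim: A s KA Ax => [|L A IH] [|b s] //=.
rewrite inE => /predU1P[<- /andP[]|/IH H /andP[_ /H]//].
by rewrite K0 //; case: b; rewrite /= ?oppr0 ltxx.
Qed.

Lemma nregions_point A x : kills E x -> dot e x = 1 ->
  (forall v, kills (e :: E) v -> v = 0) ->
  (forall L, L \in A -> dot L x != 0) -> nregions E A 1.
Proof.
move=> Ex ex E0 Ax; exists [:: [seq 0 < dot L x | L <- A]]; split=> // s.
have Ux y : kills E y -> dot e y = 1 -> y = x.
  move=> Ey ey; apply/eqP; rewrite -subr_eq0; apply/eqP/E0.
  by rewrite /= dotBr ex ey subrr eqxx killsD // -scaleN1r killsZ.
rewrite inE; split=> [/eqP ->|[[y [Ey ey]]]]; last first.
  rewrite (Ux y) // => + _; elim: (A) s Ax => [|L A' IH] [|b s] //= Ax /andP[Lx /IH/eqP->].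
    by case: b Lx => /=; [move=> ->|rewrite oppr_gt0 => /ltW; rewrite leNgt => /negbTE ->].
  by move=> K KA; apply: Ax; rewrite inE KA orbT.
split=> [|[v [/E0 -> _]]]; last first.
  by rewrite kills0.
exists x; split=> //; elim: (A) Ax => //= L A' IH Ax.
rewrite IH ?andbT => [|K KA]; last by apply: Ax; rewrite inE KA orbT.
have := Ax L; rewrite mem_head => /(_ isT).
by case: (ltrP 0 (dot L x)) => //= Lx Lx0; rewrite oppr_gt0 lt_neqAle Lx0.
Qed.

(** Here [K] meets the flat at infinity only, so just one of its signs occurs. *)
Lemma nregions_const A K x k : kills E x -> dot e x = 1 -> dot K x != 0 ->
  (forall v, kills (e :: E) v -> dot K v = 0) ->
  nregions E A k -> nregions E (K :: A) k.
Proof.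
move=> Ex ex Kx K0 [l [ul <- lP]].
have KE y : kills E y -> dot e y = 1 -> dot K y = dot K x.
  move=> Ey ey; apply/eqP; rewrite -subr_eq0 -dotBr; apply/eqP/K0.
  by rewrite /= dotBr ex ey subrr eqxx killsD // -scaleN1r killsZ.
pose t := 0 < dot K x.
have st b : (0 < signed b (dot K x)) = (b == t).
  rewrite /t; case: (ltrP 0 (dot K x)) => Kx'; case: b => //=.
  - by rewrite oppr_gt0 lt_gtF.
  - by rewrite ltNge Kx'.
  - by rewrite oppr_gt0 lt_neqAle Kx.
exists [seq t :: s | s <- l]; split; first by rewrite map_inj_uniq // => ? ? [].
  by rewrite size_map.
move=> [|b s]; first by split=> [/mapP[]|[[y []]]].
split=> [/mapP[s' /lP[[y [Ey ey Ay]] nr] [-> ->]]|].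
  split; first by exists y; rewrite /= Ay KE // st eqxx.
  apply: contra_not nr => -[v [Ev /= /andP[_ Av] nAv]]; exists v; split=> //.
  by apply: contra nAv => /= ->; rewrite K0 // eqxx.
move=> [[y [Ey ey /= /andP[Ky Ay]]] nr].
have -> : b = t by apply/eqP; rewrite -st -(KE _ Ey ey).
apply: map_f; apply/lP; split; first by exists y.
apply: contra_not nr => -[v [Ev Av nAv]]; exists v; split=> //=.
  by rewrite K0 // Av; case: (b); rewrite /= ?oppr0 lexx.
by rewrite (negbTE nAv) andbF.
Qed.

End Counting.

(** The section by [K] lies in the hyperplane [L] of [A], hence has no region of its own. *)
Lemma nregions_stale E A K L k : L \in A ->
  (forall x, kills (K :: E) x -> dot L x = 0) ->
  (exists2 v, kills (e :: E) v & dot K v != 0) ->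
  (forall v, kills (e :: E) v -> kills A v -> dot K v = 0) ->
  nregions E A k -> nregions E (K :: A) k.
Proof.
move=> LA KL nK sK nA; rewrite -[k]addn0; apply: nregions_cons => //.
exact: nregions_vanish LA KL.
Qed.

End Regions.

(** The sign vectors stay the same and only the points are transported, along a surjection of flats.
    It serves to identify a plane section of a cone with its base. *)
Lemma nregions_map (R : realFieldType) m n (e : 'rV[R]_m) (e' : 'rV[R]_n)
    (f : 'rV[R]_n -> 'rV[R]_m) E E' (lift : 'rV[R]_m -> 'rV[R]_n) A k :
  (forall x, exists2 y, kills E' y & f y = x) ->
  (forall y, kills E' y -> kills E (f y)) ->
  (forall K y, dot (lift K) y = dot K (f y)) -> lift e = e' ->
  nregions e E A k -> nregions e' E' (map lift A) k.
Proof.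
move=> fS fE fL le [l [ul <- lP]]; exists l; split=> // s; rewrite {}lP.
have kA y : kills (map lift A) y = kills A (f y).
  by rewrite /kills all_map; apply: eq_all => K /=; rewrite fL.
have pA s' y : pos (map lift A) s' y = pos A s' (f y).
  by elim: (A) s' => [|K A' IH] [|b s'] //=; rewrite fL IH.
have nA s' y : nneg (map lift A) s' y = nneg A s' (f y).
  by elim: (A) s' => [|K A' IH] [|b s'] //=; rewrite fL IH.
have fe y : dot e' y = dot e (f y) by rewrite -le fL.
split=> -[[x [Ex ex Ax]] nr]; split.
- have [y Ey fy] := fS x; exists y; rewrite fe pA fy; split=> //.
- apply: contra_not nr => -[y [/= /andP[ey Ey] Ay ny]]; exists (f y).
  by rewrite /= -fe ey fE // -nA -kA.
- by exists (f x); rewrite -fe -pA fE.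
- apply: contra_not nr => -[y [/= /andP[ey Ey] Ay ny]].
  have [z Ez fz] := fS y; exists z.
  by rewrite /= fe nA kA fz ey Ez.
Qed.

(** * Points on a line, and hyperplanes in general position *)

Section Generic.
Variables (R : realFieldType) (m : nat).
Implicit Types (e H K L v x : 'rV[R]_m) (A B E S : seq 'rV[R]_m).

Lemma perm_free_imp S S' : free S -> perm_eq S S' -> free S'.
Proof. by move=> + /perm_free <-. Qed.

Lemma free_behead H S : free (H :: S) -> free S.
Proof. by rewrite free_cons => /andP[]. Qed.

Lemma kills_free_full S : size S = m -> (forall x, kills S x -> x = 0) -> free S.
Proof.
move=> sS S0; have spanS : <<S>>%VS = fullv.
  apply/vspaceP => h; rewrite memvf; apply: contrapT => /negP /notin_span_kills.
  by case=> x /S0 ->; rewrite dotr0 eqxx.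
by rewrite /free spanS dimvf /dim /= mul1n sS.
Qed.

Lemma free_line S Z x y : (size S).+1 = m -> free (Z :: S) -> y != 0 ->
  kills S x -> kills S y -> exists c, x = c *: y.
Proof.
move=> sS fZ y0 Sx Sy.
have Zy : dot Z y != 0.
  apply: contra y0 => Zy; apply/eqP/(free_full fZ) => //=.
  by rewrite Zy Sy.
exists (dot Z x / dot Z y); apply/eqP; rewrite -subr_eq0; apply/eqP/(free_full fZ) => //=.
by rewrite dotBr dotZr divfK // subrr eqxx killsD // -scaleN1r !killsZ.
Qed.

Lemma free_point e E : free (e :: E) -> exists2 x, kills E x & dot e x = 1.
Proof.
move=> /free_kills[x Ex ex]; exists ((dot e x)^-1 *: x); first exact: killsZ.
by rewrite dotZr mulVf.
Qed.

Section Line.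
Variables (e : 'rV[R]_m) (E : seq 'rV[R]_m).
(** Under the freeness assumptions below, the flat is an affine line in the chart and each form a
    point on it. *)
Hypothesis sE : (size E).+2 = m.

Lemma kills_line A L v : L \in A -> free (e :: L :: E) ->
  kills (e :: E) v -> kills A v -> v = 0.
Proof.
move=> LA fL /= /andP[ev Ev] Av; apply: (free_full fL) => //=.
by rewrite ev Ev (killsP _ _ Av) ?eqxx.
Qed.

Lemma free_cross K : free (e :: K :: E) ->
  exists2 v, kills (e :: E) v & dot K v != 0.
Proof.
move=> fK; apply: free_kills; apply: (perm_free_imp fK).
by apply/permP => p /=; lia.
Qed.

Lemma nregions_line1 K : free (e :: K :: E) -> nregions e E [:: K] 0.
Proof.
by move=> /free_cross[v Ev Kv]; apply: (nregions_parallel Ev).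
Qed.

(** The section by [K] is a single point off all the others, which counts as one bounded region. *)
Lemma line_fresh A K L k : L \in A -> free (e :: L :: E) -> free (e :: K :: E) ->
  {in A, forall L, free (L :: K :: E)} ->
  nregions e E A k -> nregions e E (K :: A) k.+1.
Proof.
move=> LA fL fK fA nA; rewrite -[k.+1]addn1; apply: nregions_cons => //.
- by move=> v Ev Av; rewrite (kills_line LA fL Ev Av) dotr0.
- exact: free_cross.
have [x KEx ex] := free_point fK.
apply: (nregions_point KEx ex) => [v Ev|M MA].
  by apply: (free_full fK) => //=; rewrite sE.
apply/eqP => Mx; have x0 : x = 0.
  by apply: (free_full (fA M MA)) => //=; rewrite ?sE // Mx eqxx.
by move/eqP: ex; rewrite x0 dotr0 eq_sym oner_eq0.
Qed.

(** The common zero [x] spans the section by [K], so [M] vanishes on all of it. *)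
Lemma line_stale A K L M x k : L \in A -> free (e :: L :: E) -> free (e :: K :: E) ->
  M \in A -> x != 0 -> kills (M :: K :: E) x ->
  nregions e E A k -> nregions e E (K :: A) k.
Proof.
move=> LA fL fK MA x0 /= /andP[/eqP Mx KEx].
apply: (nregions_stale MA) => [y KEy||v Ev Av].
- have [c ->] := free_line (S := K :: E) sE fK x0 KEy KEx.
  by rewrite dotZr Mx mulr0.
- exact: free_cross.
by rewrite (kills_line LA fL Ev Av) dotr0.
Qed.

Lemma line_fresh_cat A B L k : L \in B ->
  {in A ++ B, forall K, free (e :: K :: E)} -> uniq (A ++ B) ->
  {in A & A ++ B, forall K L, K != L -> free (L :: K :: E)} ->
  nregions e E B k -> nregions e E (A ++ B) (size A + k).
Proof.
move=> LB + + + nB; elim: A => [|K A IH] //= fe /andP[KAB uAB] fp.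
apply: (@line_fresh _ _ L); rewrite ?mem_cat ?LB ?orbT //.
- by apply: fe; rewrite inE mem_cat LB !orbT.
- by apply: fe; rewrite mem_head.
- move=> M MAB; apply: fp; rewrite ?mem_head // ?inE ?MAB ?orbT //.
  by apply: contraNneq KAB => ->.
apply: IH => // [M MAB|M N MA NAB]; first by apply: fe; rewrite inE MAB orbT.
by apply: fp; rewrite inE ?MA ?NAB orbT.
Qed.

Lemma nregions_line A : A != [::] -> {in A, forall K, free (e :: K :: E)} ->
  uniq A -> {in A &, forall K L, K != L -> free (L :: K :: E)} ->
  nregions e E A (size A).-1.
Proof.
case/lastP: A => // A K _; rewrite -cats1 => fe uA fp.
rewrite size_cat /= addn1 -[X in nregions _ _ _ X]addn0.
apply: (@line_fresh_cat _ _ K) => //; first by rewrite inE.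
  by move=> M N MA; apply: fp; rewrite mem_cat MA.
by apply: nregions_line1; apply: fe; rewrite mem_cat inE eqxx orbT.
Qed.

End Line.

(* The point v is the only one at which H is allowed to meet a flat of the
   arrangement B that it would miss in general position; v = 0 allows none. *)
Definition generic v B H := dot H v = 0 /\
  forall S, all (mem B) S -> free S -> (size S < m)%N ->
    [|| v == 0, ~~ kills S v | (size S < m.-1)%N] -> free (H :: S).

Fixpoint lists_of (T : Type) (B : seq T) n : seq (seq T) :=
  if n is n'.+1 then [seq z :: l | z <- B, l <- lists_of B n'] else [:: [::]].

Lemma mem_lists_of (T : eqType) (B l : seq T) :
  all (mem B) l -> l \in lists_of B (size l).
Proof.
elim: l => [|z l IH] //= /andP[zB /IH lB].
by apply/allpairsPdep; exists z, l.
Qed.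

(** Only finitely many flats of [B] matter. Each contains a point off the line of [v], at which it
    is enough that [H] does not vanish; [generic_form] treats all these points at once. *)
Lemma exists_generic v B : exists H, generic v B H.
Proof.
pose T := flatten [seq lists_of B n | n <- iota 0 m].
pose good S := [&& free S, (size S < m)%N & [|| v == 0, ~~ kills S v | (size S < m.-1)%N]].
have [X Xv XT] : exists2 X : seq 'rV[R]_m, (forall x, x \in X -> forall c, x != c *: v) &
    forall S, S \in T -> good S -> exists2 x, x \in X & kills S x.
  elim: T => [|S T [X Xv XT]]; first by exists [::].
  have [/and3P[fS sS gS]|bS] := boolP (good S); last first.
    by exists X => // S'; rewrite inE => /predU1P[->|/XT//]; rewrite (negbTE bS).
  have [x Sx xv] : exists2 x, kills S x & forall c, x != c *: v.
    case/orP: gS => [/eqP->|]; last exact: kills_off_line.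
    by have [x Sx x0] := nontrivial_kills sS; exists x => // c; rewrite scaler0.
  exists (x :: X) => [y|S'].
    by rewrite inE => /predU1P[->|/Xv].
  rewrite inE => /predU1P[-> _|/XT H /H[y yX S'y]]; first by exists x; rewrite ?mem_head.
  by exists y; rewrite // inE yX orbT.
have [H Hv HX] := generic_form Xv; exists H; split=> // S SB fS sS gS.
have [||x xX Sx] := XT S; last by apply: (kills_free fS Sx); apply: HX.
  apply/flatten_mapP; exists (size S); last exact: mem_lists_of.
  by rewrite mem_iota.
exact/and3P.
Qed.

End Generic.

Definition coord_form (F : fieldType) n (i : nat) : 'rV[F]_n.+1 := delta_mx 0 (inord i).

Lemma dot_coord (F : fieldType) n i (x : 'rV[F]_n.+1) :
  dot (coord_form F n i) x = x 0 (inord i).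
Proof. exact: dot_delta. Qed.

Lemma coord_neq (F : fieldType) n i j : (i <= n)%N -> (j <= n)%N -> i != j ->
  coord_form F n i != coord_form F n j.
Proof.
move=> ni nj ij; apply/eqP => /matrixP/(_ 0 (inord i)); rewrite !mxE !eqxx /=.
rewrite -val_eqE /= !inordK // (negbTE ij) => /eqP.
by rewrite oner_eq0.
Qed.

Ltac perm_from F :=
  apply: (perm_free_imp F); apply/permP => ? /=; ring.

(** * Line arrangements with prescribed losses *)

Section Planar.
Variable R : realFieldType.
Implicit Types (H K c v x : 'rV[R]_3) (A B S : seq 'rV[R]_3).
Local Notation e := (coord_form R 2 0).
Local Notation s1 := (coord_form R 2 1).
Local Notation s2 := (coord_form R 2 2).

Lemma dot3E H x : dot H x = H 0 (inord 0) * x 0 (inord 0) +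
  H 0 (inord 1) * x 0 (inord 1) + H 0 (inord 2) * x 0 (inord 2).
Proof.
rewrite /dot !big_ord_recl big_ord0 addr0 addrA.
by congr (_ * _ + _ * _ + _ * _); congr (_ _ _); apply: val_inj; rewrite /= inordK.
Qed.

Lemma ord3P (i : 'I_3) : [\/ i = inord 0, i = inord 1 | i = inord 2].
Proof.
case: i => -[|[|[|//]]] i; [constructor 1|constructor 2|constructor 3];
by apply: val_inj; rewrite /= inordK.
Qed.

Lemma row3_eq0 x : x 0 (inord 0) = 0 -> x 0 (inord 1) = 0 -> x 0 (inord 2) = 0 -> x = 0.
Proof. by move=> ? ? ?; apply/rowP => i; rewrite mxE; case: (ord3P i) => ->. Qed.

(* The last clause provides the next line of the construction with a vertex v
   through which only two of the lines pass. *)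
Definition planar B k : Prop :=
  [/\ uniq [:: s2, e & B ++ [:: s1]],
      {in e :: B ++ [:: s1] &, forall K L, K != L -> free [:: K; L; s2]},
      nregions e [::] (B ++ [:: s1]) k,
      {in B, forall c i, c 0 i != 0} &
      exists H B' v Y, [/\ B = H :: B', v != 0 /\ Y \in [:: e; s1], kills [:: H; Y] v &
        {in [:: s2, e & B' ++ [:: s1]], forall K, dot K v = 0 -> K = Y}]].

Let neq01 : e != s1. Proof. exact: coord_neq. Qed.
Let neq02 : e != s2. Proof. exact: coord_neq. Qed.
Let neq12 : s1 != s2. Proof. exact: coord_neq. Qed.

Lemma planar_init : exists c, planar [:: c] 0.
Proof.
pose c : 'rV[R]_3 := const_mx 1.
have cE i : c 0 i = 1 by rewrite mxE.
have nc i : (i <= 2)%N -> coord_form R 2 i != c.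
  move=> i2; have [j j2 ij] : exists2 j, (j <= 2)%N & j != i.
    by exists (i == 0)%N; case: i i2.
  apply/eqP => /matrixP/(_ 0 (inord j)); rewrite cE !mxE eqxx /= -val_eqE /=.
  by rewrite !inordK // (negbTE ij) => /esym/eqP; rewrite oner_eq0.
have k01 x : kills [:: e; s1; s2] x -> x = 0.
  by rewrite /= !dot_coord => /and4P[/eqP? /eqP? /eqP? _]; apply: row3_eq0.
have kc i x : kills [:: c; coord_form R 2 i; s2] x -> i \in [:: 0; 1]%N -> x = 0.
  rewrite /= dot3E !dot_coord !cE !mul1r => /and4P[/eqP + /eqP + /eqP + _].
  move=> cx ix x2; rewrite !inE => /orP[] /eqP E; move: cx; rewrite E in ix;
  by rewrite ix x2 ?add0r !addr0 => ?; apply: row3_eq0.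
exists c; split.
- rewrite /= !inE !negb_or [s2 == e]eq_sym [s2 == s1]eq_sym [c == s1]eq_sym.
  by rewrite neq02 neq12 neq01 !nc.
- have f1 : free [:: e; s1; s2] by apply: kills_free_full.
  have f2 i : i \in [:: 0; 1]%N -> free [:: c; coord_form R 2 i; s2].
    by move=> i01; apply: kills_free_full => // x /kc; apply.
  move=> K L; rewrite !inE => /or3P[]/eqP-> /or3P[]/eqP->; rewrite ?eqxx // => _;
    do ?[exact: f1 | exact: (f2 0%N) | exact: (f2 1%N) | perm_from f1
        | perm_from (f2 0%N isT) | perm_from (f2 1%N isT)].
(* As a point, [s2] is the direction of the line [s1], along which only [c] varies. *)
- apply: (@nregions_parallel _ _ _ _ _ _ s2); rewrite /= ?dot_coord ?dot3E !mxE ?cE.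
  + by rewrite -!val_eqE /= !inordK //= eqxx.
  + by rewrite -!val_eqE /= !inordK //= eqxx.
  + by rewrite -!val_eqE /= !inordK //= !mulr0 !add0r mulr1 oner_eq0.
- by move=> d; rewrite inE => /eqP -> i; rewrite cE oner_eq0.
(* The vertex of [c] and [s1], which lies off [e] and [s2]. *)
pose v : 'rV[R]_3 := e - s2.
have v0 : v 0 (inord 0) = 1.
  by rewrite !mxE -!val_eqE /= !inordK //= subr0.
have v1 : v 0 (inord 1) = 0.
  by rewrite !mxE -!val_eqE /= !inordK //= subr0.
have v2 : v 0 (inord 2) = -1.
  by rewrite !mxE -!val_eqE /= !inordK //= sub0r.
exists c, [::], v, s1; split=> //.
- split; last by rewrite !inE eqxx orbT.
  by apply/eqP => /matrixP/(_ 0 (inord 0)); rewrite v0 mxE => /eqP; rewrite oner_eq0.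
- by rewrite /= dot3E !dot_coord !cE v0 v1 v2 !mul1r addr0 subrr eqxx.
move=> K; rewrite !inE => /or3P[]/eqP-> //; rewrite dot_coord ?v0 ?v2 => /eqP;
by rewrite ?oppr_eq0 oner_eq0.
Qed.

(* d tells whether the new line is drawn through the distinguished vertex, which
   costs one bounded region. *)
Lemma planar_cons B k (d : bool) : planar B k ->
  exists H, planar (H :: B) (k + (size B - d)).
Proof.
set A := B ++ [:: s1].
case=> uA fA nA cA [H0 [B' [v [Y [BE [v0 Yes] /and3P[/eqP H0v /eqP Yv _] vP]]]]].
pose w := if d then v else 0.
have [H [Hw gH]] := exists_generic w [:: s2, e & A].
set W := [:: s2, e & A] in uA gH *.
have H0B : H0 \in B by rewrite BE mem_head.
have s1A : s1 \in A by rewrite mem_cat inE eqxx orbT.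
have eA0 : forall x, kills (e :: A) x -> x = 0.
  move=> x /killsP z; have x0 := z e (mem_head _ _).
  have x1 : dot s1 x = 0 by apply: z; rewrite inE s1A orbT.
  have xH : dot H0 x = 0 by apply: z; rewrite inE mem_cat H0B orbT.
  rewrite !dot_coord in x0 x1; apply: row3_eq0 => //.
  move: xH; rewrite dot3E x0 x1 !mulr0 !add0r => /eqP.
  by rewrite mulf_eq0 (negbTE (cA _ H0B _)) => /eqP.
have fWK K L : K \in W -> L \in W -> K != L -> free [:: K; L].
  have f2 M : M \in e :: A -> free [:: M; s2].
    move=> MA; have [E|Ms1] := eqVneq M s1.
      have := fA e s1; rewrite !inE s1A eqxx orbT => /(_ isT isT neq01).
      by move=> /free_behead; rewrite E.
    have := fA s1 M; rewrite MA !inE s1A orbT eq_sym => /(_ isT isT Ms1).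
    exact: free_behead.
  rewrite /W !(in_cons s2) => /orP[/eqP->|KA] /orP[/eqP->|LA] KL.
  - by rewrite eqxx in KL.
  - by perm_from (f2 _ LA).
  - exact: f2.
  have /(perm_free_imp (S' := [:: s2; K; L])) := fA K L KA LA KL.
  by move=> f; apply: (@free_behead _ _ s2); apply: f; apply/permP => ? /=; ring.
have W0 K : K \in W -> free [:: K].
  move=> KW; have [E|Ke] := eqVneq K e.
    have := fWK s1 e; rewrite /W !inE s1A !eqxx !orbT => /(_ isT isT).
    by rewrite eq_sym neq01 E => /(_ isT)/free_behead.
  have := fWK e K; rewrite KW /W !inE eqxx orbT eq_sym => /(_ isT isT Ke).
  exact: free_behead.
have HK K : K \in W -> free [:: H; K].
  by move=> KW; apply: gH; rewrite /= ?KW ?orbT ?W0 //.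
have HW : H \notin W.
  by apply/negP => /HK /free_uniq; rewrite /= inE eqxx.
have HKL K L : K \in W -> L \in W -> K != L ->
    [|| ~~ d, dot K v != 0 | dot L v != 0] -> free [:: H; K; L].
  move=> KW LW KL dKL; apply: gH; rewrite /= ?KW ?LW ?fWK //.
  by rewrite /w; case: (d) dKL => /=; rewrite ?eqxx // !andbT !negb_and orbF => ->; rewrite orbT.
have vW K : K \in W -> K != H0 -> K != Y -> dot K v != 0.
  move=> KW KH0 KY; apply: contraNneq KY => /vP -> //.
  by move: KW; rewrite /W /A BE !inE /= (negbTE KH0) /= => /or3P[->|->|->]; rewrite ?orbT.
have s2v : dot s2 v != 0.
  apply: vW; rewrite ?inE ?eqxx //.
    by apply: contraTneq uA => E; rewrite /= !inE mem_cat -/A E H0B !orbT.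
  move: Yes; rewrite !inE => /orP[]/eqP->; by rewrite eq_sym.
have es1v : Y != e -> dot e v != 0.
  move=> Ye; apply: vW; rewrite ?inE ?eqxx ?orbT // 1?eq_sym //.
  by apply: contraTneq uA => E; rewrite /= mem_cat -E H0B /= andbF.
have s1v : Y != s1 -> dot s1 v != 0.
  move=> Ye; apply: vW; rewrite ?inE ?s1A ?orbT // 1?eq_sym //.
  apply: contraTneq uA => E; rewrite /A /= cat_uniq /= orbF -E H0B /=.
  by rewrite !andbF.
have eW : e \in W by rewrite !inE eqxx orbT.
have s1W : s1 \in W by rewrite !inE s1A !orbT.
have s2W : s2 \in W by rewrite mem_head.
have AW K : K \in A -> K \in W by move=> KA; rewrite !inE KA !orbT.
have eA K : K \in A -> e != K.
  by move=> KA; apply: contraTneq uA => E; rewrite /= E KA andbF.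
have HKLF : ~~ d -> forall K L, K \in W -> L \in W -> K != L -> free [:: H; K; L].
  by move=> dF K L KW LW KL; apply: HKL; rewrite ?dF.
(* The lines of [A] meet [H] in [size B + 1] points, hence in [size B] intervals; passing through
   [v] makes two of the points coincide or sends one to infinity. *)
have nH : nregions e [:: H] A (size B - d).
  case: (boolP d) => [dT|dF]; last first.
    have -> : (size B - false = (size A).-1)%N by rewrite size_cat /= addn1 subn0.
    apply: nregions_line => //; first by rewrite /A; case: (B).
    - by move=> K KA; perm_from (HKLF dF e K eW (AW _ KA) (eA _ KA)).
    - by move: uA => /and3P[].
    by move=> K L KA LA KL; perm_from (HKLF dF K L (AW _ KA) (AW _ LA) KL).
  have Hv : dot H v = 0 by rewrite -Hw /w dT.
  pose A' := B' ++ [:: s1]; have AE : A = H0 :: A' by rewrite /A BE.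
  have A'A K : K \in A' -> K \in A by rewrite AE inE orbC => ->.
  have H0A : H0 \in A by rewrite AE mem_head.
  have s1A' : s1 \in A' by rewrite mem_cat inE eqxx orbT.
  have H0A' : H0 \notin A' by move: uA => /and3P[_ _]; rewrite AE => /andP[].
  have v2 K L : K \in e :: A' -> L \in e :: A' -> K != L ->
      (dot K v != 0) || (dot L v != 0).
    move=> KA LA; apply: contraNT; rewrite negb_or !negbK => /andP[/eqP Kv /eqP Lv].
    have KY : K = Y by apply: vP Kv; rewrite in_cons KA orbT.
    have LY : L = Y by apply: vP Lv; rewrite in_cons LA orbT.
    by rewrite KY LY.
  have n' : nregions e [:: H] A' (size B - true).
    have -> : (size B - true = (size A').-1)%N by rewrite size_cat BE /= addn1 subn1.
    apply: nregions_line => //; first by rewrite /A'; case: (B').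
    - move=> K KA'; have KA := A'A _ KA'; have := HKL e K eW (AW _ KA) (eA _ KA).
      rewrite v2 ?orbT ?inE ?eqxx ?KA' ?orbT //; last exact: eA.
      by move=> /(_ isT) f; perm_from f.
    - by move: uA => /and3P[_ _]; rewrite AE => /andP[].
    move=> K L KA' LA' KL; have := HKL K L (AW _ (A'A _ KA')) (AW _ (A'A _ LA')) KL.
    rewrite v2 ?orbT ?inE ?KA' ?LA' ?orbT //.
    by move=> /(_ isT) f; perm_from f.
  rewrite AE; move: Yes; rewrite !inE => /orP[]/eqP YE; rewrite {}YE in Yv vP es1v s1v.
    (* If [Y] is [e], then [v] is at infinity: [H] is parallel to [H0], which is constant on it. *)
    have fHH0 : free [:: H; H0; s1].
      apply: HKL => //; [exact: AW | by apply: contraNneq H0A' => -> |].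
      by rewrite (s1v neq01) !orbT.
    have [x Hx ex] : exists2 x, kills [:: H] x & dot e x = 1.
      by apply: free_point; perm_from (HK e eW).
    apply: (nregions_const Hx ex) => // [|y /= /and3P[ey Hy _]].
      apply/eqP => H0x; have [r xr] : exists r, x = r *: v.
        apply: (free_line (S := [:: H; H0]) (Z := s1)) => //=; first by perm_from fHH0.
        + by move: Hx => /= /andP[-> _]; rewrite H0x eqxx.
        by rewrite Hv H0v !eqxx.
      by move/eqP: ex; rewrite xr dotZr Yv mulr0 eq_sym oner_eq0.
    have [r ->] : exists r, y = r *: v.
      apply: (free_line (S := [:: H; e]) (Z := s1)) => //=.
      + have := HKL e s1 eW s1W neq01; rewrite s1v // !orbT => /(_ isT) f.
        by perm_from f.
      + by rewrite Hy ey.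
      by rewrite Hv Yv !eqxx.
    by rewrite dotZr H0v mulr0.
  (* If [Y] is [s1], then [H0] and [s1] meet [H] in the same point [v]. *)
  have ev : dot e v != 0 by apply: es1v; rewrite eq_sym.
  apply: (@line_stale _ _ _ _ _ _ _ s1 s1 v) => //=.
  - have := HKL e s1 eW s1W neq01; rewrite ev orbT => /(_ isT) f; perm_from f.
  - have := HKL e H0 eW (AW _ H0A) (eA _ H0A); rewrite ev orbT => /(_ isT) f; perm_from f.
  by rewrite Yv Hv H0v !eqxx.
(* The next vertex must not be [v], through which [H0] passes as well: once [H] has used a vertex on
   [s1], the next one is at infinity, and conversely. *)
pose Y' := if d && (Y == s1) then e else s1.
have Y'W : Y' \in W by rewrite /Y'; case: ifP.
have Y'v : ~~ d || (dot Y' v != 0).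
  rewrite /Y'; case: (d) => //=; have [E|E] := eqVneq Y s1; last exact: s1v.
  by apply: es1v; rewrite E eq_sym.
have [v' Hv' v'0] : exists2 v', kills [:: H; Y'] v' & v' != 0 by apply: nontrivial_kills.
exists H; split.
- have /perm_uniq -> : perm_eq [:: s2, e & (H :: B) ++ [:: s1]] (H :: W).
    by apply/permP => a /=; rewrite -/A; ring.
  by rewrite cons_uniq HW uA.
- have fHs K : K \in e :: A -> free [:: H; K; s2].
    move=> KA; apply: HKL => //; last by rewrite s2v !orbT.
      by rewrite in_cons KA orbT.
    by apply: contraTneq uA => E; rewrite /W cons_uniq -E KA.
  have KA' K : K \in e :: (H :: B) ++ [:: s1] -> K = H \/ K \in e :: A.
    by rewrite !inE => /or3P[->|/eqP->|->]; [right|left|right; rewrite orbT].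
  move=> K L /KA'[->|KA] /KA'[->|LA] KL; first by rewrite eqxx in KL.
  + exact: fHs.
  + perm_from (fHs _ KA).
  exact: fA.
- apply: nregions_cons => // [v'' ev Av|].
    by rewrite (eA0 v'') ?dotr0 //= Av; move: ev => /= /andP[-> _].
  exact: free_kills (HK e eW).
- move=> c; rewrite inE => /predU1P[->|]; last exact: cA.
  (* A zero coefficient puts [H] through the coordinate point [x], where two of [e], [s1], [s2]
     meet. At most one of these contains [v], so genericity forbids it. *)
  move=> i; apply/eqP => Hi; pose x : 'rV[R]_3 := delta_mx 0 i.
  have dx K : dot K x = K 0 i by rewrite dotC dot_delta.
  have x0 : x != 0.
    by apply/eqP => /matrixP/(_ 0 i); rewrite !mxE !eqxx => /eqP; rewrite oner_eq0.
  suff: x = 0 by move/eqP: x0.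
  have f12 : free [:: H; s1; s2] by apply: HKL; rewrite ?s2v ?orbT.
  have f02 : free [:: H; e; s2] by apply: HKL; rewrite ?s2v ?orbT.
  have f01 : free [:: H; e; s1].
    apply: HKL => //; have [E|/es1v->] := eqVneq Y e; last by rewrite orbT.
    by rewrite s1v ?E ?orbT.
  have cx j : (j <= 2)%N -> inord j != i -> dot (coord_form R 2 j) x = 0.
    by move=> j2 ij; rewrite dx mxE eqxx /= eq_sym (negbTE ij).
  have inordE (a b : nat) : (a <= 2)%N -> (b <= 2)%N -> (inord a == inord b :> 'I_3) = (a == b).
    by move=> a2 b2; rewrite -val_eqE /= !inordK.
  case: (ord3P i) => iE;
    [apply: (free_full f12)|apply: (free_full f02)|apply: (free_full f01)] => //=;
    by rewrite dx Hi !cx ?eqxx // iE inordE.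
exists H, B, v', Y'; split=> //.
  by split=> //; rewrite /Y' !inE; case: ifP; rewrite eqxx ?orbT.
move=> K KW Kv'; apply: contraTeq isT => KY'; suff : v' = 0 by move/eqP: v'0.
have f : free [:: H; K; Y'].
  by apply: HKL => //; move: Y'v => /orP[->|->]; rewrite ?orbT.
apply: (free_full f) => //=.
by move: Hv' => /= /and3P[-> -> _]; rewrite Kv' eqxx.
Qed.

(** The j-th line adds j - 1 regions, or j - 2 when drawn through the vertex; only the first line
    cannot lose any. *)
Lemma planar_exists b D : (0 < b)%N -> (D < b)%N ->
  exists2 B, size B = b & planar B ('C(b, 2) - D).
Proof.
case: b => // b _; elim: b D => [|b IH] D Db.
  have [c pc] := planar_init; exists [:: c] => //.
have [D' [d [DE Db']]] : exists D' (d : bool), D = (D' + d)%N /\ (D' < b.+1)%N.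
  case: D Db => [|D]; first by exists 0%N, false.
  by exists D, true; rewrite addn1.
have [B sB pB] := IH _ Db'; have [H pH] := planar_cons d pB.
exists (H :: B); first by rewrite /= sB.
have -> : ('C(b.+2, 2) - D = 'C(b.+1, 2) - D' + (size B - d))%N; last exact: pH.
rewrite sB DE [in LHS]binS bin1; have : (b <= 'C(b.+1, 2))%N by rewrite binS bin1 leq_addl.
by case: d {pH DE} => /=; lia.
Qed.

Lemma planar_uniq B k : planar B k -> uniq (e :: B ++ [:: s1]).
Proof. by case=> /andP[]. Qed.

(** By the freeness clause of [planar] the lines meet [s2] in distinct points, none of them at
    infinity. *)
Lemma nregions_planar_line B k : planar B k ->
  nregions e [:: s2] (B ++ [:: s1]) (size B).
Proof.
move=> pB; have /andP[eA uA] := planar_uniq pB; case: pB => _ fA _ _ _.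
rewrite (_ : size B = (size (B ++ [:: s1])).-1); last by rewrite size_cat addn1.
apply: nregions_line => //; first by case: (B).
  move=> K KA; apply: fA; rewrite ?inE ?KA ?eqxx ?orbT //.
  by apply: contraNneq eA => ->.
by move=> K L KA LA KL; apply: fA; rewrite ?inE ?KA ?LA ?orbT // eq_sym.
Qed.

Lemma kills_planar B k x : planar B k -> kills (e :: B ++ [:: s1]) x -> x = 0.
Proof.
case=> _ _ _ cB [H [B' [_ [_ [BE _ _ _]]]]] /killsP z.
have x0 : dot e x = 0 by apply: z; rewrite mem_head.
have x1 : dot s1 x = 0 by apply: z; rewrite inE mem_cat !inE eqxx !orbT.
have xH : dot H x = 0 by apply: z; rewrite BE !inE eqxx orbT.
rewrite !dot_coord in x0 x1; apply: row3_eq0 => //.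
move: xH; rewrite dot3E x0 x1 !mulr0 !add0r => /eqP.
by rewrite mulf_eq0 (negbTE (cB H _ _)) ?BE ?mem_head // => /eqP.
Qed.

(** For m = 3 the line [s2], so far only a reference line, joins the arrangement. *)
Lemma nregions_planar B k : planar B k ->
  nregions e [::] (s2 :: B ++ [:: s1]) (k + size B).
Proof.
move=> pB; have [_ fA nB cB [H [B' [_ [_ [BE _ _ _]]]]]] := pB.
apply: nregions_cons => //; last exact: nregions_planar_line pB.
  move=> v ev Bv; rewrite (kills_planar pB (x := v)) ?dotr0 //=.
  by move: ev => /= /andP[-> _].
by exists (delta_mx 0 (inord 2)); rewrite /= dot_coord mxE -!val_eqE /= !inordK //=
  ?oner_eq0 ?eqxx.
Qed.

End Planar.

(** * Plane arrangements built over a cone *)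

Section Spatial.
Variable R : realFieldType.
Implicit Types (H K v x y : 'rV[R]_4) (A B D G S : seq 'rV[R]_4).
Local Notation e := (coord_form R 3 0).
Local Notation s1 := (coord_form R 3 1).
Local Notation s2 := (coord_form R 3 2).
Local Notation s3 := (coord_form R 3 3).

Lemma ord4P (i : 'I_4) : [\/ i = inord 0, i = inord 1, i = inord 2 | i = inord 3].
Proof.
case: i => -[|[|[|[|//]]]] i;
  [constructor 1|constructor 2|constructor 3|constructor 4];
by apply: val_inj; rewrite /= inordK.
Qed.

Lemma dot4E H x : dot H x = H 0 (inord 0) * x 0 (inord 0) +
  H 0 (inord 1) * x 0 (inord 1) + H 0 (inord 2) * x 0 (inord 2) +
  H 0 (inord 3) * x 0 (inord 3).
Proof.
rewrite /dot !big_ord_recl big_ord0 addr0 !addrA.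
by congr (_ * _ + _ * _ + _ * _ + _ * _); congr (_ _ _); apply: val_inj; rewrite /= inordK.
Qed.

(* All the forms lift_form c vanish at apex: they describe a cone over a planar
   arrangement. *)
Definition lift_form (c : 'rV[R]_3) : 'rV[R]_4 :=
  \row_i nth 0 [:: c 0 (inord 0); c 0 (inord 1); c 0 (inord 2); - c 0 (inord 2)] i.

Definition project x : 'rV[R]_3 :=
  \row_i nth 0 [:: x 0 (inord 0); x 0 (inord 1); x 0 (inord 2) - x 0 (inord 3)] i.

Definition apex : 'rV[R]_4 := \row_i (1 < i)%N%:R.

Lemma dot_lift c x : dot (lift_form c) x = dot c (project x).
Proof. by rewrite dot4E dot3E !mxE !inordK //=; ring. Qed.

Lemma kills_lift (C : seq 'rV[R]_3) x : kills (map lift_form C) x = kills C (project x).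
Proof. by rewrite /kills all_map; apply: eq_all => c /=; rewrite dot_lift. Qed.

Lemma lift_coord_form i : (i < 2)%N -> lift_form (coord_form R 2 i) = coord_form R 3 i.
Proof.
move=> i2; have i4 : (i < 4)%N by lia.
have i3 : (i < 3)%N by lia.
apply/rowP => j; rewrite !mxE !eqxx /= -!val_eqE /= !inordK //.
by case: i i2 {i3 i4} => [|[|i]] //; case: j => -[|[|[|[|j]]]] //= _; rewrite ?oppr0.
Qed.

Lemma project_apex : project apex = 0.
Proof.
apply/rowP => i; rewrite !mxE !inordK //=.
by case: i => -[|[|[|i]]] //= _; rewrite subrr.
Qed.

Lemma apex_neq0 : apex != 0.
Proof.
by apply/eqP => /matrixP/(_ 0 (inord 2)) /eqP; rewrite !mxE inordK //= oner_eq0.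
Qed.

Lemma dot_apex i : (i <= 3)%N -> dot (coord_form R 3 i) apex = (1 < i)%N%:R.
Proof. by move=> i3; rewrite dot_coord mxE inordK. Qed.

Lemma kills_project x : project x = 0 -> exists r, x = r *: apex.
Proof.
move=> /matrixP z; exists (x 0 (inord 2)).
have z0 := z 0 (inord 0); have z1 := z 0 (inord 1); have z2 := z 0 (inord 2).
rewrite !mxE !inordK //= in z0 z1 z2.
have {}z2 : x 0 (inord 3) = x 0 (inord 2) by apply/eqP; rewrite eq_sym -subr_eq0 z2.
by apply/rowP => i; rewrite !mxE; case: (ord4P i) => ->;
   rewrite inordK //= ?mulr0 ?mulr1 ?z0 ?z1 ?z2.
Qed.

Lemma project_lin x r : exists2 y, project y = project x & dot s2 y = r.
Proof.
exists (x + (r - x 0 (inord 2)) *: apex).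
  apply/rowP => i; rewrite !mxE !inordK //=.
  by case: i => -[|[|[|i]]] //= _; ring.
by rewrite dot_coord !mxE inordK //=; ring.
Qed.

(** [nregions_cons] adds the head of a list last, so this order builds the cone, cuts it by [s2] and
    [s3], and then adds the planes [G]. *)
Definition spatial_list G L := G ++ [:: s3, s2 & L ++ [:: s1]].

(* T counts the bounded regions of a generic plane section; a plane through the
   vertex v, and generic otherwise, has one bounded region less. *)
Definition spatial G L k T : Prop := let A := spatial_list G L in
  [/\ uniq (e :: A) /\ {in e :: A &, forall K K', K != K' -> free [:: K; K']},
      {in G ++ L, forall K i, K 0 i != 0},
      nregions e [::] A k,
      forall H, generic 0 (e :: A) H -> nregions e [:: H] A T &
      exists v, [/\ exists2 j, j \in [:: 1; 2]%N & dot (coord_form R 3 j) v != 0,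
        forall i, exists2 j, j != i & v 0 j != 0 &
        forall H, generic v (e :: A) H -> nregions e [:: H] A T.-1]].

Lemma coord_in G L i : (i <= 3)%N -> coord_form R 3 i \in e :: spatial_list G L.
Proof.
rewrite !(inE, mem_cat).
by case: i => [|[|[|[|i]]]] //= _; rewrite !eqxx ?orbT.
Qed.

Lemma spatial_listP G L K : K \in e :: spatial_list G L ->
  K \in G ++ L \/ exists2 i, (i <= 3)%N & K = coord_form R 3 i.
Proof.
rewrite in_cons !mem_cat !in_cons mem_cat inE => /predU1P[->|]; first by right; exists 0%N.
case/orP=> [->|]; first by left.
case/or4P=> [/eqP->|/eqP->|->|/eqP->]; last by right; exists 1%N.
- by right; exists 3%N.
- by right; exists 2%N.
by left; rewrite orbT.
Qed.

Lemma free_coords (i : 'I_4) :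
  free (delta_mx 0 i :: [seq delta_mx 0 l : 'rV[R]_4 | l <- rem i (enum 'I_4)]).
Proof.
apply: kills_free_full => [|x].
  by rewrite /= size_map size_rem ?mem_enum // size_enum_ord.
move=> /killsP z; apply/rowP => l; rewrite mxE -dot_delta z //.
rewrite in_cons; have [->|li] := eqVneq l i; first by rewrite eqxx.
by rewrite (map_f (fun l => delta_mx 0 l)) ?orbT // rem_filter ?enum_uniq //
  mem_filter /= li mem_enum.
Qed.

Lemma coordE i l : (i <= 3)%N -> (l <= 3)%N -> coord_form R 3 i 0 (inord l) = (i == l)%:R.
Proof. by move=> i3 l3; rewrite mxE eqxx /= -val_eqE /= !inordK // eq_sym. Qed.

Lemma generic_sub v B B' H : {subset B' <= B} -> generic v B H -> generic v B' H.
Proof.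
move=> sub [Hv gH]; split=> // S SB; apply: gH.
by apply: sub_all SB => K; apply: sub.
Qed.

Lemma size_spatial_list G L : size (spatial_list G L) = (size G + size L).+3.
Proof. by rewrite size_cat /= size_cat /= addn1 !addnS. Qed.

(** [T] grows by the number of intervals that [A] cuts out on the line where [H] meets a generic
    plane. The new vertex is the meeting point of [H], [s3] and one of [s1], [s2]: a further plane
    through it, and generic otherwise, sees [A] as before and loses one interval on its line in
    [H]. *)
Lemma spatial_cons G L k T (d : bool) : spatial G L k T ->
  exists H, spatial (H :: G) L (k + (T - d)) (T + (size G + size L).+2).
Proof.
set A := spatial_list G L; case=> -[uA fA] cA nA secA [v [[j j12 jv] v2 secv]].
set W := e :: A in uA fA secA secv.
pose w := if d then v else 0.
have [H gHW] := exists_generic w W; have [Hw gH] := gHW.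
have cW i : (i <= 3)%N -> coord_form R 3 i \in W by apply: coord_in.
have dW (l : 'I_4) : delta_mx 0 l \in W.
  by rewrite -[l]inord_val; apply: cW; rewrite -ltnS.
have kW x : kills W x -> x = 0.
  by move=> /killsP z; apply/rowP => l; rewrite mxE -dot_delta z.
have cneq i i' : (i <= 3)%N -> (i' <= 3)%N -> i != i' -> coord_form R 3 i != coord_form R 3 i'.
  exact: coord_neq.
have W0 K : K \in W -> free [:: K].
  move=> KW; have [E|Ke] := eqVneq K e.
    by have := fA s1 K (cW 1%N isT) KW; rewrite E cneq // => /(_ isT)/free_behead.
  by have := fA e K (cW 0%N isT) KW; rewrite eq_sym => /(_ Ke)/free_behead.
have HK K : K \in W -> free [:: H; K].
  by move=> KW; apply: gH; rewrite /= ?KW ?W0 ?orbT.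
have HKL K K' : K \in W -> K' \in W -> K != K' -> free [:: H; K; K'].
  by move=> KW KW' KK; apply: gH; rewrite /= ?KW ?KW' ?fA ?orbT.
have HKLM K1 K2 K3 : K1 \in W -> K2 \in W -> K3 \in W -> free [:: K1; K2; K3] ->
    [|| ~~ d, dot K1 v != 0, dot K2 v != 0 | dot K3 v != 0] -> free [:: H; K1; K2; K3].
  move=> KW1 KW2 KW3 fK dK; apply: gH; rewrite /= ?KW1 ?KW2 ?KW3 //.
  by rewrite /w; case: (d) dK => /=; rewrite ?eqxx // andbT !negb_and orbF => ->; rewrite orbT.
have HW : H \notin W.
  by apply/negP => /HK /free_uniq; rewrite /= inE eqxx.
have nH : nregions e [:: H] A (T - d).
  by rewrite /w in gHW; case: (d) gHW => [/secv|/secA]; rewrite ?subn1 ?subn0.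
(* If [H] passes through [v], then [Y] must not, so that no other plane of [W] contains the point
   where [H], [s3] and [Y] meet. *)
have [j' j'12 j'v] : exists2 j', j' \in [:: 1; 2]%N & ~~ d || (dot (coord_form R 3 j') v != 0).
  by exists j; rewrite // jv orbT.
have {}j'12 : (j' == 1)%N || (j' == 2)%N by rewrite !inE in j'12.
have j'3 : (j' <= 3)%N by case/orP: j'12 => /eqP->.
have j'n3 : j' != 3%N by case/orP: j'12 => /eqP->.
set Y := coord_form R 3 j' in j'v.
have YW : Y \in W by apply: cW.
have s3W : s3 \in W by apply: cW.
have s3Y : s3 != Y by rewrite cneq // eq_sym.
have [x Hx x0] : exists2 x, kills [:: H; s3; Y] x & x != 0 by apply: nontrivial_kills.
have uniqx K : K \in W -> dot K x = 0 -> K = s3 \/ K = Y.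
  move=> KW Kx; have [->|Ks3] := eqVneq K s3; first by left.
  have [->|KY] := eqVneq K Y; first by right.
  suff f : free [:: K; s3; Y].
    have /free_full z : free [:: H; K; s3; Y].
      by apply: HKLM => //; case/orP: j'v => ->; rewrite ?orbT.
    have : x = 0 by apply: z => //=; move: Hx => /= /and4P[-> -> -> _]; rewrite Kx eqxx.
    by move/eqP: x0.
  have f3 : free [:: s3; Y] by apply: fA.
  (* A coordinate vector separates [K] from [s3] and [Y]: the first one if [K] is in [G ++ L], whose
     members have no zero coefficient, and its own one if [K] is a coordinate form. *)
  have [l lx] : exists l, [/\ dot s3 (delta_mx 0 l) = 0, dot Y (delta_mx 0 l) = 0 &
      dot K (delta_mx 0 l) != 0].
    have dE M l : dot M (delta_mx 0 l) = M 0 l by rewrite dotC dot_delta.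
    case: (spatial_listP KW) => [KGL|[i i3 E]].
      exists (inord 0); rewrite !dE !coordE //; split=> //; last exact: cA.
      by case/orP: j'12 => /eqP ->.
    rewrite E in Ks3 KY; exists (inord i); rewrite !dE E !coordE // eqxx oner_eq0.
    split=> //; first by have [E3|//] := eqVneq 3%N i; rewrite -E3 eqxx in Ks3.
    by have [Ej|//] := eqVneq j' i; rewrite -Ej eqxx in KY.
  case: lx => l3 lY lK; apply: (kills_free (x := delta_mx 0 l)) => //=.
  by rewrite l3 lY eqxx.
have HWE K : K \in e :: spatial_list (H :: G) L -> K = H \/ K \in W.
  by rewrite !in_cons => /or3P[->|/eqP->|->]; [right|left|right; rewrite orbT].
have WHW : {subset W <= e :: spatial_list (H :: G) L}.
  by move=> K; rewrite !in_cons => /orP[->|->]; rewrite ?orbT.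
have HHW : H \in e :: spatial_list (H :: G) L by rewrite !in_cons eqxx orbT.
have sA : (size A).-1 = (size G + size L).+2 by rewrite size_spatial_list.
have eA K : K \in A -> e != K.
  by move=> KA; apply: contraTneq uA => E; rewrite /= E KA.
have AW K : K \in A -> K \in W by rewrite inE orbC => ->.
have lineA K M H' : K \in W -> M \in W -> K != M -> generic 0 (e :: spatial_list (H :: G) L) H' ->
    free [:: K; M; H; H'].
  move=> KW MW KM [_ gH']; have f : free [:: H'; H; K; M].
    apply: gH'; rewrite ?eqxx //; last exact: HKL.
    by rewrite /= HHW !WHW.
  by perm_from f.
have crossH v' H' : generic v' (e :: spatial_list (H :: G) L) H' ->
    exists2 y, kills [:: e; H'] y & dot H y != 0.
  move=> [_ gH']; apply: free_kills; have f : free [:: H'; H; e].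
    by apply: gH'; rewrite ?orbT //= ?HHW ?HK ?cW ?WHW ?cW.
  by perm_from f.
have killsA H' y : kills [:: e; H'] y -> kills A y -> dot H y = 0.
  by move=> /= /andP[ey _] Ay; rewrite (kW y) ?dotr0 //= ey.
exists H; split.
- split.
    have /perm_uniq -> : perm_eq (e :: spatial_list (H :: G) L) (H :: W).
      by apply/permP => a /=; ring.
    by rewrite cons_uniq HW.
  move=> K K' /HWE[->|KW] /HWE[->|KW'] KK; first by rewrite eqxx in KK.
  + exact: HK.
  + by perm_from (HK _ KW).
  exact: fA.
- move=> K; rewrite in_cons => /predU1P[->|]; last exact: cA.
  (* A zero coefficient puts [H] through the coordinate point [y], cut out by [S]. Since [v] is no
     coordinate point, [S] does not kill it and genericity applies. *)
  move=> i; apply/eqP => Hi; pose y : 'rV[R]_4 := delta_mx 0 i.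
  have y0 : y != 0.
    by apply/eqP => /matrixP/(_ 0 i); rewrite !mxE !eqxx => /eqP; rewrite oner_eq0.
  suff: y = 0 by move/eqP: y0.
  pose S := [seq delta_mx 0 l : 'rV[R]_4 | l <- rem i (enum 'I_4)].
  have sS : size S = 3 by rewrite size_map size_rem ?mem_enum // size_enum_ord.
  have riP l : (l \in rem i (enum 'I_4)) = (l != i).
    by rewrite rem_filter ?enum_uniq // mem_filter mem_enum andbT.
  apply: (@free_full _ _ (H :: S)); rewrite /= ?sS //.
    apply: gH; rewrite ?sS //.
    + by apply/allP => K' /mapP[l _ ->]; apply: dW.
    + exact: free_behead (free_coords i).
    rewrite /w; case: (d); rewrite ?eqxx //; apply/orP; right; apply/orP; left.
    have [l li vl] := v2 i; apply: contra vl => /killsP z.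
    by rewrite -dot_delta z ?map_f ?riP.
  rewrite dotC dot_delta Hi eqxx /=; apply/killsP => K' /mapP[l].
  by rewrite riP => li ->; rewrite dot_delta mxE eqxx (negbTE li).
- apply: nregions_cons => // [y ey Ay|].
    by apply: (killsA 0) => //=; move: ey => /= /andP[-> _]; rewrite dot0r eqxx.
  exact: free_kills (HK e (cW 0%N isT)).
- move=> H' gH'; apply: nregions_cons; first exact: killsA.
  + exact: crossH gH'.
  + by apply: secA; apply: generic_sub gH'.
  rewrite -sA; apply: nregions_line => //.
  + by rewrite -size_eq0 size_spatial_list.
  + by move=> K KA; apply: lineA => //; [exact: cW|exact: AW|exact: eA].
  + by move: uA => /andP[].
  by move=> K M KA MA KM; apply: lineA => //; [exact: AW|exact: AW|rewrite eq_sym].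
have j''3 : (3 - j' <= 3)%N by rewrite leq_subr.
have xcoord i : (i <= 3)%N -> i != 3%N -> i != j' -> dot (coord_form R 3 i) x != 0.
  move=> i3 in3 ij; apply/eqP => ix.
  by case: (uniqx _ (cW i i3) ix) => /eqP; apply/negP; apply: cneq.
exists x; split.
(* [3 - j'] is the other one of 1 and 2, and among the coordinate planes only [s3] and [Y] contain
   [x]. *)
- exists (3 - j')%N; first by case/orP: j'12 => /eqP->.
  by apply: xcoord => //; case/orP: j'12 => /eqP->.
- move=> i; have [->|i0] := eqVneq i (inord 0).
    exists (inord (3 - j')); first by rewrite -val_eqE /= !inordK //; case/orP: j'12 => /eqP->.
    by rewrite -dot_coord; apply: xcoord => //; case/orP: j'12 => /eqP->.
  exists (inord 0); first by rewrite eq_sym.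
  by rewrite -dot_coord; apply: xcoord => //; case/orP: j'12 => /eqP->.
move=> H' gH'; have [H'x gS] := gH'.
have -> : (T + (size G + size L).+2).-1 = (T + (size G + (size L).+1))%N.
  by rewrite !addnS.
apply: nregions_cons; [exact: killsA | exact: crossH gH' | |].
  (* Only two planes of [W] pass through [x], so no free triple does: with respect to [W] alone [H']
     is fully generic. *)
  apply: secA; split=> [|S SW fS sS _]; first by rewrite dotr0.
  apply: gS => //; first by apply: sub_all SW => K /WHW.
  have [sS2|] := boolP (size S < 3)%N; first by apply/or3P; constructor 3.
  rewrite -leqNgt => sS3; apply/or3P; constructor 2; apply/negP => /killsP z.
  suff : (size S <= 2)%N by rewrite leqNgt sS3.
  apply: (@uniq_leq_size _ S [:: s3; Y]); first exact: free_uniq.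
  move=> K KS; rewrite !inE; have := uniqx K _ (z K KS).
  by move: SW => /allP/(_ K KS) KW /(_ KW)[->|->]; rewrite eqxx ?orbT.
have HHx : dot H x = 0 by move: Hx => /= /andP[/eqP].
have Yx : dot Y x = 0 by move: Hx => /= /and4P[_ _ /eqP].
have s3x : dot s3 x = 0 by move: Hx => /= /and3P[_ /eqP].
pose D := s2 :: L ++ [:: s1].
have AE : A = G ++ s3 :: D by [].
have sD : size D = (size L).+2 by rewrite /= size_cat addn1.
have uAA : uniq A by move: uA => /andP[].
have DA K : K \in D -> K \in A.
  by move=> KD; rewrite AE mem_cat (in_cons s3) KD !orbT.
have s1D : s1 \in D by rewrite in_cons mem_cat inE eqxx !orbT.
have YD : Y \in D.
  by case/orP: j'12 => /eqP E; rewrite /Y E // in_cons eqxx.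
have s3D : s3 \notin D.
  by move: uAA; rewrite AE cat_uniq => /and3P[_ _ /andP[]].
have freeA K M : K \in W -> M \in W -> K != M -> ~~ ((dot K x == 0) && (dot M x == 0)) ->
    free [:: K; M; H; H'].
  move=> KW MW KM KMx; have f : free [:: H'; H; K; M].
    apply: gS; [by rewrite /= HHW !WHW|exact: HKL|by []|].
    apply/or3P; constructor 2; apply: contra KMx => /= /and4P[_ -> -> _].
    by [].
  by perm_from f.
have ex : dot e x != 0 by apply: (xcoord 0%N) => //; case/orP: j'12 => /eqP->.
have freee K : K \in A -> free [:: e; K; H; H'].
  by move=> KA; apply: freeA; [exact: cW|exact: AW|exact: eA|rewrite (negbTE ex)].
have DY K : K \in D -> dot K x = 0 -> K = Y.
  move=> KD /(uniqx K (AW _ (DA _ KD)))[E|//].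
  by rewrite E (negbTE s3D) in KD.
(* On the line where [H] meets [H'], the points of [s3] and [Y] coincide in [x]. Count [D], which
   contains [Y]; then [s3] adds nothing and each member of [G] adds one interval. *)
apply: (@line_fresh_cat _ _ e [:: H; H'] erefl G (s3 :: D) s1) => //.
- by rewrite (in_cons s3) s1D orbT.
- move=> K M KG MA KM; have KA : K \in A by rewrite AE mem_cat KG.
  apply: freeA; rewrite ?AW // 1?eq_sym //; apply/nandP; right; apply/negP => /eqP Kx.
  have : K \in s3 :: D.
    by have [->|->] := uniqx K (AW _ KA) Kx; rewrite (in_cons s3) ?eqxx // YD orbT.
  by apply/negP; move: uAA; rewrite AE cat_uniq => /and3P[_ /hasPn + _] => /(_ K) h;
     apply/negP => /h; rewrite /= KG.
have -> : (size L).+1 = (size D).-1 by rewrite sD.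
have s3A : s3 \in A by rewrite AE mem_cat mem_head orbT.
have s1A := DA _ s1D.
apply: (@line_stale _ _ _ _ _ _ _ s1 Y x) => //=; [exact: freee|exact: freee| |].
  by rewrite Yx s3x HHx H'x !eqxx.
apply: nregions_line => //.
- by move=> K KD; apply/freee/DA.
- by move: uAA; rewrite AE cat_uniq => /and3P[_ _ /andP[]].
move=> K M KD MD KM; apply: freeA; [exact/AW/DA|exact/AW/DA|by rewrite eq_sym|].
apply/negP => /andP[/eqP Mx /eqP Kx].
by move: KM; rewrite (DY _ KD Kx) (DY _ MD Mx) eqxx.
Qed.

Local Notation e' := (coord_form R 2 0).
Local Notation s1' := (coord_form R 2 1).

Lemma lift_e : lift_form e' = e. Proof. exact: lift_coord_form. Qed.
Lemma lift_s1 : lift_form s1' = s1. Proof. exact: lift_coord_form. Qed.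

Lemma lift_form_inj : injective lift_form.
Proof.
move=> c c' /matrixP E; apply/rowP => i.
have := E 0 (inord i); rewrite !mxE inordK; last exact: ltn_trans (ltn_ord i) _.
by case: (ord3P i) => ->; rewrite inordK.
Qed.

Lemma lift_apex c : dot (lift_form c) apex = 0.
Proof. by rewrite dot_lift project_apex dotr0. Qed.

(** As [H] misses the apex, [project] maps it bijectively onto the space of the base. *)
Lemma nregions_lift H C k : dot H apex != 0 -> nregions e' [::] C k ->
  nregions e [:: H] (map lift_form C) k.
Proof.
move=> Ha; apply: (nregions_map (f := project)) => //; last exact: lift_e.
  move=> x; have [y yx _] := project_lin
    (\row_i nth 0 [:: x 0 (inord 0); x 0 (inord 1); x 0 (inord 2); 0] i) 0.
  (* Moving along the apex reaches [H] without changing the projection. *)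
  exists (y - (dot H y / dot H apex) *: apex).
    by rewrite /= dotBr dotZr divfK // subrr eqxx.
  apply/rowP => i; move/matrixP/(_ 0): yx => yx.
  have := yx (inord 0); have := yx (inord 1); have := yx (inord 2).
  rewrite !mxE !inordK //= subr0 => E2 E1 E0.
  by case: (ord3P i) => ->; rewrite inordK //= -?E0 -?E1 -?E2; ring.
by move=> K y; rewrite dot_lift.
Qed.

(** Along the apex the cone is constant and [s2] varies, so the cone and [s2] together bound
    nothing. All regions come from the section by [s3]: [k] from the base and [size B] from the line
    where [s3] meets [s2]. *)
Lemma spatial_init (B : seq 'rV[R]_3) k : planar B k ->
  spatial [::] (map lift_form B) (k + size B) (k + size B + (size B).+1).
Proof.
move=> pB; set b := size B; pose C := B ++ [:: s1'].
have [_ fC nC cB [c [B' [_ [_ [BE _ _ _]]]]]] := pB.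
have cinB : c \in B by rewrite BE mem_head.
have := planar_uniq pB; rewrite cons_uniq -/C => /andP[eC uC].
have s1C : s1' \in C by rewrite mem_cat inE eqxx orbT.
have lC : map lift_form B ++ [:: s1] = map lift_form C by rewrite map_cat /= lift_s1.
set A := spatial_list [::] (map lift_form B).
have AE : A = [:: s3, s2 & map lift_form C] by rewrite /A /spatial_list lC.
set W := e :: A.
have quad (K L : 'rV[R]_3) : K \in e' :: C -> L \in e' :: C -> K != L ->
    free [:: lift_form K; lift_form L; s2; s3].
  move=> KC LC KL; apply: kills_free_full => // x /=.
  rewrite !dot_lift => /and5P[Kx Lx s2x s3x _].
  have /kills_project[r xr] : project x = 0.
    apply: (free_full (fC K L KC LC KL)) => //=; rewrite Kx Lx dot_coord mxE inordK //=.
    by rewrite !dot_coord in s2x s3x; rewrite (eqP s2x) (eqP s3x) subrr eqxx.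
  move: s2x; rewrite xr dotZr dot_apex // mulr1 => /eqP ->.
  by rewrite scale0r.
have WP K : K \in W -> [\/ K = s2, K = s3 | exists2 M, M \in e' :: C & K = lift_form M].
  rewrite /W AE !in_cons => /or4P[/eqP->|/eqP->|/eqP->|/mapP[M MC ->]].
  - by constructor 3; exists e'; rewrite ?mem_head ?lift_e.
  - by constructor 2.
  - by constructor 1.
  by constructor 3; exists M; rewrite // inE MC orbT.
have WC (M : 'rV[R]_3) : M \in e' :: C -> lift_form M \in W.
  rewrite /W AE !in_cons => /predU1P[->|MC]; first by rewrite lift_e eqxx.
  by rewrite map_f ?orbT.
have cW i : (i <= 3)%N -> coord_form R 3 i \in W by apply: coord_in.
have other M : M \in e' :: C -> exists2 M', M' \in e' :: C & M' != M.
  move=> MC; have [->|Me] := eqVneq M e'; last by exists e'; rewrite ?mem_head // eq_sym.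
  by exists s1'; rewrite ?inE ?s1C ?orbT //; apply: contraNneq eC => <-.
have neq_lift i M : (1 < i <= 3)%N -> coord_form R 3 i != lift_form M.
  case/andP=> i1 i3; apply/eqP => /(congr1 (fun K => dot K apex)).
  by rewrite lift_apex dot_apex // i1 => /eqP; rewrite oner_eq0.
have s2s3 : s2 != s3 by apply: coord_neq.
have tri (K L : 'rV[R]_3) : K \in e' :: C -> L \in e' :: C -> K != L ->
    free [:: s2; lift_form K; lift_form L] /\ free [:: s3; lift_form K; lift_form L].
  move=> KC LC KL; have f := quad _ _ KC LC KL.
  split; first by apply: (@free_behead _ _ s3); perm_from f.
  by apply: (@free_behead _ _ s2); perm_from f.
have tri2 (K : 'rV[R]_3) : K \in e' :: C -> free [:: lift_form K; s2; s3].
  move=> KC; have [L LC LK] := other K KC.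
  exact: free_behead (quad _ _ LC KC LK).
have fW : {in W &, forall K K', K != K' -> free [:: K; K']}.
  have f23 : free [:: s2; s3] := free_behead (tri2 e' (mem_head _ _)).
  have fl i M : M \in e' :: C -> i \in [:: 2; 3]%N -> free [:: coord_form R 3 i; lift_form M].
    move=> MC; rewrite !inE => /orP[]/eqP->;
    [apply: (@free_behead _ _ s3)|apply: (@free_behead _ _ s2)]; perm_from (tri2 M MC).
  move=> K K' /WP[->|->|[M MC ->]] /WP[->|->|[M' MC' ->]]; rewrite ?eqxx // => KK.
  - exact: fl.
  - by perm_from f23.
  - exact: fl.
  - by perm_from (fl 2%N M MC isT).
  - by perm_from (fl 3%N M MC isT).
  apply: (@free_behead _ _ s2); apply: (tri M M' MC MC' _).1.
  by apply: contraNneq KK => ->.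
have c0 i : c 0 i != 0 by apply: cB.
(* The first vertex: the point where the plane over [c] meets [s2] and [s3]. *)
pose v : 'rV[R]_4 := \row_i nth 0 [:: c 0 (inord 1); - c 0 (inord 0); 0; 0] i.
have vE : [/\ dot e v != 0, dot s1 v != 0, dot s2 v = 0 & dot s3 v = 0].
  by rewrite !dot_coord !mxE !inordK //= oppr_eq0.
case: vE => ev s1v s2v s3v.
have v0 : v != 0 by apply: contraNneq ev => ->; rewrite dotr0.
have cv : dot (lift_form c) v = 0.
  by rewrite dot_lift dot3E !mxE !inordK //= !subr0; ring.
have quadv (K L : 'rV[R]_3) : K \in e' :: C -> L \in e' :: C -> K != L ->
    ~~ ((dot (lift_form K) v == 0) && (dot (lift_form L) v == 0)).
  move=> KC LC KL; apply: contra v0 => /andP[Kv Lv].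
  by apply/eqP/(free_full (quad K L KC LC KL)) => //=; rewrite Kv Lv s2v s3v eqxx.
have killsC x : dot e x = 0 -> kills (map lift_form C) x -> exists r, x = r *: apex.
  move=> ex; rewrite kills_lift => Cx; apply/kills_project/(kills_planar pB) => /=.
  by rewrite -dot_lift lift_e ex eqxx.
have eqC M : M \in C -> e' != M by move=> MC; apply: contraNneq eC => ->.
have lineC E : size E = 2 -> {in C, forall K : 'rV[R]_3, free [:: e, lift_form K & E]} ->
    {in C &, forall K L : 'rV[R]_3, K != L -> free [:: lift_form L, lift_form K & E]} ->
    nregions e E (map lift_form C) b.
  move=> sE fe fp; have -> : b = (size (map lift_form C)).-1.
    by rewrite size_map size_cat addn1.
  apply: nregions_line; rewrite ?sE //; first by rewrite /C; case: (B).
  - by move=> _ /mapP[K KC ->]; apply: fe.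
  - by rewrite (map_inj_uniq lift_form_inj).
  move=> _ _ /mapP[K KC ->] /mapP[L LC ->] KL; apply: fp => //.
  by apply: contraNneq KL => ->.
(* On [H] the cone contributes [k], then [s2] adds [b] and [s3] adds [b + 1]. If [H] contains [v],
   the points where [s2] and the plane over [c] meet the line of [s3] coincide, and one interval is
   lost. *)
have sec (d : bool) H : generic (if d then v else 0) W H ->
    nregions e [:: H] A (k + b + (b.+1 - d)).
  case=> Hw gH; have s1W : s1 \in W by apply: cW.
  have gv S : all (mem W) S -> free S -> size S = 3 -> ~~ kills S v -> free (H :: S).
    move=> SW fS sS Sv; apply: gH; rewrite ?sS //; case: (d); last by rewrite eqxx.
    by rewrite Sv orbT.
  have gl i (K L : 'rV[R]_3) : i \in [:: 2; 3]%N -> K \in e' :: C -> L \in e' :: C -> K != L ->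
      free [:: H; coord_form R 3 i; lift_form K; lift_form L].
    move=> i23 KC LC KL; apply: gv => //.
    - by rewrite /= !WC // cW // ; move: i23; rewrite !inE => /orP[]/eqP->.
    - by move: i23 (tri K L KC LC KL) => + [f2 f3]; rewrite !inE => /orP[]/eqP->.
    by apply: contra (quadv K L KC LC KL) => /= /and4P[_ -> -> _].
  have Ha : dot H apex != 0.
    have fec : free [:: e; s1; lift_form c].
      have f : free [:: lift_form c; e; s1].
        apply: (kills_free (x := delta_mx 0 (inord 2))).
        - by apply: fW; rewrite ?cW // coord_neq.
        - by rewrite /= !dot_coord !mxE -!val_eqE /= !inordK //= eqxx.
        by rewrite dotC dot_delta mxE inordK //= c0.
      by perm_from f.
    have /free_full z : free [:: H; e; s1; lift_form c].
      apply: gv => //; last by rewrite /= (negbTE ev).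
      by rewrite /= !cW // WC // inE mem_cat cinB orbT.
    apply: contra apex_neq0 => Ha; apply/eqP/z => //=.
    by rewrite Ha !dot_apex // lift_apex eqxx.
  have cross i : i \in [:: 2; 3]%N -> exists2 x, kills [:: e; H] x & dot (coord_form R 3 i) x != 0.
    move=> i23; apply: free_kills; have f : free [:: H; e; coord_form R 3 i].
      apply: gH; rewrite ?orbT //=.
      - by rewrite !cW //; move: i23; rewrite !inE => /orP[]/eqP->.
      by apply: fW; rewrite ?cW ?coord_neq //; move: i23; rewrite !inE => /orP[]/eqP->.
    by perm_from f.
  have kH i x : kills [:: e; H] x -> kills (map lift_form C) x -> dot (coord_form R 3 i) x = 0.
    move=> /= /and3P[/eqP ex Hx _] /(killsC _ ex)[r xr]; move: Hx; rewrite xr !dotZr.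
    by rewrite mulf_eq0 (negbTE Ha) orbF => /eqP ->; rewrite mul0r.
  have lH i : i \in [:: 2; 3]%N -> nregions e [:: coord_form R 3 i; H] (map lift_form C) b.
    move=> i23; apply: lineC => [//|K KC|K L KC LC KL].
      have f := gl i e' K i23 (mem_head _ _) (mem_behead (s := _ :: _) KC) (eqC _ KC).
      by rewrite -lift_e; perm_from f.
    have f := gl i K L i23 (mem_behead (s := _ :: _) KC) (mem_behead (s := _ :: _) LC) KL.
    by perm_from f.
  rewrite AE; apply: nregions_cons.
  - by move=> x ex /= /andP[_]; apply: kH.
  - exact: cross.
  - apply: nregions_cons; [exact: kH|exact: cross|exact: nregions_lift|exact: lH].
  have fe1 : free [:: e; s1; s3; H].
    rewrite -lift_e -lift_s1.
    have f := gl 3%N e' s1' isT (mem_head _ _) (mem_behead (s := _ :: _) s1C) (eqC _ s1C).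
    by perm_from f.
  have fe2 : free [:: e; s2; s3; H].
    have f : free [:: H; e; s2; s3].
      rewrite -lift_e; apply: gv => //; last by rewrite /= lift_e (negbTE ev).
        by rewrite /= WC ?mem_head // !cW.
      exact: tri2 (mem_head _ _).
    by perm_from f.
  have s1lC : s1 \in map lift_form C by rewrite -lift_s1 map_f.
  case: (boolP d) => dT; last first.
    rewrite subn0; apply: (@line_fresh _ _ e [:: s3; H] erefl _ _ s1) => //; last exact: lH.
    move=> _ /mapP[M MC ->]; have f : free [:: H; lift_form M; s2; s3].
      apply: gH; rewrite ?(negbTE dT) ?eqxx //.
        by rewrite /= WC ?cW // inE MC orbT.
      by apply: tri2; rewrite inE MC orbT.
    by perm_from f.
  rewrite subn1 /=; apply: (@line_stale _ _ e [:: s3; H] erefl _ _ s1 (lift_form c) v) => //.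
  - by rewrite map_f // mem_cat cinB.
  - by move: Hw; rewrite dT /= cv s2v s3v => ->; rewrite eqxx.
  exact: lH.
split.
- split; last exact: fW.
  have nl i : (1 < i <= 3)%N -> coord_form R 3 i \notin map lift_form C.
    by move=> i13; apply/mapP => -[M _ /eqP]; apply/negP/neq_lift.
  rewrite -/A AE !cons_uniq (map_inj_uniq lift_form_inj) uC !in_cons !negb_or.
  rewrite (nl 3%N) // (nl 2%N) // [s3 == s2]eq_sym s2s3 !coord_neq //=.
  by rewrite -lift_e (mem_map lift_form_inj) eC.
- move=> K /mapP[M MB ->] i; rewrite mxE.
  by case: (ord4P i) => ->; rewrite inordK //= ?oppr_eq0 cB.
- rewrite -/A AE -[(k + b)%N]add0n; apply: nregions_cons.
  + move=> x /= /andP[/eqP ex _] /andP[s2x /(killsC _ ex)[r xr]].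
    move: s2x; rewrite xr !dotZr !dot_apex // !mulr1 => /eqP ->.
    by [].
  + by exists apex; rewrite /= ?dot_apex ?eqxx ?oner_eq0.
  + apply: (@nregions_parallel _ _ _ _ _ _ apex); rewrite /= ?dot_apex ?eqxx ?oner_eq0 //.
    by rewrite kills_lift project_apex kills0.
  apply: nregions_cons.
  + move=> x /= /and3P[/eqP ex s3x _] /(killsC _ ex)[r xr].
    move: s3x; rewrite xr !dotZr !dot_apex // !mulr1 => /eqP ->.
    by [].
  + exists (delta_mx 0 (inord 2)); rewrite /= !dot_coord !mxE -!val_eqE /= !inordK //=.
      by rewrite eqxx.
    by rewrite oner_eq0.
  + by apply: nregions_lift => //; rewrite dot_apex // oner_eq0.
  apply: lineC => [//|K KC|K L KC LC KL].
    by rewrite -lift_e; apply: quad; rewrite ?mem_head ?inE ?KC ?orbT ?eqC.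
  by apply: quad; rewrite ?inE ?KC ?LC ?orbT // eq_sym.
- by move=> H /(sec false); rewrite subn0.
exists v; split.
- by exists 1%N.
- move=> i; have [->|i0] := eqVneq i (inord 0).
    by exists (inord 1); rewrite -?dot_coord // -val_eqE /= !inordK.
  by exists (inord 0); rewrite -?dot_coord // eq_sym.
by move=> H /(sec true); rewrite subn1 addnS.
Qed.

End Spatial.

(** * Arithmetic of the losses *)

Lemma mul2_bin2 n : (2 * 'C(n.+1, 2) = n.+1 * n)%N.
Proof. by elim: n => // n IH; rewrite binS bin1 mulnDr IH; ring. Qed.

Lemma ltn_bin2 D b : (D < b)%N -> (D <= 'C(b, 2))%N.
Proof. by case: b => // b Db; rewrite binS bin1 (leq_trans _ (leq_addl _ _)). Qed.

Lemma mul6_bin3 n : (6 * 'C(n.+2, 3) = n.+2 * n.+1 * n)%N.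
Proof.
elim: n => // n IH; rewrite binS mulnDr IH.
by rewrite -[6%N]/(3 * 2)%N -(mulnA 3 2 'C(n.+2, 2)) mul2_bin2; ring.
Qed.

(** For fixed [b] the sums, with [D] and [p] as quotient and remainder, fill the interval from
    ['C(b + 1, 3)] to just below [top b]. By [step], a gap before the next interval occurs only for
    [b] so large that [top b] is already at least ['C(N + 1, 2)], hence beyond [r]. *)
Lemma bin_greedy N r : (0 < N)%N -> (r < 'C(N.+1, 2))%N -> exists b D p,
  [/\ (0 < b <= N)%N, (D < b)%N, (p <= N - b)%N &
      r = ('C(b.+1, 3) + (N - b).+1 * D + p)%N].
Proof.
move=> N0 rN; pose top b := ('C(b.+1, 3) + (N - b).+1 * b)%N.
have step b : (0 < b < N)%N -> (top b <= r)%N -> ('C(b.+2, 3) <= r)%N.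
  move=> /andP[b0 bN] tr; have tN := leq_ltn_trans tr rN.
  apply: leq_trans tr; rewrite leqNgt; apply/negP => ltb.
  have [g gE] : exists g, N = (b + g.+1)%N by exists (N - b).-1; lia.
  have gb : (2 * g.+2 < b.+1)%N.
    move: ltb; rewrite /top (binS b.+1) ltn_add2l gE addKn => ltb.
    have : (2 * (g.+2 * b) < b.+1 * b)%N by rewrite -mul2_bin2 ltn_mul2l.
    by rewrite mulnA ltn_mul2r => /andP[].
  have [t tE] : exists t, b = (2 * g + 4 + t)%N by exists (b - (2 * g + 4))%N; lia.
  move: tN; apply/negP; rewrite /top gE addKn -leqNgt -(leq_pmul2l (_ : 0 < 6)%N) // mulnDr.
  rewrite -[X in (X * 'C((b + g.+1).+1, 2) <= _)%N]/(3 * 2)%N -mulnA mul2_bin2.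
  case: b tE {b0 bN ltb gb gE} => [|b] tE; first by lia.
  by rewrite mul6_bin3; nia.
have [b [b0 /andP[rb br]]] : exists b, (0 < b <= N)%N /\ ('C(b.+1, 3) <= r < top b)%N.
  suff H b : (0 < b <= N)%N -> (r < top b)%N ->
      exists b, (0 < b <= N)%N /\ ('C(b.+1, 3) <= r < top b)%N.
    apply: (H N); rewrite ?N0 ?leqnn //; apply: leq_trans rN _.
    rewrite /top subnn mul1n -(leq_pmul2l (_ : 0 < 6)%N) // mulnDr.
    rewrite -[X in (X * 'C(N.+1, 2) <= _)%N]/(3 * 2)%N -mulnA mul2_bin2.
    by case: (N) => // N'; rewrite mul6_bin3; nia.
  elim: b => // -[|b] IH /andP[_ bN] rb.
    by exists 1%N; rewrite bin_small //= N0.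
  have [rb'|rb'] := ltnP r (top b.+1).
    by apply: IH; rewrite // /= ltnW.
  by exists b.+2; split=> //; rewrite rb andbT step.
exists b, ((r - 'C(b.+1, 3)) %/ (N - b).+1)%N, ((r - 'C(b.+1, 3)) %% (N - b).+1)%N.
split=> //; first by rewrite ltn_divLR // mulnC ltn_subLR.
  by rewrite -ltnS ltn_pmod.
by rewrite -addnA (mulnC (N - b).+1) -divn_eq subnKC.
Qed.

(** * Arrangements with any admissible number of bounded regions *)

Section Realization.
Variable R : realFieldType.

Definition coord_forms n : seq 'rV[R]_n.+1 := [seq coord_form R n i.+1 | i <- iota 0 n].

Definition realized n N k := exists C A : seq 'rV[R]_n.+1,
  [/\ size C = N, {in C, forall (c : 'rV[R]_n.+1) i, c 0 i != 0}, perm_eq A (C ++ coord_forms n) &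
      nregions (coord_form R n 0) [::] A k].

(** The first equation is the balance of losses: ['C(b + 1, 3)] for the cone, [D] for the section by
    [s3] and for that by each of the [g] later planes, and one for each of the [p] planes drawn
    through the vertex. *)
Lemma spatial_exists b D g p : (0 < b)%N -> (D < b)%N -> (p <= g)%N ->
  exists G L k T, [/\ size G = g, size L = b, @spatial R G L k T,
    (k + p + g.+1 * D + 'C(b.+1, 3) = 'C(b + g.+2, 3))%N & (T + D = 'C(b + g.+2, 2))%N].
Proof.
move=> b0 Db; elim: g p => [|g IH] p pg.
  have [B sB pB] := planar_exists R b0 Db.
  have Dk := ltn_bin2 Db.
  have b1 : 'C(b.+1, 2) = ('C(b, 2) + b)%N by rewrite binS bin1.
  have b2 : 'C(b.+2, 2) = ('C(b, 2) + b + b.+1)%N by rewrite binS bin1 b1.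
  have b3 : 'C(b.+2, 3) = ('C(b.+1, 3) + 'C(b.+1, 2))%N by rewrite binS.
  exists [::], (map (@lift_form R) B), ('C(b, 2) - D + size B)%N,
    ('C(b, 2) - D + size B + (size B).+1)%N.
  split; [by []|by rewrite size_map|exact: spatial_init| |]; rewrite sB addn2 ?b3 ?b2 ?b1; lia.
have [p' [d [pE p'g]]] : exists p' (d : bool), p = (p' + d)%N /\ (p' <= g)%N.
  case: p pg => [|p] pg; first by exists 0%N, false.
  by exists p, true; rewrite addn1.
have [G [L [k [T [sG sL GL kE TE]]]]] := IH p' p'g.
have [H HG] := spatial_cons d GL.
have T0 : (b < T + D)%N.
  by rewrite TE addnS binS bin1 (leq_trans _ (leq_addl _ _)) // addnS ltnS leq_addr.
exists (H :: G), L, (k + (T - d))%N, (T + (size G + size L).+2)%N.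
split=> //=; first by rewrite sG.
  have E3 : 'C(b + g.+3, 3) = ('C(b + g.+2, 3) + 'C(b + g.+2, 2))%N by rewrite addnS binS.
  by rewrite E3 -kE -TE pE; case: (d) => /=; lia.
have E2 : 'C(b + g.+3, 2) = ('C(b + g.+2, 2) + (b + g.+2))%N by rewrite addnS binS bin1.
by rewrite E2 -TE sG sL; lia.
Qed.

Lemma realized4 N k : (0 < N)%N -> ('C(N.+1, 3) < k <= 'C(N.+2, 3))%N -> realized 3 N k.
Proof.
move=> N0 /andP[k1 k2].
have NE : 'C(N.+2, 3) = ('C(N.+1, 3) + 'C(N.+1, 2))%N by rewrite binS.
have [||b [D [p [/andP[b0 bN] Db pN rE]]]] := @bin_greedy N ('C(N.+2, 3) - k) => //.
  by lia.
have [G [L [k' [T [sG sL GL kE _]]]]] := spatial_exists b0 Db pN.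
have kk : k' = k.
  have E : (b + (N - b).+2 = N.+2)%N by lia.
  by rewrite E in kE; lia.
case: GL => _ cA nA _ _; exists (G ++ L), (spatial_list G L); split=> //.
- by rewrite size_cat sG sL subnK.
- by apply/permP => a; rewrite /spatial_list /coord_forms !count_cat /= !count_cat /=; ring.
by rewrite -kk.
Qed.

Lemma realized3 N k : (0 < N)%N -> ('C(N, 2) < k <= 'C(N.+1, 2))%N -> realized 2 N k.
Proof.
move=> N0 /andP[k1 k2].
have NE : 'C(N.+1, 2) = ('C(N, 2) + N)%N by rewrite binS bin1.
have DN : ('C(N.+1, 2) - k < N)%N by lia.
have := ltn_bin2 DN; have [B sB pB] := planar_exists R N0 DN => Dk.
exists B, [:: coord_form R 2 2 & B ++ [:: coord_form R 2 1]]; split=> //.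
- by case: pB.
- by apply/permP => a; rewrite /coord_forms /= !count_cat /=; ring.
have -> : k = ('C(N, 2) - ('C(N.+1, 2) - k) + size B)%N by rewrite sB; lia.
exact: nregions_planar pB.
Qed.

Lemma free2 (K L : 'rV[R]_2) :
  K 0 (inord 0) * L 0 (inord 1) != K 0 (inord 1) * L 0 (inord 0) -> free [:: K; L].
Proof.
move=> det; apply: kills_free_full => // x /= /and3P[/eqP Kx /eqP Lx _].
have dE (h : 'rV[R]_2) : dot h x = h 0 (inord 0) * x 0 (inord 0) + h 0 (inord 1) * x 0 (inord 1).
  rewrite /dot !big_ord_recl big_ord0 addr0.
  by congr (_ * _ + _ * _); congr (_ _ _); apply: val_inj; rewrite /= inordK.
rewrite !dE in Kx Lx; rewrite -subr_eq0 in det.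
have x0 : x 0 (inord 0) = 0.
  apply/eqP; rewrite -(mulrI_eq0 _ (mulfI det)); apply/eqP.
  transitivity (L 0 (inord 1) * (K 0 (inord 0) * x 0 (inord 0) + K 0 (inord 1) * x 0 (inord 1))
    - K 0 (inord 1) * (L 0 (inord 0) * x 0 (inord 0) + L 0 (inord 1) * x 0 (inord 1))); first ring.
  by rewrite Kx Lx !mulr0 subrr.
have x1 : x 0 (inord 1) = 0.
  apply/eqP; rewrite -(mulrI_eq0 _ (mulfI det)); apply/eqP.
  transitivity (K 0 (inord 0) * (L 0 (inord 0) * x 0 (inord 0) + L 0 (inord 1) * x 0 (inord 1))
    - L 0 (inord 0) * (K 0 (inord 0) * x 0 (inord 0) + K 0 (inord 1) * x 0 (inord 1))); first ring.
  by rewrite Kx Lx !mulr0 subrr.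
apply/rowP => -[[|[|//]] i2]; rewrite mxE; [rewrite -x0|rewrite -x1];
by congr (x 0 _); apply: val_inj; rewrite /= inordK.
Qed.

Lemma realized2 N : (0 < N)%N -> realized 1 N N.
Proof.
move=> N0; pose c t : 'rV[R]_2 := \row_i (if i == inord 0 then 1 else t.+1%:R).
have c0 t : c t 0 (inord 0) = 1 by rewrite mxE eqxx.
have c1 t : c t 0 (inord 1) = t.+1%:R by rewrite mxE -val_eqE /= !inordK.
pose e := coord_form R 1 0; pose s := coord_form R 1 1.
have e0 : e 0 (inord 0) = 1 by rewrite mxE !eqxx.
have e1 : e 0 (inord 1) = 0 by rewrite mxE eqxx -val_eqE /= !inordK.
have s0 : s 0 (inord 0) = 0 by rewrite mxE eqxx -val_eqE /= !inordK.
have s1 : s 0 (inord 1) = 1 by rewrite mxE !eqxx.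
pose C := map c (iota 0 N).
have AP K : K \in C ++ [:: s] -> K = s \/ exists t, K = c t.
  by rewrite mem_cat inE => /orP[/mapP[t _ ->]|/eqP->]; [right; exists t|left].
have cs t : c t != s.
  by apply/eqP => /matrixP/(_ 0 (inord 0)) /eqP; rewrite c0 s0 oner_eq0.
have cinj : injective c.
  move=> t u /matrixP/(_ 0 (inord 1)) /eqP; rewrite !c1 eqr_nat => /eqP[].
  by [].
have sA : size (C ++ [:: s]) = N.+1 by rewrite size_cat size_map size_iota addn1.
exists C, (C ++ [:: s]); split=> //.
- by rewrite size_map size_iota.
- by move=> _ /mapP[t _ ->] i; rewrite mxE; case: ifP; rewrite ?oner_eq0 ?pnatr_eq0.
- rewrite (_ : N = (size (C ++ [:: s])).-1); last by rewrite sA.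
  apply: nregions_line => //; first by rewrite -size_eq0 sA.
  + by move=> K /AP[->|[t ->]]; apply: free2;
      rewrite e0 e1 ?s1 ?c1 mul0r mul1r ?oner_eq0 ?pnatr_eq0.
  + rewrite cat_uniq map_inj_uniq // iota_uniq /= orbF andbT.
    by apply/mapP => -[t _ /esym/eqP]; rewrite (negbTE (cs t)).
  move=> K L /AP[->|[t ->]] /AP[->|[u ->]]; rewrite ?eqxx // => KL; apply: free2;
    rewrite ?c0 ?c1 ?s0 ?s1 ?mul1r ?mulr1 ?mulr0 ?mul0r ?oner_eq0 1?eq_sym ?oner_eq0 //.
  by rewrite eqr_nat eqSS; apply: contraNneq KL => ->.
Qed.

Lemma realized_pad n N N' k : (0 < n)%N -> (0 < N <= N')%N -> realized n N k -> realized n N' k.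
Proof.
move=> n0 /andP[N0 NN'] [[|c C] [A [sC cC pA nA]]]; first by rewrite -sC in N0.
have cA : c \in A by rewrite (perm_mem pA) mem_head.
exists (nseq (N' - N) c ++ c :: C), (nseq (N' - N) c ++ A); split.
- by rewrite size_cat size_nseq sC subnK.
- by move=> d; rewrite mem_cat => /orP[/nseqP[-> _]|]; apply: cC; rewrite ?mem_head.
- by rewrite -catA perm_cat2l.
elim: (N' - N)%N => //= j IH.
have cj : c \in nseq j c ++ A by rewrite mem_cat cA orbT.
apply: (nregions_stale cj) IH => [x /= /andP[/eqP]|| v _ /killsP -> //] //.
exists (delta_mx 0 (inord 1)); last by rewrite dotC dot_delta cC ?mem_head.
rewrite /= dot_coord mxE -!val_eqE /= !inordK //.
by rewrite eqxx.
Qed.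

Theorem realizable n N k : (0 < N)%N -> n \in [:: 1; 2; 3]%N ->
  (0 < k <= 'C(N + n.-1, n))%N -> realized n N k.
Proof.
move=> N0 n123 /andP[k0 kN].
(* These intervals partition the range of [k]; the [N - M] missing columns will be repetitions. *)
have [M [M0 MN kM]] : exists M, [/\ (0 < M)%N, (M <= N)%N &
    ('C(M.-1 + n.-1, n) < k <= 'C(M + n.-1, n))%N].
  elim: N N0 kN => // N IH _ kN.
  have [kN'|kN'] := leqP k 'C(N + n.-1, n); last by exists N.+1; rewrite kN' kN.
  case: (posnP N) => [N0|N0]; last first.
    by have [M [M0 MN kM]] := IH N0 kN'; exists M; rewrite (leq_trans MN).
  move: kN' k0; rewrite N0 bin_small ?leqn0 => [/eqP->|] //.
  by move: n123; rewrite !inE => /or3P[]/eqP->.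
apply: (@realized_pad _ M); [by move: n123; rewrite !inE => /or3P[]/eqP->|by rewrite M0|].
move: n123 kM; rewrite !inE => /or3P[]/eqP-> /=.
- rewrite !addn0 !bin1 => kM; have -> : k = M by lia.
  exact: realized2.
- by rewrite !addn1 prednK // => /realized3; apply.
by rewrite !addn2 prednK // => /realized4; apply.
Qed.

End Realization.

(** * A critical point in each bounded region *)

Section Extrema.
Import numFieldNormedType.Exports.
Variables (R : realType) (n : nat).
Implicit Types (x : 'rV[R]_n) (P : seq ('rV[R]_n * R)) (L : seq (nat * 'rV[R]_n)).

Definition polytope P x := all (fun p => p.2 <= dot p.1 x) P.

Definition monomial L x : R := \prod_(p <- L) dot p.2 x ^+ p.1.

Lemma dot_continuous (K : 'rV[R]_n) : continuous (fun x => dot K x).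
Proof.
apply: continuous_big => [|i _]; first exact: add_continuous.
move=> x; apply: continuousM; first exact: cst_continuous.
exact: coord_continuous.
Qed.

Lemma monomial_continuous L : continuous (fun x => monomial L x).
Proof.
apply: continuous_big => [|p _]; first exact: mul_continuous.
move=> x; apply: (continuous_comp (f := fun x => dot p.2 x) (g := fun r => r ^+ p.1)).
  exact: dot_continuous.
exact: exprn_continuous.
Qed.

Lemma closed_polytope P : closed [set x | polytope P x]%classic.
Proof.
elim: P => [|p P IH]; first by rewrite (_ : [set x | _]%classic = setT);
    [exact: closedT | apply/seteqP; split].
rewrite (_ : [set x | _]%classic =
  ((fun x => dot p.1 x) @^-1` [set r | p.2 <= r] `&` [set x | polytope P x])%classic).
  apply: closedI => //; apply: closed_comp => [x _|]; first exact: dot_continuous.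
  exact: closed_ge.
by apply/seteqP; split=> x /= => [/andP[]//|[-> ->]].
Qed.

Lemma polytope_max P L (M : R) :
  (exists x, polytope P x) -> (forall x, polytope P x -> forall i, `|x 0 i| <= M) ->
  exists2 c, polytope P c & forall x, polytope P x -> monomial L x <= monomial L c.
Proof.
move=> [x0 Px0] PM; pose D := [set x | polytope P x]%classic.
have cD : compact D.
  apply: (@subclosed_compact _ _
    [set v : 'rV[R]_n | forall i, `[- M, M]%classic (v ord0 i)]%classic).
  - exact: closed_polytope.
  - by apply: (@rV_compact R n (fun=> `[- M, M]%classic)) => i; exact: segment_compact.
  by move=> x /= Px i; rewrite /= in_itv /= -ler_norml PM.
have [||c] := @EVT_max_rV R n (monomial L) D _ cD.
- by exists x0.
- by apply: continuous_subspaceT; apply: monomial_continuous.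
by rewrite inE => Pc cmax; exists c => // x Px; apply: cmax; rewrite inE.
Qed.

(** Write p as p(0) + X q. If q(0) is nonzero, q keeps its sign near 0, and a small step in the
    direction of that sign increases p. *)
Lemma poly_local_max (p : {poly R}) (d : R) : 0 < d ->
  (forall t, `|t| <= d -> p.[t] <= p.[0]) -> p^`().[0] = 0.
Proof.
move=> d0 pmax; have [q qE] : exists q, p = p.[0]%:P + 'X * q.
  have /factor_theorem[q qE] : root (p - p.[0]%:P) 0.
    by rewrite /root !hornerE subrr.
  by exists q; rewrite mulrC -[X in q * X]subr0 -qE addrC subrK.
have -> : p^`().[0] = q.[0].
  by rewrite qE derivD derivC add0r derivM derivX mul1r hornerD hornerM hornerX mul0r addr0.
apply/eqP/negPn/negP => q0; have aq0 : 0 < `|q.[0]| by rewrite normr_gt0.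
have [r r0 rP] := poly_cont 0 q aq0.
pose t := Num.sg q.[0] * Num.min d (r / 2).
have m0 : 0 < Num.min d (r / 2) by rewrite lt_min d0 divr_gt0.
have nt : `|t| = Num.min d (r / 2).
  by rewrite normrM normr_sg q0 mul1r gtr0_norm.
have /pmax : `|t| <= d by rewrite nt ge_min lexx.
rewrite {1}qE hornerD hornerC hornerM hornerX gerDl; apply/negP; rewrite -ltNge.
have /rP : `|t - 0| < r.
  by rewrite subr0 nt gt_min ltr_pdivrMr // mulr_natr mulr2n ltrDl r0 orbT.
rewrite /t; case: (sgrP q.[0]) q0 => // q0 _; rewrite ?mul1r ?mulN1r.
  rewrite ltr_distl subrr => /andP[+ _] => qt.
  by rewrite mulr_gt0.
rewrite ltr_distl addrN => /andP[_ qt].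
by rewrite nmulr_rgt0 // oppr_lt0.
Qed.

Lemma deriv_prod_log (L : seq (nat * {poly R})) :
  all (fun p => p.2.[0] != 0) L ->
  (\prod_(p <- L) p.2 ^+ p.1)^`().[0] =
  (\prod_(p <- L) p.2.[0] ^+ p.1) * \sum_(p <- L) p.1%:R * (p.2^`().[0] / p.2.[0]).
Proof.
elim: L => [|[l q] L IH] /=; first by rewrite !big_nil -polyC1 derivC horner0 mulr0.
case/andP=> q0 /IH {}IH; rewrite !big_cons derivM hornerD !hornerM IH horner_prod /=.
under eq_bigr do rewrite horner_exp.
rewrite deriv_exp hornerMn hornerM !horner_exp mulrDr; congr (_ + _); last by rewrite mulrA.
case: l => [|l]; first by rewrite mulr0n !mul0r mulr0.
by rewrite -mulr_natl exprS /=; field.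
Qed.
End Extrema.

Section Critical.
Variables (R : realType) (n : nat).
Implicit Types (x v : 'rV[R]_n.+1) (L : seq (nat * 'rV[R]_n.+1)).
Let e : 'rV[R]_n.+1 := delta_mx 0 ord0.

Lemma bounded_slice L :
  (forall i, i != ord0 -> exists b : bool, (-1) ^+ b *: delta_mx 0 i \in map snd L) ->
  (exists2 x, dot e x = 1 & all (fun p => 0 <= dot p.2 x) L) ->
  (forall v, dot e v = 0 -> all (fun p => 0 <= dot p.2 v) L ->
     forall p, p \in L -> dot p.2 v = 0) ->
  exists M, forall x, dot e x = 1 -> all (fun p => 0 <= dot p.2 x) L ->
    forall i, `|x 0 i| <= M.
Proof.
move=> coordL [x0 ex0 Lx0] norec.
(* The region lies in a single orthant, with signs [sg]. *)
have [sg sgP] : exists sg : 'I_n.+1 -> bool, forall i,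
    (-1) ^+ sg i *: delta_mx 0 i \in e :: map snd L.
  apply: (@fin_all_exists _ (fun=> bool)
    (fun i b => (-1) ^+ b *: delta_mx 0 i \in e :: map snd L)) => i.
  have [->|/coordL[b bL]] := eqVneq i ord0.
    by exists false; rewrite expr0 scale1r mem_head.
  by exists b; rewrite inE bL orbT.
pose f i : 'rV[R]_n.+1 := (-1) ^+ sg i *: delta_mx 0 i.
pose S := \sum_i f i.
have fpos x i : 0 <= dot e x -> all (fun p => 0 <= dot p.2 x) L -> dot (f i) x = `|x 0 i|.
  move=> ex /allP Lx; have : 0 <= dot (f i) x.
    have := sgP i; rewrite -/(f i) inE => /predU1P[->//|/mapP[p pL ->]].
    exact: Lx.
  rewrite dotZl dot_delta; case: (sg i); rewrite ?expr1 ?expr0 ?mul1r ?mulN1r => h.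
    by rewrite ler0_norm // -oppr_ge0.
  by rewrite ger0_norm.
have dotS x : 0 <= dot e x -> all (fun p => 0 <= dot p.2 x) L ->
    dot S x = \sum_i `|x 0 i|.
  move=> ex Lx; rewrite /S; transitivity (\sum_i dot (f i) x).
    apply: (big_ind2 (fun h r => dot h x = r)) => //; first by rewrite dot0r.
    by move=> h _ g _ <- <-; rewrite dotDl.
  by apply: eq_bigr => i _; apply: fpos.
(* S is the l1-norm on the region, so it suffices to bound e away from 0 on its
   compact slice S = 1. *)
pose P : seq ('rV[R]_n.+1 * R) := [:: (e, 0), (S, 1), (- S, -1) & [seq (p.2, 0) | p <- L]].
have PE x : polytope P x = [&& 0 <= dot e x, dot S x == 1 & all (fun p => 0 <= dot p.2 x) L].
  rewrite /polytope /= all_map; congr (_ && _); rewrite andbA; congr (_ && _).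
  by rewrite -scaleN1r dotZl mulN1r lerN2 andbC -eq_le.
have scaleP x : dot e x = 1 -> 0 < dot S x -> all (fun p => 0 <= dot p.2 x) L ->
    polytope P ((dot S x)^-1 *: x).
  move=> ex S0 Lx; rewrite PE; apply/and3P; split.
  - by rewrite dotZr ex mulr1 invr_ge0 ltW.
  - by rewrite dotZr mulVf // gt_eqF.
  by apply: sub_all Lx => p px /=; rewrite dotZr mulr_ge0 // invr_ge0 ltW.
have le_sum x i : `|x 0 i| <= \sum_j `|x 0 j|.
  by rewrite (bigD1 i) //= lerDl sumr_ge0.
have [c] : exists2 c, polytope P c &
    forall x, polytope P x -> monomial [:: (1%N, - e)] x <= monomial [:: (1%N, - e)] c.
  apply: (@polytope_max _ _ _ _ 1) => [|x].
    have S1 : 0 < dot S x0.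
      rewrite dotS ?ex0 // (lt_le_trans _ (le_sum _ ord0)) //.
      by rewrite -dot_delta ex0 normr1.
    by exists ((dot S x0)^-1 *: x0); apply: scaleP; rewrite ?ex0.
  by rewrite PE => /and3P[ex /eqP <- Lx] i; rewrite dotS.
rewrite PE => /and3P[ec /eqP Sc Lc] cmax.
have {}cmax x : polytope P x -> dot e c <= dot e x.
  move/cmax; rewrite /monomial !big_cons !big_nil !mulr1 !expr1 /= -scaleN1r !dotZl.
  by rewrite !mulN1r lerN2.
(* If [e] vanished at its minimum [c], then [c] would be a recession direction, so all its
   coordinates would be 0, against [dot S c] = 1. *)
have {}ec : 0 < dot e c.
  rewrite lt_def ec andbT; apply/eqP => ec0.
  have c0 i : `|c 0 i| = 0.
    rewrite -(fpos c i) ?ec0 //; have := sgP i; rewrite -/(f i) inE.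
    by case/predU1P=> [->//|/mapP[p pL ->]]; apply: norec.
  move: Sc; rewrite dotS ?ec0 // big1 => [/eqP|i _]; last exact: c0.
  by rewrite eq_sym oner_eq0.
exists (dot e c)^-1 => x ex Lx i; apply: le_trans (le_sum x i) _.
have S1 : 0 < dot S x.
  rewrite dotS ?ex // (lt_le_trans _ (le_sum _ ord0)) //.
  by rewrite -dot_delta ex normr1.
rewrite -dotS ?ex // -[dot S x]invrK lef_pV2 ?posrE ?invr_gt0 //.
have /cmax : polytope P ((dot S x)^-1 *: x).
  by apply: scaleP; rewrite ?ex.
by rewrite dotZr ex mulr1.
Qed.

(** The product of powers is positive inside the region and 0 on its boundary, so its maximum over
    the closed region, compact by [bounded_slice], is attained at an interior point. *)
Lemma region_critical L x0 : all (fun p => 0 < p.1)%N L ->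
  (forall i, i != ord0 -> exists b : bool, (-1) ^+ b *: delta_mx 0 i \in map snd L) ->
  dot e x0 = 1 -> all (fun p => 0 < dot p.2 x0) L ->
  (forall v, dot e v = 0 -> all (fun p => 0 <= dot p.2 v) L ->
     forall p, p \in L -> dot p.2 v = 0) ->
  exists x, [/\ dot e x = 1, all (fun p => 0 < dot p.2 x) L &
    forall v, dot e v = 0 -> \sum_(p <- L) p.1%:R * (dot p.2 v / dot p.2 x) = 0].
Proof.
move=> L0 coordL ex0 Lx0 norec.
have Lx0' : all (fun p => 0 <= dot p.2 x0) L by apply: sub_all Lx0 => p /ltW.
have [|M xM] := bounded_slice coordL _ norec; first by exists x0.
pose P : seq ('rV[R]_n.+1 * R) := [:: (e, 1), (- e, -1) & [seq (p.2, 0) | p <- L]].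
have PE x : polytope P x = (dot e x == 1) && all (fun p => 0 <= dot p.2 x) L.
  rewrite /polytope /= all_map andbA; congr (_ && _).
  by rewrite -scaleN1r dotZl mulN1r lerN2 andbC -eq_le.
have [||c] := @polytope_max _ _ P L M.
- by exists x0; rewrite PE ex0 eqxx.
- by move=> x; rewrite PE => /andP[/eqP ex Lx]; apply: xM.
rewrite PE => /andP[/eqP ec Lc] cmax; exists c.
have gc : 0 < monomial L c.
  apply: lt_le_trans (cmax x0 _); last by rewrite PE ex0 eqxx.
  by rewrite /monomial big_seq prodr_gt0 // => p pL; rewrite exprn_gt0 // (allP Lx0).
have {}Lc : all (fun p => 0 < dot p.2 c) L.
  apply/allP => p pL; rewrite lt_def (allP Lc) // andbT; apply/negP => /eqP pc.
  move: gc; rewrite /monomial (big_rem p) //= pc expr0n.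
  by rewrite eqn0Ngt (allP L0) // mul0r ltxx.
split=> // v ev; pose q := [seq (p.1, (dot p.2 c)%:P + dot p.2 v *: 'X) | p <- L].
have qE t : (\prod_(p <- q) p.2 ^+ p.1).[t] = monomial L (c + t *: v).
  rewrite horner_prod big_map; apply: eq_bigr => p _ /=.
  by rewrite horner_exp !hornerE dotDr dotZr mulrC.
have [d d0 dP] : exists2 d : R, 0 < d &
    forall t, `|t| <= d -> all (fun p => 0 < dot p.2 (c + t *: v)) L.
  have : pos (map snd L) (nseq (size L) true) c.
    by elim: (L) Lc => //= p L' IH /andP[-> /IH].
  move=> /(pos_perturb v)[d d0 dP]; exists d => // t /dP.
  by elim: (L) => //= p L' IH /andP[-> /IH].
have : (\prod_(p <- q) p.2 ^+ p.1)^`().[0] = 0.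
  apply: (poly_local_max d0) => t td; rewrite !qE scale0r addr0 cmax // PE.
  rewrite dotDr dotZr ev mulr0 addr0 ec eqxx.
  by apply: sub_all (dP t td) => p /ltW.
rewrite deriv_prod_log; last first.
  apply/allP => _ /mapP[p pL ->] /=; rewrite !hornerE ?mulr0 ?addr0 gt_eqF //.
  exact: (allP Lc).
move/eqP; rewrite mulf_eq0 !big_map => /orP[/eqP gc0|/eqP s0].
  suff E : monomial L c = 0 by rewrite E ltxx in gc.
  rewrite -gc0; apply: eq_bigr => p _ /=.
  by rewrite !hornerE ?mulr0 ?addr0.
rewrite -[RHS]s0; apply: eq_bigr => p _ /=.
congr (_ * (_ / _)); last by rewrite !hornerE ?mulr0 ?addr0.
by rewrite derivD derivC add0r derivZ derivX hornerZ hornerC mulr1.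
Qed.

End Critical.

(** The last clause says that the logarithmic differential of the product of the powers vanishes on
    the chart where [e] is 1. *)
Definition critical_at (F : fieldType) n (e : 'rV[F]_n) (L : seq (nat * 'rV[F]_n)) x :=
  [/\ dot e x = 1, all (fun p => dot p.2 x != 0) L &
    forall v, dot e v = 0 -> \sum_(p <- L) p.1%:R * (dot p.2 v / dot p.2 x) = 0].

(** * Counting real and complex critical points *)

Section RealCritical.
Variables (R : realType) (n : nat) (L : seq (nat * 'rV[R]_n.+1)) (k : nat).
Let e : 'rV[R]_n.+1 := delta_mx 0 ord0.
Hypothesis L0 : all (fun p => 0 < p.1)%N L.
Hypothesis coordL : forall i, i != ord0 -> delta_mx 0 i \in map snd L.

Let forms_span v : dot e v = 0 -> (forall p, p \in L -> dot p.2 v = 0) -> v = 0.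
Proof.
move=> ev Lv; apply/rowP => i; rewrite mxE -dot_delta.
have [->//|/coordL/mapP[p pL ->]] := eqVneq i ord0.
exact: Lv.
Qed.

Lemma critical_unique s x y : critical_at e L x -> critical_at e L y ->
  pos (map snd L) s x -> pos (map snd L) s y -> x = y.
Proof.
move=> [ex _ cx] [ey _ cy] sx sy; apply/eqP; rewrite -subr_eq0; apply/eqP.
have eB : dot e (x - y) = 0 by rewrite dotBr ex ey subrr.
apply: forms_span => // p pL.
have xy q : q \in L -> 0 < dot q.2 x * dot q.2 y.
  elim: (L) s sx sy => // q' L' IH [|b s] //= /andP[Kx Lx] /andP[Ky Ly].
  rewrite inE => /predU1P[->|/(IH s Lx Ly)//].
  case: b Kx Ky => /= Kx Ky; first exact: mulr_gt0.
  by rewrite -[_ * _]opprK -mulrN -mulNr mulr_gt0.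
(* The difference of the equations of x and y tested on x - y is a sum of squares
   with positive weights. *)
pose t q := q.1%:R * (dot q.2 (x - y) ^+ 2 / (dot q.2 x * dot q.2 y)).
have t0 q : q \in L -> 0 <= t q.
  by move=> qL; rewrite mulr_ge0 ?ler0n // divr_ge0 ?sqr_ge0 // ltW // xy.
have : \sum_(q <- L) t q = 0.
  transitivity (\sum_(q <- L) q.1%:R * (dot q.2 (x - y) / dot q.2 y) -
                \sum_(q <- L) q.1%:R * (dot q.2 (x - y) / dot q.2 x)).
    rewrite -sumrB big_seq [RHS]big_seq.
    apply: eq_bigr => q /xy; rewrite /t dotBr => xyq.
    have x0 : dot q.2 x != 0 by apply: contraTneq xyq => ->; rewrite mul0r ltxx.
    have y0 : dot q.2 y != 0 by apply: contraTneq xyq => ->; rewrite mulr0 ltxx.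
    by field; rewrite x0 y0.
  by rewrite cx // cy // subrr.
rewrite big_seq => /eqP; rewrite psumr_eq0 // => /allP/(_ p pL); rewrite pL /=.
rewrite !mulf_eq0 invr_eq0 (gt_eqF (xy p pL)) orbF pnatr_eq0 eqn0Ngt (allP L0) //=.
by rewrite orbb => /eqP.
Qed.

Lemma pos_signs x : all (fun p => dot p.2 x != 0) L ->
  pos (map snd L) [seq 0 < dot p.2 x | p <- L] x.
Proof.
elim: (L) => //= p L' IH /andP[px /IH ->].
by rewrite andbT; case: (ltrP 0 (dot p.2 x)) => //= px'; rewrite oppr_gt0 lt_neqAle px.
Qed.

(** Along a recession direction all terms of the critical equation are nonnegative, so they all
    vanish and the direction is killed. *)
Lemma critical_bounded x : critical_at e L x ->
  bounded_region e [::] (map snd L) [seq 0 < dot p.2 x | p <- L].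
Proof.
case=> ex Lx cx; split.
  by exists x; split=> //; apply: pos_signs.
case=> v [/= /andP[/eqP ev _] Lv /negP[]]; apply/killsP => _ /mapP[p pL ->].
have {}Lv q : q \in L -> 0 <= dot q.2 v / dot q.2 x.
  elim: (L) Lx Lv => // q' L' IH /= /andP[qx Lx] /andP[qv Lv].
  rewrite inE => /predU1P[->|/(IH Lx Lv)//].
  case: (ltrP 0 (dot q'.2 x)) qv => /= qx' qv; first by rewrite divr_ge0 // ltW.
  by rewrite mulr_le0 ?invr_le0 // -oppr_ge0.
have := cx v ev; rewrite big_seq => /eqP; rewrite psumr_eq0 => [/allP/(_ p pL)|q qL]; last first.
  by rewrite mulr_ge0 ?ler0n ?Lv.
rewrite pL /= !mulf_eq0 invr_eq0 (negbTE (allP Lx p pL)) orbF pnatr_eq0 eqn0Ngt (allP L0) //=.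
by move/eqP.
Qed.

Lemma bounded_critical s : bounded_region e [::] (map snd L) s ->
  exists x, critical_at e L x /\ pos (map snd L) s x.
Proof.
case=> -[x0 [_ ex0 sx0]] norec.
(* Flipping the forms that are negative on the region makes all of them positive there; the
   quotients in the critical equations do not change. *)
pose sL := [seq (p.1.1, (-1) ^+ (~~ p.2) *: p.1.2) | p <- zip L s].
have sz : size s = size L by have := size_pos sx0; rewrite size_map.
have dotS b K x : dot ((-1) ^+ (~~ b) *: K) x = signed b (dot K x) :> R.
  by rewrite dotZl; case: b; rewrite ?expr0 ?expr1 ?mul1r ?mulN1r.
have posS x : all (fun p => 0 < dot p.2 x) sL = pos (map snd L) s x.
  rewrite /sL; elim: (L) (s) sz => [|p L' IH] [|b s'] //= [/IH <-].
  by rewrite dotS.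
have nnegS x : all (fun p => 0 <= dot p.2 x) sL = nneg (map snd L) s x.
  rewrite /sL; elim: (L) (s) sz => [|p L' IH] [|b s'] //= [/IH <-].
  by rewrite dotS.
have memS p : p \in L -> exists b, (p.1, (-1) ^+ (~~ b) *: p.2) \in sL.
  rewrite /sL; elim: (L) (s) sz => [|p' L' IH] [|b s'] //= [/IH {}IH].
  rewrite inE => /predU1P[->|/IH[b' pb']]; first by exists b; rewrite mem_head.
  by exists b'; rewrite inE pb' orbT.
have [|||||x [ex px cx]] := @region_critical R n sL x0.
- rewrite /sL; elim: (L) (s) sz L0 => [|p L' IH] [|b s'] //= [/IH {}IH] /andP[-> /IH ->] //.
- move=> i /coordL/mapP[p pL ->]; have [b pb] := memS p pL.
  by exists (~~ b); apply/mapP; exists (p.1, (-1) ^+ (~~ b) *: p.2).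
- exact: ex0.
- by rewrite posS.
- move=> v ev; rewrite nnegS => sv.
  have /killsP Lv : kills (map snd L) v.
    by apply: contra_notT norec => Lv; exists v; rewrite /= ev eqxx.
  move=> _ /mapP[[q b] qb ->] /=; rewrite dotS.
  have qL : q \in L.
    have := map_f fst qb; rewrite -/(unzip1 _) unzip1_zip // sz //.
  by rewrite Lv ?map_f //; case: (b); rewrite /= ?oppr0.
exists x; split; last by rewrite -posS.
split=> // [|v ev].
  move: px; rewrite posS; elim: (L) (s) sz => [|p L' IH] [|b s'] //= [/IH {}IH] /andP[Kx /IH ->].
  by rewrite andbT; apply: contraTneq Kx => ->; case: (b); rewrite /= ?oppr0 ltxx.
rewrite -[RHS](cx v ev) /sL big_map; elim: (L) (s) sz => [|p L' IH] [|b s'] //=.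
  by rewrite !big_nil.
move=> [/IH E]; rewrite !big_cons /= !dotS E; congr (_ * _ + _).
by case: (b) => //=; rewrite invrN mulrNN.
Qed.

Lemma real_critical_count : nregions e [::] (map snd L) k ->
  exists r, [/\ uniq r, size r = k & forall x, x \in r <-> critical_at e L x].
Proof.
move=> [l [ul <- lP]].
have [f fP] : exists f : seq bool -> 'rV[R]_n.+1, forall s, s \in l ->
    critical_at e L (f s) /\ pos (map snd L) s (f s).
  have /choice[f fP] s : exists x, s \in l -> critical_at e L x /\ pos (map snd L) s x.
    have [sl|] := boolP (s \in l); last by exists 0.
    by have [x xP] := bounded_critical ((lP s).1 sl); exists x.
  by exists f.
have posE s x : pos (map snd L) s x -> s = [seq 0 < dot p.2 x | p <- L].
  elim: (L) s => [|p L' IH] [|b s] //= /andP[Kx /IH <-]; congr cons.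
  by case: b Kx => /=; [move=> -> | rewrite oppr_gt0 => /lt_gtF ->].
exists (map f l); split; last 1 first.
- move=> x; split=> [/mapP[s /fP[cx _] ->]//|cx].
  have sl := (lP _).2 (critical_bounded cx); set s := [seq _ | _ <- _] in sl.
  have [cy sy] := fP s sl; apply/mapP; exists s => //.
  apply: (critical_unique cx cy) sy.
  by apply: pos_signs; case: cx.
- rewrite map_inj_in_uniq // => s s' sl s'l E.
  by rewrite (posE _ _ (fP s sl).2) (posE _ _ (fP s' s'l).2) E.
by rewrite size_map.
Qed.

End RealCritical.

Section ComplexCritical.
Variables (R : realType) (n : nat).
Local Notation C := R[i].
Local Notation toC := (real_complex R).
Local Notation mapC := (map_mx toC).

Definition complexify (L : seq (nat * 'rV[R]_n.+1)) : seq (nat * 'rV[C]_n.+1) :=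
  [seq (p.1, mapC p.2) | p <- L].

Let e : 'rV[R]_n.+1 := delta_mx 0 ord0.

Lemma dot_mapC (K x : 'rV[R]_n.+1) : dot (mapC K) (mapC x) = toC (dot K x).
Proof. by rewrite rmorph_sum; apply: eq_bigr => i _; rewrite !mxE rmorphM. Qed.

Lemma row_complexE (x : 'rV[C]_n.+1) :
  x = mapC (map_mx (@complex.Re R) x) + 'i%C *: mapC (map_mx (@complex.Im R) x).
Proof. by apply/rowP => i; rewrite !mxE -complexE. Qed.

Lemma dot_complexE (K : 'rV[R]_n.+1) (x : 'rV[C]_n.+1) : dot (mapC K) x =
  (dot K (map_mx (@complex.Re R) x) +i* dot K (map_mx (@complex.Im R) x))%C.
Proof.
by rewrite {1}[x]row_complexE dotDr dotZr !dot_mapC [RHS]complexE.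
Qed.

Lemma Im_sum (I : Type) (r : seq I) (F : I -> C) :
  complex.Im (\sum_(j <- r) F j) = \sum_(j <- r) complex.Im (F j).
Proof. by apply: big_morph => // -[a b] [a' b']. Qed.

Lemma mapC_inj : injective (mapC : 'rV[R]_n.+1 -> 'rV[C]_n.+1).
Proof.
move=> x y /matrixP E; apply/rowP => i; have := E 0 i; rewrite !mxE.
exact: complexI.
Qed.

Variables (L : seq (nat * 'rV[R]_n.+1)).
Hypothesis L0 : all (fun p => 0 < p.1)%N L.
Hypothesis coordL : forall i, i != ord0 -> delta_mx 0 i \in map snd L.

Lemma complex_critical x : critical_at e L x -> critical_at (mapC e) (complexify L) (mapC x).
Proof.
move=> [ex Lx cx]; split.
- by rewrite dot_mapC ex rmorph1.
- rewrite all_map; apply: sub_all Lx => p /= px.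
  by rewrite dot_mapC fmorph_eq0.
have realP v : dot e v = 0 ->
    \sum_(p <- complexify L) p.1%:R * (dot p.2 (mapC v) / dot p.2 (mapC x)) = 0.
  move=> ev; transitivity (toC (\sum_(p <- L) p.1%:R * (dot p.2 v / dot p.2 x))).
    rewrite big_map rmorph_sum; apply: eq_bigr => p _.
    by rewrite !dot_mapC rmorphM fmorph_div rmorph_nat.
  by rewrite cx // rmorph0.
move=> v; rewrite dot_complexE => /eqP; rewrite eq_complex /= => /andP[/eqP eRe /eqP eIm].
rewrite [v]row_complexE; set vr := map_mx _ v; set vi := map_mx _ v.
transitivity (\sum_(p <- complexify L) p.1%:R * (dot p.2 (mapC vr) / dot p.2 (mapC x))
  + 'i%C * \sum_(p <- complexify L) p.1%:R * (dot p.2 (mapC vi) / dot p.2 (mapC x))).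
  rewrite mulr_sumr -big_split; apply: eq_bigr => p _ /=.
  by rewrite dotDr dotZr; ring.
by rewrite !realP // mulr0 addr0.
Qed.

Lemma complex_critical_real z : critical_at (mapC e) (complexify L) z ->
  exists2 x, z = mapC x & critical_at e L x.
Proof.
move=> [ez Lz cz]; pose a := map_mx (@complex.Re R) z; pose b := map_mx (@complex.Im R) z.
move: ez; rewrite dot_complexE => /eqP; rewrite eq_complex /= => /andP[/eqP ea /eqP eb].
have zE p : dot (mapC p) z = (dot p a +i* dot p b)%C by apply: dot_complexE.
have nz p : p \in L -> 0 < dot p.2 a ^+ 2 + dot p.2 b ^+ 2.
  move=> pL; have := allP Lz (p.1, mapC p.2) (map_f _ pL).
  rewrite /= zE eq_complex /= negb_and lt_def addr_ge0 ?sqr_ge0 // andbT.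
  by rewrite paddr_eq0 ?sqr_ge0 // !sqrf_eq0 negb_and.
(* The imaginary part of the equation tested on Im z is minus a sum of squares
   with positive weights. *)
have b0 p : p \in L -> dot p.2 b = 0.
  move=> pL; have := cz (mapC b); rewrite dot_mapC eb rmorph0 => /(_ erefl).
  move=> /(congr1 (@complex.Im R)); rewrite Im_sum big_map /= => /eqP.
  rewrite (eq_bigr (fun p => - (p.1%:R * (dot p.2 b ^+ 2 / (dot p.2 a ^+ 2 + dot p.2 b ^+ 2))))).
    rewrite sumrN oppr_eq0 big_seq psumr_eq0 => [/allP/(_ p pL)|q qL]; last first.
      by rewrite mulr_ge0 ?ler0n // divr_ge0 ?sqr_ge0 // ltW // nz.
    rewrite pL /= !mulf_eq0 invr_eq0 (gt_eqF (nz p pL)) orbF pnatr_eq0 eqn0Ngt (allP L0) //=.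
    by rewrite orbb => /eqP.
  move=> q _ /=; rewrite zE dot_mapC -(rmorph_nat toC) /=.
  by ring.
have bE : b = 0.
  apply/rowP => i; rewrite [RHS]mxE -dot_delta.
  have [->//|/coordL/mapP[p pL ->]] := eqVneq i ord0.
  exact: b0.
have za : z = mapC a.
  by rewrite [LHS]row_complexE -/a -/b bE map_mx0 scaler0 addr0.
exists a => //; rewrite za in Lz cz; split=> //.
  move: Lz; rewrite all_map; apply: sub_all => p /=.
  by rewrite dot_mapC fmorph_eq0.
move=> v ev; apply: (@complexI R).
transitivity (\sum_(p <- complexify L) p.1%:R * (dot p.2 (mapC v) / dot p.2 (mapC a))).
  rewrite big_map rmorph_sum; apply: eq_bigr => p _.
  by rewrite !dot_mapC rmorphM fmorph_div rmorph_nat.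
by rewrite cz // dot_mapC ev rmorph0.
Qed.

Lemma complex_critical_count k : nregions e [::] (map snd L) k ->
  exists r, [/\ uniq r, size r = k &
    forall z, z \in r <-> critical_at (mapC e) (complexify L) z].
Proof.
move=> /(real_critical_count L0 coordL)[r [ur <- rP]]; exists (map mapC r); split.
- by rewrite map_inj_uniq //; apply: mapC_inj.
- by rewrite size_map.
move=> z; split=> [/mapP[x /rP cx ->]|/complex_critical_real[x -> /rP xr]].
  exact: complex_critical.
exact: map_f.
Qed.

End ComplexCritical.

(** * First-order definability and generic counts *)

Section GenericTruth.
Variables (F : closedFieldType) (N : nat).
Implicit Types (u : 'I_N -> F) (t : GRing.term F) (f : GRing.formula F).

Definition env u : seq F := [seq u i | i <- enum 'I_N].

(** The value for inverses is arbitrary, as only ring terms are evaluated; variables from [N] on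
    become 0, the default value in [nth_env]. *)
Fixpoint term_mpoly t : {mpoly F[N]} :=
  match t with
  | GRing.Var i => if insub i is Some j then 'X_j else 0
  | GRing.Const c => c%:MP
  | GRing.NatConst k => k%:R
  | GRing.Add t1 t2 => term_mpoly t1 + term_mpoly t2
  | GRing.Opp t1 => - term_mpoly t1
  | GRing.NatMul t1 k => term_mpoly t1 *+ k
  | GRing.Mul t1 t2 => term_mpoly t1 * term_mpoly t2
  | GRing.Inv t1 => 0
  | GRing.Exp t1 k => term_mpoly t1 ^+ k
  end.

Lemma nth_env u i : (env u)`_i = if insub i is Some j then u j else 0.
Proof.
case: insubP => [j _ <-|]; last first.
  by rewrite -leqNgt => Ni; rewrite nth_default // size_map size_enum_ord.
rewrite (nth_map j); last by rewrite size_enum_ord; apply: ltn_ord.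
by congr (u _); apply: val_inj; rewrite /= nth_enum_ord //; apply: ltn_ord.
Qed.

Lemma term_mpolyE u t : GRing.rterm t -> GRing.eval (env u) t = (term_mpoly t).@[u].
Proof.
elim: t => //=.
- move=> i _; rewrite nth_env; case: insub => [j|]; last by rewrite meval0.
  by rewrite mevalXU.
- by move=> c _; rewrite mevalC.
- by move=> k _; rewrite -mpolyC_nat mevalC.
- by move=> t1 IH1 t2 IH2 /andP[/IH1-> /IH2->]; rewrite mevalD.
- by move=> t1 IH1 /IH1 ->; rewrite mevalN.
- by move=> t1 IH1 k /IH1 ->; rewrite mevalMn.
- by move=> t1 IH1 t2 IH2 /andP[/IH1-> /IH2->]; rewrite mevalM.
by move=> t1 IH1 k /IH1 ->; rewrite rmorphXn.
Qed.

(** An equation between distinct polynomials fails where their difference does not vanish;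
    connectives multiply the exceptional polynomials. *)
Lemma qf_generic f : GRing.qf_form f -> GRing.rformula f ->
  exists2 h : {mpoly F[N]}, h != 0 &
    exists b, forall u, h.@[u] != 0 -> GRing.qf_eval (env u) f = b.
Proof.
have binary f1 f2 (op : bool -> bool -> bool) :
    (exists2 h : {mpoly F[N]}, h != 0 &
      exists b, forall u, h.@[u] != 0 -> GRing.qf_eval (env u) f1 = b) ->
    (exists2 h : {mpoly F[N]}, h != 0 &
      exists b, forall u, h.@[u] != 0 -> GRing.qf_eval (env u) f2 = b) ->
    exists2 h : {mpoly F[N]}, h != 0 &
      exists b, forall u, h.@[u] != 0 ->
        op (GRing.qf_eval (env u) f1) (GRing.qf_eval (env u) f2) = b.
  move=> [h1 h10 [b1 hb1]] [h2 h20 [b2 hb2]]; exists (h1 * h2); first exact: mulf_neq0.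
  exists (op b1 b2) => u; rewrite mevalM mulf_eq0 negb_or => /andP[/hb1-> /hb2->].
  by [].
elim: f => //=.
- by move=> b _ _; exists 1; [exact: oner_neq0|exists b].
- move=> t1 t2 _ /andP[r1 r2].
  have [E|NE] := eqVneq (term_mpoly t1) (term_mpoly t2).
    exists 1; first exact: oner_neq0.
    by exists true => u _; rewrite !term_mpolyE // E eqxx.
  exists (term_mpoly t1 - term_mpoly t2); first by rewrite subr_eq0.
  by exists false => u; rewrite mevalB subr_eq0 !term_mpolyE // => /negbTE.
- move=> f1 IH1 f2 IH2 /andP[q1 q2] /andP[r1 r2].
  exact: (binary _ _ andb (IH1 q1 r1) (IH2 q2 r2)).
- move=> f1 IH1 f2 IH2 /andP[q1 q2] /andP[r1 r2].
  exact: (binary _ _ orb (IH1 q1 r1) (IH2 q2 r2)).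
- move=> f1 IH1 f2 IH2 /andP[q1 q2] /andP[r1 r2].
  exact: (binary _ _ implb (IH1 q1 r1) (IH2 q2 r2)).
move=> f1 IH1 q1 r1; have [h h0 [b hb]] := IH1 q1 r1.
by exists h => //; exists (~~ b) => u /hb ->.
Qed.

(* By quantifier elimination every definable set of data contains a nonempty
   Zariski open set or is disjoint from one. *)
Lemma formula_generic f : exists2 h : {mpoly F[N]}, h != 0 &
  (forall u, h.@[u] != 0 -> GRing.holds (env u) f) \/
  (forall u, h.@[u] != 0 -> ~ GRing.holds (env u) f).
Proof.
pose g := GRing.quantifier_elim (@ClosedFieldQE.ex_elim F) (GRing.to_rform f).
have rf := GRing.to_rform_rformula f.
have wf := @ClosedFieldQE.wf_ex_elim F.
have ok := ClosedFieldQE.holds_ex_elim (@solve_monicpoly F).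
have /andP[qg rg] := GRing.quantifier_elim_wf wf rf.
have gP u : reflect (GRing.holds (env u) (GRing.to_rform f)) (GRing.qf_eval (env u) g).
  exact: GRing.quantifier_elim_rformP.
have [h h0 [b hb]] := qf_generic qg rg; exists h => //.
case: b hb => hb; [left|right] => u /hb gb; first exact/GRing.to_rformP/gP.
by move/GRing.to_rformP/gP; rewrite gb.
Qed.

End GenericTruth.

Section Definable.
Variable F : fieldType.
Implicit Types (e : seq F) (P Q : seq F -> Prop) (a b : seq F -> F).

Definition definable_fun a := exists t, forall e, GRing.eval e t = a e.
Definition definable P := exists f, forall e, GRing.holds e f <-> P e.

Lemma definable_var i : definable_fun (fun e => e`_i).
Proof. by exists (GRing.Var F i). Qed.

Lemma definable_cst c : definable_fun (fun=> c).
Proof. by exists (GRing.Const c). Qed.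

Lemma definable_mul a b : definable_fun a -> definable_fun b ->
  definable_fun (fun e => a e * b e).
Proof. by move=> [t ta] [s sb]; exists (GRing.Mul t s) => e /=; rewrite ta sb. Qed.

Lemma definable_sum (I : Type) (r : seq I) (G : I -> seq F -> F) :
  (forall i, definable_fun (G i)) -> definable_fun (fun e => \sum_(i <- r) G i e).
Proof.
move=> dG; elim: r => [|i r [t tP]]; first by exists (GRing.Const 0) => e; rewrite big_nil.
by have [s sP] := dG i; exists (GRing.Add s t) => e; rewrite big_cons /= sP tP.
Qed.

Lemma definable_eq a b : definable_fun a -> definable_fun b ->
  definable (fun e => a e = b e).
Proof. by move=> [t ta] [s sb]; exists (GRing.Equal t s) => e /=; rewrite ta sb. Qed.

Lemma definable_not P : definable P -> definable (fun e => ~ P e).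
Proof. by move=> [f fP]; exists (GRing.Not f) => e /=; rewrite fP. Qed.

Lemma definable_and P Q : definable P -> definable Q -> definable (fun e => P e /\ Q e).
Proof.
by move=> [f fP] [g gP]; exists (GRing.And f g) => e /=; rewrite fP gP.
Qed.

Lemma definable_iff P Q : (forall e, P e <-> Q e) -> definable P -> definable Q.
Proof. by move=> PQ [f fP]; exists f => e; rewrite fP. Qed.

Lemma definable_all (I : finType) (P : I -> seq F -> Prop) :
  (forall i, definable (P i)) -> definable (fun e => forall i, P i e).
Proof.
move=> dP; have [f fP] : exists f, forall e, GRing.holds e f <-> forall i, i \in enum I -> P i e.
  elim: (enum I) => [|i r [f fP]]; first by exists (GRing.Bool true).
  have [g gP] := dP i; exists (GRing.And g f) => e /=; rewrite gP fP; split.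
    by move=> [Pi Pr] j; rewrite inE => /predU1P[->|/Pr].
  by move=> Pr; split=> [|j jr]; apply: Pr; rewrite inE ?eqxx ?jr ?orbT.
by exists f => e; rewrite fP; split=> H i *; apply: H; rewrite ?mem_enum.
Qed.

Lemma definable_exists P (I : seq nat) : definable P ->
  definable (fun e => exists2 e', {in [predC I], forall i, e`_i = e'`_i} & P e').
Proof.
move=> [f fP]; exists (foldr (@GRing.Exists F) f I) => e.
rewrite -GRing.foldExistsP; split=> -[e' ee' e'P]; exists e' => //; exact/fP.
Qed.

End Definable.

Definition at_least (T : eqType) k (Q : T -> Prop) :=
  exists r : seq T, [/\ uniq r, size r = k & forall p, p \in r -> Q p].

Definition exactly (T : eqType) k (Q : T -> Prop) :=
  exists r : seq T, [/\ uniq r, size r = k & forall p, p \in r <-> Q p].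

(** This makes an exact count first-order: each half speaks of a fixed number of distinct
    solutions. *)
Lemma exactlyE (T : eqType) k (Q : T -> Prop) :
  exactly k Q <-> at_least k Q /\ ~ at_least k.+1 Q.
Proof.
split=> [[r [ur sr rQ]]|[[r [ur sr rQ]] nQ]].
  split; first by exists r; split=> // p /rQ.
  case=> r' [ur' sr' r'Q]; have /(uniq_leq_size ur') : {subset r' <= r} by move=> p /r'Q/rQ.
  by rewrite sr sr' ltnn.
exists r; split=> // p; split=> [/rQ//|Qp]; apply: contrapT => /negP pr; apply: nQ.
exists (p :: r); split=> /=; rewrite ?sr ?pr // => q.
by rewrite inE => /predU1P[->|/rQ].
Qed.

Section GenericCount.
Variables (F : closedFieldType) (N : nat).
Hypothesis N0 : (0 < N)%N.

(* Block 0 of an assignment of the variables holds the data, and block b.+1 a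
   candidate for the b-th solution. *)
Definition block b (e : seq F) : 'rV[F]_N := \row_i e`_(b * N + i).

Variable S : 'rV[F]_N -> 'rV[F]_N -> Prop.
Hypothesis defS : forall b c, definable (fun e => S (block b e) (block c e)).

Lemma definable_block_neq b c : definable (fun e => block b e <> block c e).
Proof.
apply/definable_not/(definable_iff _ (definable_all (fun i : 'I_N =>
  definable_eq (definable_var F (b * N + i)) (definable_var F (c * N + i))))) => e.
split=> [H|/rowP H i]; first by apply/rowP => i; rewrite !mxE.
by have := H i; rewrite !mxE.
Qed.

Lemma definable_at_least k : definable (fun e => at_least k (S (block 0 e))).
Proof.
have defT := definable_cst (1 : F).
have def1 : definable (fun e => forall b : 'I_k, S (block 0 e) (block b.+1 e)).
  by apply: definable_all => b; apply: defS.
have def2 : definable (fun e => forall bc : 'I_k * 'I_k,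
    bc.1 != bc.2 -> block bc.1.+1 e <> block bc.2.+1 e).
  apply: definable_all => -[b c] /=; have [_|bc] := eqVneq b c.
    by exists (GRing.Bool true).
  by apply: definable_iff (definable_block_neq b.+1 c.+1) => e; split=> // H; apply: H.
apply: definable_iff (definable_exists (iota N (k * N)) (definable_and def1 def2)) => e.
have blk0 e' : {in [predC iota N (k * N)], forall i, e`_i = e'`_i} -> block 0 e = block 0 e'.
  move=> ee'; apply/rowP => i; rewrite !mxE mul0n add0n; apply: ee'.
  by rewrite !inE mem_iota leqNgt ltn_ord.
split=> [[e' /blk0 E [S1 S2]]|[r [ur sr rS]]].
  exists [seq block b.+1 e' | b : 'I_k <- enum 'I_k]; split.
  - rewrite map_inj_in_uniq ?enum_uniq // => b c _ _ E'; apply/eqP/negPn/negP => bc.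
    exact: (S2 (b, c) bc).
  - by rewrite size_map size_enum_ord.
  by move=> p /mapP[b _ ->]; rewrite E.
pose g l := if (l < N)%N then e`_l else (r`_(l %/ N).-1) 0 (Ordinal (ltn_pmod l N0)).
(* The assignment keeps the data in block 0, stores the solutions [r] in the next [k] blocks and
   agrees with [e] beyond them; its length covers both. *)
pose e' := mkseq (fun l => if (l < k.+1 * N)%N then g l else e`_l) (maxn (size e) (k.+1 * N)).
have e'E l : e'`_l = if (l < k.+1 * N)%N then g l else e`_l.
  have [lm|ml] := ltnP l (maxn (size e) (k.+1 * N)); first by rewrite nth_mkseq.
  rewrite nth_default ?size_mkseq //; move: ml; rewrite geq_max => /andP[el kl].
  by rewrite ltnNge kl /= nth_default.
have bE (b : 'I_k) : block b.+1 e' = r`_b.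
  apply/rowP => i; rewrite mxE e'E /g.
  have -> : (b.+1 * N + i < k.+1 * N)%N.
    rewrite (@leq_trans (b.+2 * N)) //; first by rewrite mulSn addnC ltn_add2r.
    by rewrite leq_mul2r ltnS ltn_ord orbT.
  rewrite ltnNge (@leq_trans (b.+1 * N)) ?leq_pmull ?leq_addr //=.
  rewrite divnMDl // divn_small ?addn0 //=; congr (_ _ _); apply: val_inj => /=.
  by rewrite modnMDl modn_small.
have E : block 0 e' = block 0 e.
  apply/rowP => i; rewrite !mxE mul0n add0n e'E /g ltn_ord.
  by rewrite (leq_trans (ltn_ord i)) // mulSn leq_addr.
exists e'.
  move=> l; rewrite !inE mem_iota negb_and -ltnNge -leqNgt e'E /g => /orP[lN|kl].
    by rewrite lN (leq_trans lN) // mulSn leq_addr.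
  by rewrite ltnNge mulSn kl.
split=> [b|[b c] /= bc]; rewrite ?E !bE.
  by apply: rS; rewrite mem_nth // sr.
by move=> /eqP; rewrite nth_uniq ?sr //; apply/negP.
Qed.

Lemma exactly_generic k : exists2 h : {mpoly F[N]}, h != 0 &
  (forall u : 'rV_N, h.@[fun i => u 0 i] != 0 -> exactly k (S u)) \/
  (forall u : 'rV_N, h.@[fun i => u 0 i] != 0 -> ~ exactly k (S u)).
Proof.
have [f fP] : definable (fun e => exactly k (S (block 0 e))).
  apply: definable_iff (definable_and (definable_at_least k)
    (definable_not (definable_at_least k.+1))) => e.
  by rewrite exactlyE.
have envE (u : 'rV_N) : block 0 (env (fun i => u 0 i)) = u.
  apply/rowP => i; rewrite mxE mul0n add0n nth_env.
  by rewrite insubT ?ltn_ord //= => lt; congr (u 0 _); apply: val_inj.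
have [h h0 hf] := formula_generic N f; exists h => //.
by case: hf => hf; [left|right] => u /hf; rewrite fP envE.
Qed.

End GenericCount.

Lemma nat_nonroot (D : idomainType) (q : {poly D}) M0 :
  injective (fun i : nat => i%:R : D) -> q != 0 -> exists2 M, (M0 <= M)%N & q.[M%:R] != 0.
Proof.
move=> D0 q0; pose rs : seq D := [seq i%:R | i <- iota M0 (size q)].
have /allPn[_ /mapP[M + ->] qM] : ~~ all (root q) rs.
  apply/negP => rt; have := max_poly_roots q0 rt.
  by rewrite map_inj_uniq // iota_uniq size_map size_iota ltnn => /(_ isT).
by rewrite mem_iota => /andP[MM _]; exists M.
Qed.

(** * The cone over the Segre variety, its tangent spaces and the likelihood equations *)

Section DirectionalDerivative.
Variables (F : numFieldType) (N : nat).
Implicit Types (p v : 'I_N -> F) (f g : {mpoly F[N]}).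

Definition dirder p v f : F := \sum_(l < N) (f^`M(l)).@[p] * v l.

Lemma dirderD p v f g : dirder p v (f + g) = dirder p v f + dirder p v g.
Proof. by rewrite -big_split; apply: eq_bigr => l _; rewrite mderivD mevalD mulrDl. Qed.

Lemma dirderZ p v c f : dirder p v (c *: f) = c * dirder p v f.
Proof. by rewrite mulr_sumr; apply: eq_bigr => l _; rewrite mderivZ mevalZ mulrA. Qed.

Lemma dirderB p v f g : dirder p v (f - g) = dirder p v f - dirder p v g.
Proof. by rewrite dirderD -scaleN1r dirderZ mulN1r. Qed.

Lemma dirderM p v f g : dirder p v (f * g) = dirder p v f * g.@[p] + f.@[p] * dirder p v g.
Proof.
rewrite mulr_suml mulr_sumr -big_split; apply: eq_bigr => l _.
by rewrite /= mderivM mevalD !mevalM; ring.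
Qed.

Lemma dirderC p v c : dirder p v c%:MP = 0.
Proof. by apply: big1 => l _; rewrite mderivC meval0 mul0r. Qed.

Lemma dirderX p v i : dirder p v 'X_i = v i.
Proof.
rewrite /dirder (bigD1 i) //= big1 => [|l li].
  have -> : ('X_i : {mpoly F[N]})^`M(i) = 1.
    rewrite mderivX mnm1E eqxx scale1r (_ : (_ - _)%MM = 0%MM) ?mpolyX0 //.
    by apply/mnmP => j; rewrite mnmBE subnn mnm0E.
  by rewrite meval1 mul1r addr0.
by rewrite mderivX mnm1E eq_sym (negbTE li) scale0r meval0 mul0r.
Qed.

Lemma mpoly_generated (P : {mpoly F[N]} -> Prop) :
  (forall c, P c%:MP) -> (forall i, P 'X_i) -> (forall f g, P f -> P g -> P (f + g)) ->
  (forall f g, P f -> P g -> P (f * g)) -> forall f, P f.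
Proof.
move=> PC PX PD PM; have PXm m : P 'X_[m].
  rewrite mpolyXE_id; elim/big_ind: _ => [|//|i _]; first by rewrite -mpolyC1.
  by elim: (m i) => [|k IH]; rewrite ?expr0 -?mpolyC1 // exprS; apply: PM.
elim/mpolyind => [|c m f _ _ Pf]; first by rewrite -mpolyC0.
by apply: PD => //; rewrite -mul_mpolyC; apply: PM.
Qed.

(** Evaluation along the curve is proved in the same induction because the product rule needs it. *)
Lemma chain_rule (c : 'I_N -> {poly F}) f :
  (mmap (@polyC F) c f)^`().[0] = dirder (fun l => (c l).[0]) (fun l => (c l)^`().[0]) f
  /\ forall r, (mmap (@polyC F) c f).[r] = f.@[fun l => (c l).[r]].
Proof.
elim/mpoly_generated: f => [a|i|f g [df ef] [dg eg]|f g [df ef] [dg eg]].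
- by rewrite mmapC derivC horner0 dirderC; split=> // r; rewrite hornerC mevalC.
- by rewrite mmapX mmap1U dirderX; split=> // r; rewrite mevalXU.
- rewrite mmapD derivD hornerD df dg dirderD; split=> // r.
  by rewrite hornerD ef eg mevalD.
rewrite rmorphM derivM hornerD !hornerM df dg !ef !eg dirderM; split=> // r.
by rewrite hornerM ef eg mevalM.
Qed.

Lemma poly_vanish (q : {poly F}) : (forall r, q.[r] = 0) -> q = 0.
Proof.
move=> q0; apply/eqP/negPn/negP => /(nat_nonroot 0)[i j /eqP|M _].
  by rewrite eqr_nat => /eqP.
by rewrite q0 eqxx.
Qed.

End DirectionalDerivative.

Section SegreCone.
Variables (F : numFieldType) (m n : nat) (w : 'M[F]_(m, n)).
Hypothesis w0 : forall i j, w i j != 0.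
Implicit Types (p v : 'M[F]_(m, n)) (s : 'rV[F]_m) (t : 'rV[F]_n).
Implicit Types (f : {mpoly F[m * n]}).

(** The 2 x 2 minors of the matrix of all [p i j / w i j], with denominators cleared. *)
Definition rank_one p := forall (ii : 'I_m * 'I_m) (jj : 'I_n * 'I_n),
  w ii.1 jj.2 * w ii.2 jj.1 * (p ii.1 jj.1 * p ii.2 jj.2) =
  w ii.1 jj.1 * w ii.2 jj.2 * (p ii.1 jj.2 * p ii.2 jj.1).

Let X i j : {mpoly F[m * n]} := 'X_(mxvec_index i j).

Definition minor i i' j j' : {mpoly F[m * n]} :=
  (w i j' * w i' j) *: (X i j * X i' j') - (w i j * w i' j') *: (X i j' * X i' j).

Lemma mxeval_X i j p : mxeval (X i j) p = p i j.
Proof. by rewrite /mxeval mevalXU mxvecE. Qed.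

Lemma mxeval_minor i i' j j' p : mxeval (minor i i' j j') p =
  w i j' * w i' j * (p i j * p i' j') - w i j * w i' j' * (p i j' * p i' j).
Proof.
rewrite /mxeval /minor mevalB !mevalZ !mevalM.
by rewrite -!/(mxeval (X _ _) p) !mxeval_X.
Qed.

Lemma rank_one_segre s t : rank_one (segre_map w s t).
Proof. by move=> [i i'] [j j'] /=; rewrite !mxE; ring. Qed.

Lemma minor_vanishes i i' j j' :
  vanishes_on (fun p => exists s t, p = segre_map w s t) (minor i i' j j').
Proof.
move=> _ [s [t ->]]; rewrite mxeval_minor (rank_one_segre s t (i, i') (j, j')).
exact: subrr.
Qed.

Lemma mx_neq0 p : p != 0 -> exists i j, p i j != 0.
Proof.
move=> p0; apply: contrapT => H; move/eqP: p0; apply; apply/matrixP => i j.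
rewrite mxE; apply: contrapT => /eqP pij; apply: H; by exists i, j.
Qed.

Lemma rank_oneP p : rank_one p -> exists s t, p = segre_map w s t.
Proof.
move=> rp; have [->|/mx_neq0[i0 [j0 p0]]] := eqVneq p 0.
  by exists 0, 0; apply/matrixP => i j; rewrite !mxE mulr0.
(* The column and the row through a nonzero entry, scaled so that their product is right at that
   entry. *)
exists (\row_i (p i j0 / w i j0)), (\row_j (p i0 j / w i0 j * (w i0 j0 / p i0 j0))).
apply/matrixP => i j; rewrite !mxE; have := rp (i, i0) (j, j0) => /= E.
apply: (mulIf (w0 i j0)); apply: (mulIf (w0 i0 j)); apply: (mulIf p0).
transitivity (w i j0 * w i0 j * (p i j * p i0 j0)); first ring.
by rewrite E; field; rewrite !w0 p0.
Qed.

(** The minors cut out the image of the parametrization, which is therefore already closed. *)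
Lemma scaled_segreP p : scaled_segre w p <-> exists s t, p = segre_map w s t.
Proof.
split=> [cl|st f fX]; last exact: fX.
apply: rank_oneP => -[i i'] [j j'] /=; apply/eqP; rewrite -subr_eq0 -mxeval_minor.
by apply/eqP/cl/minor_vanishes.
Qed.

Definition segre_diff s t (dst : 'rV[F]_m * 'rV[F]_n) : 'M[F]_(m, n) :=
  \matrix_(i, j) (w i j * (dst.1 0 i * t 0 j + s 0 i * dst.2 0 j)).

Lemma vanishes_scaled f : vanishes_on (scaled_segre w) f ->
  forall s t, mxeval f (segre_map w s t) = 0.
Proof. by move=> fX s t; apply/fX/scaled_segreP; exists s, t. Qed.

Lemma segre_map_neq0 s t : segre_map w s t != 0 -> exists i j, s 0 i != 0 /\ t 0 j != 0.
Proof.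
move=> /mx_neq0[i [j]]; rewrite mxE !mulf_eq0 !negb_or => /andP[/andP[_ si] tj].
by exists i, j.
Qed.

Lemma mxvec_ind (P : 'I_(m * n) -> Prop) : (forall i j, P (mxvec_index i j)) -> forall l, P l.
Proof. by move=> H l; case/mxvec_indexP: l. Qed.

(** The differentials of the minors through a nonzero entry determine a tangent vector from one row
    and one column. Conversely, an equation of the cone vanishes along the curve that moves [s] and
    [t] linearly, hence so does its derivative at 0. *)
Lemma tangent_segre s t v : segre_map w s t != 0 ->
  tangent (scaled_segre w) (segre_map w s t) v <-> exists dst, v = segre_diff s t dst.
Proof.
set p := segre_map w s t => p0; split=> [tv|[[ds dt] ->] f fX].
  have [i0 [j0 [si0 tj0]]] := segre_map_neq0 p0.
  pose y i j := v i j / w i j.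
  have yE i j : y i j * (s 0 i0 * t 0 j0) + s 0 i * t 0 j * y i0 j0 =
      y i j0 * (s 0 i0 * t 0 j) + s 0 i * t 0 j0 * y i0 j.
    have mX : vanishes_on (scaled_segre w) (minor i i0 j j0).
      by move=> q /scaled_segreP; apply: minor_vanishes.
    have := tv _ mX; rewrite -/(dirder (fun l => mxvec p 0 l) (fun l => mxvec v 0 l) _).
    rewrite dirderB !dirderZ !dirderM !dirderX !mevalXU !mxvecE !mxE => E.
    have ww : w i j * w i0 j0 * (w i j0 * w i0 j) != 0 by rewrite !mulf_neq0.
    apply: (mulIf ww); apply/eqP; rewrite -subr_eq0 -[X in _ == X]E; apply/eqP.
    by rewrite /y; field; rewrite !w0.
  (* The pair is determined up to multiples of [(s, - t)]; this one has second component 0 at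
     [j0]. *)
  exists (\row_i (y i j0 / t 0 j0), \row_j ((y i0 j - t 0 j * y i0 j0 / t 0 j0) / s 0 i0)).
  apply/matrixP => i j; rewrite !mxE /=.
  have -> : v i j = w i j * y i j by rewrite /y mulrC divfK.
  congr (_ * _); apply: (mulIf (mulf_neq0 si0 tj0)); apply/eqP.
  rewrite -(inj_eq (addIr (s 0 i * t 0 j * y i0 j0))) yE; apply/eqP.
  by field; rewrite si0 tj0.
pose c l : {poly F} := (mxvec p 0 l)%:P + (mxvec (segre_diff s t (ds, dt)) 0 l) *: 'X
  + (mxvec (segre_map w ds dt) 0 l) *: 'X^2.
have [dE hE] := chain_rule c f.
have : mmap (@polyC F) c f = 0.
  apply: poly_vanish => r; rewrite hE.
  rewrite -[RHS](vanishes_scaled fX (s + r *: ds) (t + r *: dt)); apply: meval_eq => l.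
  elim/mxvec_ind: l => i j; rewrite /c !mxvecE !hornerE !mxE /=; ring.
move=> /(congr1 (fun q => q^`().[0])); rewrite derivC horner0 dE => d0.
rewrite -[RHS]d0; apply: eq_bigr => l _; congr (_ * _).
  by apply: meval_eq => l'; rewrite /c !hornerE /= ?expr0n ?mulr0 ?addr0.
rewrite /c !derivD derivC !derivZ derivX derivXn add0r hornerD !hornerZ hornerC.
by rewrite hornerMn hornerXn expr1 mul0rn mulr0 addr0 mulr1.
Qed.

Lemma segre_diff_linear s t : linear (segre_diff s t).
Proof. by move=> a [ds dt] [ds' dt']; apply/matrixP => i j; rewrite !mxE /=; ring. Qed.

HB.instance Definition _ s t := GRing.isLinear.Build F ('rV[F]_m * 'rV[F]_n)%type
  'M[F]_(m, n) *:%R (segre_diff s t) (segre_diff_linear s t).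

(** The kernel of [segre_diff s t] is the line of [(s, - t)]. As the dimension is the same at all
    nonzero points, all of them are regular. *)
Lemma tangent_space_segre s t (T : {vspace 'M[F]_(m, n)}) : segre_map w s t != 0 ->
  is_tangent_space (scaled_segre w) (segre_map w s t) T -> (\dim T).+1 = (m + n)%N.
Proof.
move=> p0 TP; have [i0 [j0 [si0 tj0]]] := segre_map_neq0 p0.
have TE : T = limg (linfun (segre_diff s t)).
  apply/vspaceP => v; apply/idP/idP.
    move/TP/(tangent_segre _ p0) => [dst ->].
    have -> : segre_diff s t dst = linfun (segre_diff s t) dst by rewrite lfunE.
    by rewrite memv_img ?memvf.
  move=> /memv_imgP[dst _ ->]; apply/TP/(tangent_segre _ p0).
  by exists dst; rewrite lfunE.
have kerE : lker (linfun (segre_diff s t)) = <[(s, - t)]>%VS.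
  apply/vspaceP => dst; rewrite memv_ker lfunE /=; apply/idP/vlineP; last first.
    case=> a ->; apply/eqP/matrixP => i j; rewrite !mxE /=; ring.
  case: dst => ds dt /eqP/matrixP E; exists (ds 0 i0 / s 0 i0).
  have D i j : ds 0 i * t 0 j + s 0 i * dt 0 j = 0.
    have := E i j; rewrite !mxE => /eqP; rewrite mulf_eq0 (negbTE (w0 i j)) => /eqP.
    by [].
  have dtE j : dt 0 j = - (ds 0 i0 / s 0 i0 * t 0 j).
    apply: (mulfI si0); apply/eqP; rewrite -subr_eq0 -[X in _ == X](D i0 j); apply/eqP.
    by field.
  congr pair; apply/rowP => l; rewrite !mxE; last by rewrite dtE mulrN.
  apply: (mulIf tj0); apply/eqP; rewrite -subr_eq0 -[X in _ == X](D l j0) dtE; apply/eqP.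
  ring.
have := limg_ker_dim (linfun (segre_diff s t)) fullv.
rewrite -TE capfv kerE dim_vline dimvf.
have -> : dim ('rV[F]_m * 'rV[F]_n)%type = (m + n)%N.
  transitivity (dim 'rV[F]_m + dim 'rV[F]_n)%N; first by [].
  by rewrite !dim_matrix !mul1r.
move=> <-.
have -> : (s, - t) != 0.
  apply: contraNneq si0.
  by move=> /(congr1 (fun q : ('rV[F]_m * 'rV[F]_n)%type => q.1 0 i0)) /= ->; rewrite mxE.
by rewrite add1n.
Qed.

Lemma regular_segre s t : segre_map w s t != 0 ->
  regular_point (scaled_segre w) (segre_map w s t).
Proof.
move=> p0; split=> //; first by apply/scaled_segreP; exists s, t.
have TP : is_tangent_space (scaled_segre w) (segre_map w s t) (limg (linfun (segre_diff s t))).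
  move=> v; rewrite tangent_segre //; split.
    by move=> /memv_imgP[dst _ ->]; exists dst; rewrite lfunE.
  move=> [dst ->].
  have -> : segre_diff s t dst = linfun (segre_diff s t) dst by rewrite lfunE.
  by rewrite memv_img ?memvf.
exists (limg (linfun (segre_diff s t))) => // q T' /scaled_segreP[s' [t' ->]] q0 T'P.
by rewrite -ltnS (tangent_space_segre p0 TP) (tangent_space_segre q0 T'P).
Qed.

(** The data [U] have entries in the field, so that negative data can be tested. *)
Definition likelihood_equations (U p : 'M[F]_(m, n)) := [/\ rank_one p,
  forall i j, p i j != 0, Defs.total p = 1,
  forall i, Defs.total U * \sum_j p i j = \sum_j U i j &
  forall j, Defs.total U * \sum_i p i j = \sum_i U i j].

(** In the coordinates [ds / s] and [dt / t] of the tangent space, the coefficients of the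
    differential are the defects of the row sums and of the column sums. *)
Lemma critical_pointP (u : 'M[nat]_(m, n)) p :
  critical_point (scaled_segre w) u p <->
  likelihood_equations (map_mx (fun a : nat => a%:R) u) p.
Proof.
set U := map_mx _ u.
have UE : (\sum_i \sum_j u i j)%N%:R = Defs.total U.
  rewrite natr_sum; apply: eq_bigr => i _; rewrite natr_sum.
  by apply: eq_bigr => j _; rewrite mxE.
have dE s t dst : p = segre_map w s t -> (forall i j, p i j != 0) -> Defs.total p = 1 ->
    dloglik u p (segre_diff s t dst) =
    \sum_i dst.1 0 i / s 0 i * (\sum_j U i j - Defs.total U * \sum_j p i j) +
    \sum_j dst.2 0 j / t 0 j * (\sum_i U i j - Defs.total U * \sum_i p i j).
  move=> pE p0 p1.
  transitivity (\sum_i \sum_j (U i j - Defs.total U * p i j) *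
      (dst.1 0 i / s 0 i + dst.2 0 j / t 0 j)).
    rewrite /dloglik p1 divr1 UE /(Defs.total (segre_diff _ _ _)) mulr_sumr -sumrB.
    apply: eq_bigr => i _; rewrite mulr_sumr -sumrB; apply: eq_bigr => j _.
    have := p0 i j; rewrite pE !mxE !mulf_eq0 !negb_or => /andP[/andP[_ si] tj].
    by field; rewrite w0 si tj.
  under eq_bigr do under eq_bigr do rewrite mulrDr.
  under eq_bigr do rewrite big_split /=.
  rewrite big_split /=; congr (_ + _).
    by apply: eq_bigr => i _; rewrite -mulr_suml sumrB -mulr_sumr mulrC.
  rewrite exchange_big /=; apply: eq_bigr => j _.
  by rewrite -mulr_suml sumrB -mulr_sumr mulrC.
split=> [[[/scaled_segreP[s [t pE]] pn0 _] p0 p1 crit]|[rp p0 p1 rows cols]].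
  have pn0' : segre_map w s t != 0 by rewrite -pE.
  have crit' dst : dloglik u p (segre_diff s t dst) = 0.
    by apply: crit; rewrite pE; apply/(tangent_segre _ pn0'); exists dst.
  have st i j : s 0 i != 0 /\ t 0 j != 0.
    by have := p0 i j; rewrite pE !mxE !mulf_eq0 !negb_or => /andP[/andP[_ ->] ->].
  have [i1 [j1 _]] := mx_neq0 pn0.
  split=> //; first by rewrite pE; apply: rank_one_segre.
    move=> i; have := crit' (delta_mx 0 i, 0); rewrite (dE s t) //=.
    rewrite [X in _ + X]big1 => [|j _]; last by rewrite mxE mul0r mul0r.
    rewrite addr0 (bigD1 i) //= [X in _ + X]big1 => [|i' ii]; last first.
      by rewrite mxE (negbTE ii) andbF !mul0r.
    rewrite mxE !eqxx addr0 => /eqP; rewrite mulf_eq0 mul1r invr_eq0.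
    by rewrite (negbTE (st i j1).1) subr_eq0 => /eqP ->.
  move=> j; have := crit' (0, delta_mx 0 j); rewrite (dE s t) //=.
  rewrite [X in X + _]big1 => [|i _]; last by rewrite mxE mul0r mul0r.
  rewrite add0r (bigD1 j) //= [X in _ + X]big1 => [|j' jj]; last first.
    by rewrite mxE (negbTE jj) andbF !mul0r.
  rewrite mxE !eqxx addr0 => /eqP; rewrite mulf_eq0 mul1r invr_eq0.
  by rewrite (negbTE (st i1 j).2) subr_eq0 => /eqP ->.
have [s [t pE]] := rank_oneP rp.
have pn0 : segre_map w s t != 0.
  apply/eqP => E; move: p1; rewrite pE E /Defs.total big1 => [/eqP|i _]; last first.
    by rewrite big1 // => j _; rewrite mxE.
  by rewrite eq_sym oner_eq0.
split=> //; first by rewrite pE; apply: regular_segre.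
move=> v; rewrite pE => /(tangent_segre _ pn0)[dst ->]; rewrite -pE dE //.
by rewrite !big1 ?addr0 // => [j|i] _; rewrite ?rows ?cols subrr mulr0.
Qed.

End SegreCone.

(** * From the likelihood equations to critical points of products of linear forms *)

Section LikelihoodCount.
Variables (F : numFieldType) (a n : nat) (w : 'M[F]_(a.+1, n.+1)).
Hypothesis w0 : forall i j, w i j != 0.
Variables (al : 'I_a -> nat) (be : 'I_n.+1 -> nat) (U : 'M[F]_(a.+1, n.+1)).
Hypothesis be0 : forall j, (0 < be j)%N.
Hypothesis rowU : forall i, \sum_j U (lift ord0 i) j = - (al i)%:R.
Hypothesis colU : forall j, \sum_i U i j = (be j)%:R.

Definition column_form j : 'rV[F]_a.+1 := \row_i w i j.

Definition weighted_forms : seq (nat * 'rV[F]_a.+1) :=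
  [seq (al i, delta_mx 0 (lift ord0 i)) | i <- enum 'I_a] ++
  [seq (be j, column_form j) | j <- enum 'I_n.+1].

Lemma sum_weighted_forms (G : nat -> 'rV[F]_a.+1 -> F) :
  \sum_(q <- weighted_forms) G q.1 q.2 =
  \sum_i G (al i) (delta_mx 0 (lift ord0 i)) + \sum_j G (be j) (column_form j).
Proof. by rewrite big_cat !big_map. Qed.

Local Notation crit := (critical_at (delta_mx 0 ord0) weighted_forms).

Let T : F := Defs.total U.

Let TE : T = \sum_j (be j)%:R.
Proof. by rewrite /T /Defs.total exchange_big; apply: eq_bigr => j _; rewrite colU. Qed.

Let T0 : T != 0.
Proof.
by rewrite TE -natr_sum pnatr_eq0 -lt0n (bigD1 ord0) //= ltn_addr.
Qed.

Let b0 j : (be j)%:R != 0 :> F.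
Proof. by rewrite pnatr_eq0 -lt0n. Qed.

(** The column equations force this second factor. *)
Definition fit (s : 'rV[F]_a.+1) : 'M[F]_(a.+1, n.+1) :=
  segre_map w s (\row_j ((be j)%:R / T / dot (column_form j) s)).

(** Recovers [s], normalized to [s 0 ord0 = 1], from the first column of [p]. *)
Definition row_factor (p : 'M[F]_(a.+1, n.+1)) : 'rV[F]_a.+1 :=
  \row_i (p i ord0 / w i ord0 * (w ord0 ord0 / p ord0 ord0)).

Lemma crit_neq0 s : crit s ->
  [/\ s 0 ord0 = 1, forall i, s 0 i != 0 & forall j, dot (column_form j) s != 0].
Proof.
move=> [s1 /allP allL _]; rewrite dot_delta in s1.
split=> // [i|j]; last first.
  apply: (allL (be j, column_form j)).
  by rewrite mem_cat (map_f (fun j => (be j, column_form j))) ?orbT ?mem_enum.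
case: (unliftP ord0 i) => [i' ->|->]; last by rewrite s1 oner_neq0.
rewrite -dot_delta; apply: (allL (al i', delta_mx 0 (lift ord0 i'))).
by rewrite mem_cat (map_f (fun i => (al i, delta_mx 0 (lift ord0 i)))) ?mem_enum.
Qed.

Lemma fit_col s j : crit s -> \sum_i fit s i j = (be j)%:R / T.
Proof.
move=> /crit_neq0[_ _ c0]; rewrite -[RHS](divfK (c0 j)) mulr_sumr.
by apply: eq_bigr => i _; rewrite !mxE; field; rewrite T0 c0.
Qed.

Lemma fit_likelihood s : crit s -> likelihood_equations w U (fit s).
Proof.
move=> cs; have [s1 s0 c0] := crit_neq0 cs; have [_ _ eqs] := cs.
have cols j : Defs.total U * \sum_i fit s i j = \sum_i U i j.
  by rewrite fit_col // colU -/T mulrC divfK.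
have rows i : Defs.total U * \sum_j fit s (lift ord0 i) j = \sum_j U (lift ord0 i) j.
  (* Varying the single coordinate [lift ord0 i] yields the equation of that row. *)
  rewrite rowU; have := eqs (delta_mx 0 (lift ord0 i)).
  rewrite dot_delta mxE (negbTE (neq_lift _ _)) andbF => /(_ erefl).
  rewrite (sum_weighted_forms (fun c q => c%:R * (dot q _ / dot q s))).
  rewrite (bigD1 i) //= big1 => [|i' ii]; last first.
    by rewrite dot_delta mxE (inj_eq lift_inj) (negbTE ii) andbF mul0r mulr0.
  rewrite addr0 !dot_delta mxE !eqxx mul1r => E.
  apply: (mulIf (invr_neq0 (s0 (lift ord0 i)))).
  apply/eqP; rewrite mulNr -subr_eq0 opprK -[X in _ == X]E addrC; apply/eqP; congr (_ + _).
  rewrite mulr_sumr mulr_suml; apply: eq_bigr => j _.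
  by rewrite dotC dot_delta !mxE -/T; field; rewrite T0 c0 s0.
have tot : Defs.total (fit s) = 1.
  rewrite /Defs.total exchange_big /=; under eq_bigr do rewrite fit_col //.
  by rewrite -mulr_suml -TE divff.
split=> //; first exact: rank_one_segre.
  by move=> i j; rewrite !mxE !mulf_neq0 ?invr_neq0.
move=> i; case: (unliftP ord0 i) => [i' ->|->]; first exact: rows.
(* Row 0, whose coordinate is fixed by the chart, has no equation of its own; it follows from the
   total and the other rows. *)
apply: (addIr (\sum_i \sum_j U (lift ord0 i) j)).
transitivity (Defs.total U); last by rewrite /Defs.total big_ord_recl.
rewrite -{2}[Defs.total U]mulr1 -tot [Defs.total (fit s)]big_ord_recl mulrDr; congr (_ + _).
by rewrite mulr_sumr; apply: eq_bigr => i' _; rewrite rows.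
Qed.

Lemma row_factorK s : crit s -> row_factor (fit s) = s.
Proof.
move=> /crit_neq0[s1 s0 c0]; apply/rowP => i; rewrite !mxE s1.
by field; rewrite !w0 T0 c0 b0.
Qed.

Lemma fitK p : likelihood_equations w U p -> crit (row_factor p) /\ fit (row_factor p) = p.
Proof.
move=> [rp p0 p1 rows cols]; have [s [t pE]] := rank_oneP w0 rp.
have st i j : s 0 i != 0 /\ t 0 j != 0.
  by have := p0 i j; rewrite pE !mxE !mulf_eq0 !negb_or => /andP[/andP[_ ->] ->].
have s0 i := (st i ord0).1; have t0 j := (st ord0 j).2.
have fE i : row_factor p 0 i = s 0 i / s 0 ord0.
  by rewrite !mxE pE !mxE; field; rewrite !w0 s0 t0.
have cE j : T * (s 0 ord0 * t 0 j) * dot (column_form j) (row_factor p) = (be j)%:R.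
  rewrite -colU -cols -/T -mulrA; congr (_ * _); rewrite mulr_sumr; apply: eq_bigr => i _.
  by rewrite fE pE !mxE; field.
have c0 j : dot (column_form j) (row_factor p) != 0.
  by apply: contra_neq (b0 j) => c0; rewrite -cE c0 mulr0.
split.
  split.
  - by rewrite dot_delta fE divff.
  - apply/allP => q; rewrite mem_cat => /orP[] /mapP[l _ ->] //=.
    by rewrite dot_delta fE mulf_neq0 ?invr_eq0.
  move=> v; rewrite dot_delta => v0.
  rewrite (sum_weighted_forms (fun c q => c%:R * (dot q v / dot q (row_factor p)))).
  transitivity (\sum_i (- \sum_j U (lift ord0 i) j) *
      (v 0 (lift ord0 i) * s 0 ord0 / s 0 (lift ord0 i))
    + \sum_j T * (s 0 ord0 * t 0 j) * dot (column_form j) v).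
    congr (_ + _); apply: eq_bigr => l _; last by rewrite -cE; field.
    by rewrite !dot_delta fE rowU opprK; field; rewrite !s0.
  have -> : \sum_j T * (s 0 ord0 * t 0 j) * dot (column_form j) v =
      \sum_i (\sum_j U i j) * (v 0 i * s 0 ord0 / s 0 i).
    transitivity (\sum_j \sum_i T * p i j * (v 0 i * s 0 ord0 / s 0 i)).
      apply: eq_bigr => j _; rewrite mulr_sumr; apply: eq_bigr => i _.
      by rewrite pE !mxE; field.
    rewrite exchange_big; apply: eq_bigr => i _ /=.
    by rewrite -rows mulr_sumr mulr_suml.
  rewrite big_ord_recl v0 !mul0r mulr0 add0r -big_split big1 // => i _ /=.
  by rewrite mulNr addNr.
apply/matrixP => i j; rewrite [LHS]mxE fE mxE -cE [in RHS]pE mxE.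
by field; rewrite T0 s0 c0.
Qed.

Lemma likelihood_count k : exactly k crit -> exactly k (likelihood_equations w U).
Proof.
move=> [r [ur <- rP]]; exists (map fit r); split; last 1 first.
- move=> p; split=> [/mapP[s /rP cs ->]|lp]; first exact: fit_likelihood.
  have [cp pE] := fitK lp; apply/mapP; exists (row_factor p) => //.
  exact/rP.
- rewrite map_inj_in_uniq // => s s' /rP cs /rP cs' E.
  by rewrite -(row_factorK cs) E row_factorK.
by rewrite size_map.
Qed.

End LikelihoodCount.

Section DefinableLikelihood.
Variables (F : numClosedFieldType) (m n : nat) (w : 'M[F]_(m, n)).

Lemma definable_likelihood b c : definable (fun e : seq F =>
  likelihood_equations w (vec_mx (block (m * n) b e)) (vec_mx (block (m * n) c e))).
Proof.
have entry d i j : definable_fun (fun e : seq F => vec_mx (block (m * n) d e) i j).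
  have [t tP] := definable_var F (d * (m * n) + mxvec_index i j).
  by exists t => e; rewrite tP !mxE.
have ent_tot : definable_fun (fun e : seq F => Defs.total (vec_mx (block (m * n) b e))).
  by do 2!apply: definable_sum => ?; apply: entry.
have defp : definable (fun e : seq F => rank_one w (vec_mx (block (m * n) c e)) /\
    (forall ij : 'I_m * 'I_n, vec_mx (block (m * n) c e) ij.1 ij.2 <> 0)).
  apply: definable_and.
    apply: definable_all => ii; apply: definable_all => jj.
    by apply: definable_eq; do 2!apply: definable_mul => //; apply: definable_cst.
  by apply: definable_all => ij; apply/definable_not/definable_eq => //; apply: definable_cst.
have deft : definable (fun e : seq F => Defs.total (vec_mx (block (m * n) c e)) = 1).
  apply: definable_eq; last exact: definable_cst.
  by do 2!apply: definable_sum => ?; apply: entry.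
have defr : definable (fun e : seq F => forall i, Defs.total (vec_mx (block (m * n) b e)) *
    \sum_j vec_mx (block (m * n) c e) i j = \sum_j vec_mx (block (m * n) b e) i j).
  apply: definable_all => i; apply: definable_eq; last exact: definable_sum.
  by apply: definable_mul => //; apply: definable_sum.
have defc : definable (fun e : seq F => forall j, Defs.total (vec_mx (block (m * n) b e)) *
    \sum_i vec_mx (block (m * n) c e) i j = \sum_i vec_mx (block (m * n) b e) i j).
  apply: definable_all => j; apply: definable_eq; last exact: definable_sum.
  by apply: definable_mul => //; apply: definable_sum.
apply: definable_iff (definable_and (definable_and defp deft) (definable_and defr defc)) => e.
split=> [[[[rp p0] p1] [rows cols]]|[rp p0 p1 rows cols]]; split=> //.
  by move=> i j; apply/eqP; apply: (p0 (i, j)).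
by split=> //; split=> // ij; apply/eqP.
Qed.

End DefinableLikelihood.

(** * Zariski density of the test data *)

Section DensePoints.
Variables (F : numFieldType) (N : nat).
Implicit Types f : {mpoly F[N]}.

Lemma horner_mmap (A : comNzRingType) (g : {rmorphism F -> A}) (c : 'I_N -> {poly A}) f r :
  (mmap (polyC \o g) c f).[r] = mmap g (fun l => (c l).[r]) f.
Proof.
elim/mpoly_generated: f => [b|i|f1 f2 E1 E2|f1 f2 E1 E2].
- by rewrite !mmapC /= hornerC.
- by rewrite !mmapX !mmap1U.
- by rewrite !mmapD hornerD E1 E2.
by rewrite !rmorphM hornerM; congr (_ * _).
Qed.

Lemma natr_mpoly_inj : injective (fun i : nat => i%:R : {mpoly F[N]}).
Proof. by move=> i j /eqP; rewrite -!mpolyC_nat mpolyC_eq eqr_nat => /eqP. Qed.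

Lemma nat_point f : f != 0 -> exists q : 'I_N -> nat, f.@[fun l => (q l)%:R] != 0.
Proof.
move=> f0; apply: contrapT => H.
have {}H (q : 'I_N -> nat) : f.@[fun l => (q l)%:R] = 0.
  by apply: contrapT => /eqP qf; apply: H; exists q.
(* The coordinates below k are arbitrary polynomials, in the end the variables. *)
have vanish k (c : 'I_N -> {mpoly F[N]}) :
    (forall l : 'I_N, (k <= l)%N -> exists b : nat, c l = b%:R) -> mmap (@mpolyC N F) c f = 0.
  elim: k c => [c cE|k IH c cE].
    have /choice[q qE] := fun l => cE l isT.
    have -> : c = fun l => (q l)%:R by apply/funext.
    rewrite -(mpolyC0 N F) -(H q); elim/mpoly_generated: (f) => [b|i|f1 f2 E1 E2|f1 f2 E1 E2].
    - by rewrite mmapC mevalC.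
    - by rewrite mmapX mmap1U mevalXU mpolyC_nat.
    - by rewrite mmapD mevalD mpolyCD E1 E2.
    by rewrite rmorphM mevalM mpolyCM; congr (_ * _).
  have [kN|Nk] := ltnP k N; last first.
    by apply: IH => l kl; have := leq_trans (ltn_ord l) (leq_trans Nk kl); rewrite ltnn.
  pose l0 := Ordinal kN; pose P := mmap (polyC \o @mpolyC N F)
    (fun l => if l == l0 then 'X else (c l)%:P) f.
  have PE r : P.[r] = mmap (@mpolyC N F) (fun l => if l == l0 then r else c l) f.
    rewrite horner_mmap; congr (mmap _ _ _); apply/funext => l.
    by case: ifP => _; rewrite ?hornerX ?hornerC.
  have P0 : P = 0.
    apply/eqP/negPn/negP => /(nat_nonroot 0 natr_mpoly_inj)[b _]; rewrite PE IH ?eqxx // => l kl.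
    case: eqP => [_|/eqP ll]; first by exists b.
    by apply: cE; rewrite ltn_neqAle kl andbT eq_sym.
  rewrite -(horner0 (c l0)) -P0 PE; congr (mmap _ _ _); apply/funext => l.
  by case: eqP => [->|].
move/eqP: f0; apply; rewrite -(vanish N (fun l => 'X_l)); last first.
  by move=> l; rewrite leqNgt ltn_ord.
elim/mpoly_generated: (f) => [b|i|f1 f2 E1 E2|f1 f2 E1 E2].
- by rewrite mmapC.
- by rewrite mmapX mmap1U.
- by rewrite mmapD -E1 -E2.
by rewrite rmorphM [LHS]/=; congr (_ * _).
Qed.

(** As a polynomial in [M] the value of [f] is nonzero at [M] = 0, by the choice of [q], so it has
    nonroots beyond any bound. Far out, the signs are governed by [u0]. *)
Lemma ray_point f (u0 : 'I_N -> int) : f != 0 -> exists q : 'I_N -> nat, forall M0,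
  exists2 M, (M0 <= M)%N & f.@[fun l => (M%:Z * u0 l + (q l)%:Z)%:~R] != 0.
Proof.
move=> /nat_point[q fq]; exists q => M0.
pose c l : {poly F} := (u0 l)%:~R *: 'X + (q l)%:R%:P.
have [_ hE] := chain_rule c f.
have /(@nat_nonroot _ _ M0)[|M MM] : mmap (@polyC F) c f != 0.
- apply: contra_neq fq => P0; rewrite -[RHS](horner0 0) -P0 hE.
  by apply: meval_eq => l; rewrite !hornerE.
- by move=> i j /eqP; rewrite eqr_nat => /eqP.
rewrite hE => fM; exists M => //; apply: contra_neq fM => fM; rewrite -[RHS]fM.
by apply: meval_eq => l; rewrite !hornerE rmorphD rmorphM /= mulrC.
Qed.

End DensePoints.

Lemma perm_map_lift (T1 T2 : eqType) (f : T1 -> T2) s t :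
  perm_eq t (map f s) -> exists2 s', perm_eq s' s & map f s' = t.
Proof.
case: s => [/perm_nilP ->|x0 s /(perm_iotaP (f x0))[Is IsP ->]]; first by exists [::].
exists [seq nth x0 (x0 :: s) i | i <- Is].
  by apply/(perm_iotaP x0); exists Is => //; move: IsP; rewrite size_map.
rewrite -map_comp; apply/eq_in_map => i; rewrite (perm_mem IsP) mem_iota size_map => /andP[_ lt].
by rewrite (nth_map x0 (f x0) f lt).
Qed.

Lemma critical_at_perm (F : fieldType) n (e : 'rV[F]_n) L L' x : perm_eq L L' ->
  critical_at e L x -> critical_at e L' x.
Proof.
by move=> LL [ex Lx cx]; split=> // [|v /cx]; rewrite -?(perm_all _ LL) -?(perm_big _ LL).
Qed.

(** * The maximum likelihood degree as a number of bounded regions *)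

Section MLDegree.
Variables (R : realType) (a n : nat) (w : 'M[R]_(a.+1, n.+1)).
Hypothesis w0 : forall i j, w i j != 0.
Local Notation C := R[i].
Local Notation toC := (real_complex R).

Let wC : 'M[C]_(a.+1, n.+1) := map_mx toC w.

Let wC0 i j : wC i j != 0.
Proof. by rewrite mxE fmorph_eq0. Qed.

Lemma complexify_forms (al : 'I_a -> nat) (be : 'I_n.+1 -> nat) :
  complexify (weighted_forms w al be) = weighted_forms wC al be.
Proof.
rewrite /complexify map_cat; congr (_ ++ _); rewrite -map_comp; apply: eq_map => l /=; congr (_, _).
  by apply/rowP => i; rewrite !mxE rmorph_nat.
by apply/rowP => i; rewrite !mxE.
Qed.

Variables (A : seq 'rV[R]_a.+1) (k : nat).
Hypothesis permA : perm_eq A ([seq delta_mx 0 (lift ord0 i) | i <- enum 'I_a] ++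
  [seq column_form w j | j <- enum 'I_n.+1]).
Hypothesis countA : nregions (delta_mx 0 ord0) [::] A k.

Lemma cone_count (u : 'M[int]_(a.+1, n.+1)) :
  (forall i, \sum_j u (lift ord0 i) j < 0) -> (forall j, 0 < \sum_i u i j) ->
  exactly k (likelihood_equations wC (map_mx intr u)).
Proof.
move=> rows cols.
have /choice[al alP] i : exists b : nat, (0 < b)%N /\ \sum_j u (lift ord0 i) j = - b%:Z.
  by exists (absz (\sum_j u (lift ord0 i) j)%R); have := rows i; lia.
have /choice[be beP] j : exists b : nat, (0 < b)%N /\ \sum_i u i j = b%:Z.
  by exists (absz (\sum_i u i j)%R); have := cols j; lia.
apply: (likelihood_count wC0 (al := al) (be := be)).
- by move=> j; have [] := beP j.
- move=> i; rewrite -[RHS](rmorphN intr (al i)%:Z) -(alP i).2 rmorph_sum.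
  by apply: eq_bigr => j _; rewrite mxE.
- move=> j; rewrite -[RHS]/((be j)%:Z%:~R) -(beP j).2 rmorph_sum.
  by apply: eq_bigr => i _; rewrite mxE.
have permA' : perm_eq A (map snd (weighted_forms w al be)).
  rewrite map_cat -[map snd (map _ (enum 'I_a))]map_comp.
  by rewrite -[map snd (map _ (enum 'I_n.+1))]map_comp.
have [L LP LE] := perm_map_lift permA'; have countL := countA; rewrite -LE in countL.
have [|i i0|r [ur sr rP]] := complex_critical_count _ _ countL.
- apply/allP => p; rewrite (perm_mem LP) mem_cat => /orP[] /mapP[l _ ->] /=.
    by have [] := alP l.
  by have [] := beP l.
- rewrite LE (perm_mem permA) mem_cat.
  case: (unliftP ord0 i) i0 => [i' ->|->]; last by rewrite eqxx.
  by rewrite (map_f (fun i => delta_mx 0 (lift ord0 i))) ?mem_enum.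
have eE : map_mx toC (delta_mx 0 ord0) = delta_mx 0 ord0 :> 'rV_a.+1.
  by apply/rowP => i; rewrite !mxE rmorph_nat.
have LP' : perm_eq (complexify L) (weighted_forms wC al be).
  by rewrite -complexify_forms perm_map.
exists r; split; [exact: ur|exact: sr|move=> p; rewrite rP eE].
by split; apply: critical_at_perm; rewrite // perm_sym.
Qed.

Lemma mldeg_count : has_mldeg (scaled_segre wC) k.
Proof.
pose S (u p : 'rV[C]_(a.+1 * n.+1)) := likelihood_equations wC (vec_mx u) (vec_mx p).
have defS b c : definable (fun e : seq C => S (block (a.+1 * n.+1) b e) (block (a.+1 * n.+1) c e)).
  exact: definable_likelihood.
have [h h0 hS] := exactly_generic (isT : (0 < a.+1 * n.+1)%N) defS k.
have exS (u : 'M_(a.+1, n.+1)) : exactly k (S (mxvec u)) <-> exactly k (likelihood_equations wC u).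
  rewrite /S mxvecK; split=> -[r [ur <- rP]].
    exists (map vec_mx r); split; rewrite ?size_map ?map_inj_uniq //.
      exact: (can_inj vec_mxK).
    by move=> p; rewrite -{1}[p]mxvecK (mem_map (can_inj vec_mxK)) rP mxvecK.
  exists (map mxvec r); split; rewrite ?size_map ?map_inj_uniq //; first exact: (can_inj mxvecK).
  by move=> p; rewrite -{1}[p]vec_mxK (mem_map (can_inj mxvecK)) rP.
exists h => // u hu.
case: hS => hS.
  have := (exS _).1 (hS (mxvec (map_mx (fun b : nat => b%:R) u)) hu).
  move=> [r [ur sr rP]]; exists r; split=> // p.
  by rewrite rP; split=> /critical_pointP; apply.
(* If the count failed generically, it would fail at some data far out in the direction [u0], whose
   column sums are 1 and whose row sums other than the first are negative; there [cone_count]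
   contradicts this. *)
pose u0 (l : 'I_(a.+1 * n.+1)) : int := mxvec
  (\matrix_(i < a.+1, j < n.+1) if i == ord0 then a.+1%:Z else -1) 0 l.
have [q qP] := ray_point u0 h0.
pose Q : nat := \sum_l q l.
have qQ l : (q l <= Q)%N by rewrite /Q (bigD1 l) //= leq_addr.
have [M MQ] := qP Q.+1.
pose v : 'M[int]_(a.+1, n.+1) :=
  \matrix_(i, j) (M%:Z * u0 (mxvec_index i j) + (q (mxvec_index i j))%:Z).
have -> : h.@[fun l => (M%:Z * u0 l + (q l)%:Z)%:~R] =
    h.@[fun l => mxvec (map_mx intr v : 'M[C]_(_, _)) 0 l].
  by apply: meval_eq => l; case/mxvec_indexP: l => i j; rewrite mxvecE !mxE.
move=> /hS; case; apply/exS; apply: cone_count.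
- move=> i; apply: (@le_lt_trans _ _ (\sum_(j < n.+1) (-1 : int))); last first.
    by rewrite sumr_const card_ord mulNrn oppr_lt0 ltr0n.
  apply: ler_sum => j _; rewrite mxE /u0 mxvecE mxE eq_sym (negbTE (neq_lift _ _)).
  by have := qQ (mxvec_index (lift ord0 i) j); lia.
move=> j; rewrite big_ord_recl mxE /u0 mxvecE mxE eqxx.
have : \sum_(i < a) - M%:Z <= \sum_(i < a) v (lift ord0 i) j.
  apply: ler_sum => i _; rewrite mxE /u0 mxvecE mxE eq_sym (negbTE (neq_lift _ _)).
  by lia.
rewrite sumr_const card_ord -mulr_natr natz => sumv; apply: lt_le_trans (lerD (lexx _) sumv).
by rewrite mulrC; nia.
Qed.

End MLDegree.

Theorem theorem1p4 (R : realType) (m n : nat)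
    (hm : m \in [:: 2; 3; 4]%N) (hn : (1 <= n)%N)
    (k : nat) (hk : (1 <= k <= 'C(n + m - 2, m - 1))%N) :
  exists w : 'M[R]_(m, n),
    (forall i j, w i j != 0) /\
    has_mldeg (scaled_segre (map_mx (real_complex R) w)) k.
Proof.
case: m hm hk => // a ha hk; case: n hn hk => // n _ hk.
have a123 : a \in [:: 1; 2; 3]%N by move: ha; rewrite !inE !eqSS.
have a0 : (0 < a)%N by move: a123; rewrite !inE => /or3P[] /eqP->.
have hk' : (0 < k <= 'C(n.+1 + a.-1, a))%N.
  by move: hk; rewrite subn1 (_ : (n.+1 + a.+1 - 2 = n.+1 + a.-1)%N) //; lia.
have [C [A [sC C0 permA countA]]] := realizable R (ltn0Sn n) a123 hk'.
exists (\matrix_(i, j) (C`_j) 0 i); split.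
  by move=> i j; rewrite mxE C0 // mem_nth // sC.
apply: (mldeg_count _ (A := A)).
- by move=> i j; rewrite mxE C0 // mem_nth // sC.
- have -> : [seq delta_mx 0 (lift ord0 i) | i <- enum 'I_a] = coord_forms R a.
    rewrite /coord_forms -val_enum_ord -map_comp; apply: eq_map => i /=; congr delta_mx.
    by apply: val_inj; rewrite /= inordK // ltnS.
  have -> : [seq column_form (\matrix_(i, j) (C`_j) 0 i) j | j <- enum 'I_n.+1] = C.
    apply: (@eq_from_nth _ 0); first by rewrite size_map size_enum_ord.
    rewrite size_map size_enum_ord => i lt; rewrite (nth_map ord0) ?size_enum_ord //.
    by apply/rowP => l; rewrite !mxE nth_enum_ord.
  by rewrite (perm_trans permA) // perm_catC.
move: countA; rewrite /coord_form; suff -> : inord 0 = ord0 :> 'I_a.+1 by [].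
by apply: val_inj; rewrite /= inordK.
Qed.
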